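(* Let $\lambda=(\lambda_1,\dots,\lambda_n)$ be a partition with at least one part equal to $0$, and let $x_1,\dots,x_n>0$ and $t\in[0,1)$. In the multispecies $t$-PushTASEP with content $\lambda$ and parameters $\mathbf{x}=(x_1,\dots,x_n)$, the stationary probability of a configuration $\eta\in S_\lambda$ is \[ \pi_\lambda(\eta)=\frac{F_\eta(\mathbf{x};1,t)}{P_\lambda(\mathbf{x};1,t)}, \] where $F_\eta(\mathbf{x};q,t)$ is the ASEP polynomial associated to $\eta$ and $P_\lambda(\mathbf{x};q,t)$ is the Macdonald polynomial associated to $\lambda$, both specialised at $q=1$.
   Context: Sites $1,\dots,n$ ($n\ge 2$) lie on a ring with clockwise order $1\to2\to\cdots\to n\to1$. For a partition $\lambda=(\lambda_1\ge\dots\ge\lambda_n\ge0)$, $S_\lambda$ is the set of compositions $\eta=(\eta_1,\dots,\eta_n)$ that are rearrangements of $\lambda$; $\eta_j$ is the species of the particle at site $j$, species $0$ meaning a vacancy. Write $[m]_t=1+t+\dots+t^{m-1}$. The multispecies $t$-PushTASEP with content $\lambda$ is the continuous-time Markov chain on $S_\lambda$ in which each site $j$ has an independent exponential clock (bell) of rate $1/x_j$. When the bell at $j$ rings in configuration $\eta$: if $\eta_j=0$ nothing changes. Otherwise the particle at $j$ (species $\eta_j$) becomes active. An active particle of species $r$ at site $p$ acts as follows: let $m$ be the number of parts of $\lambda$ smaller than $r$; list the $m$ sites $i$ with $\eta_i<r$ (values in the configuration before the bell rang) in clockwise order starting from the site after $p$; the particle moves to the $k$-th listed site with probability $t^{k-1}/[m]_t$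 and settles there, displacing the particle there; if the displaced species is nonzero, that particle becomes active at that site and repeats the procedure, otherwise the procedure stops. In the resulting configuration, site $j$ is vacant, each site where an active particle settled holds that particle, and all other sites are unchanged; this is a single transition. Nonsymmetric Macdonald polynomials: for $f\in\mathbb{Q}(q,t)[x_1,\dots,x_n]$ and $1\le i\le n-1$, $s_if$ swaps $x_i,x_{i+1}$; $L_if=\frac{tx_i-x_{i+1}}{x_i-x_{i+1}}(f-s_if)$; $T_if=tf-L_if$; $T_i^{-1}f=t^{-1}f-t^{-1}L_if$; $(\omega f)(x_1,\dots,x_n)=f(qx_n,x_1,\dots,x_{n-1})$; $Y_i=t^{-(i-1)}T_i^{-1}\cdots T_{n-1}^{-1}\,\omega\, T_1\cdots T_{i-1}$ for $1\le i\le n$. For a composition $\eta$ (an $n$-tuple of nonnegative integers) let $y_i(\eta)=q^{\eta_i}t^{-\#\{j>i:\eta_j\ge\eta_i\}-\#\{j<i:\eta_j>\eta_i\}}$. Let $\eta^+$ be the weakly decreasing rearrangement of $\eta$. For partitions of equal size, $\lambda\le\mu$ means $\lambda_1+\dots+\lambda_i\le\mu_1+\dots+\mu_i$ for all $i$; for compositions, $\eta\le\nu$ means either $\eta^+\le\nu^+$, or $\eta^+=\nu^+$ and $\eta_1+\dots+\eta_i\le\nu_1+\dots+\nu_i$ for all $i$. The nonsymmetric Macdonald polynomial $E_\eta(\mathbf{x};q,t)$ is the unique polynomial of the form $\sum_{\zeta\le\eta}v_{\eta,\zeta}(q,t)\mathbf{x}^\zeta$ with $v_{\eta,\eta}=1$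 such that $Y_iE_\eta=y_i(\eta)E_\eta$ for all $i$. ASEP polynomials: for a partition $\lambda$, $\{F_\eta(\mathbf{x};q,t)\}_{\eta\in S_\lambda}$ is the unique family of homogeneous degree-$|\lambda|$ polynomials in $x_1,\dots,x_n$ with coefficients in $\mathbb{Q}(q,t)$ such that $F_\lambda=E_\lambda$ and: $T_iF_\eta=F_{s_i\eta}$ when $\eta_i>\eta_{i+1}$ (where $s_i\eta$ swaps entries $i,i+1$); $T_iF_\eta=tF_\eta$ when $\eta_i=\eta_{i+1}$; and $q^{\eta_n}F_\eta(x_1,\dots,x_n)=F_{(\eta_n,\eta_1,\dots,\eta_{n-1})}(qx_n,x_1,\dots,x_{n-1})$. The Macdonald polynomial is $P_\lambda(\mathbf{x};q,t)=\sum_{\eta\in S_\lambda}F_\eta(\mathbf{x};q,t)$. *)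

(* Defs.v *)
From HB Require Import structures.
From mathcomp Require Import all_boot all_order all_fingroup all_algebra.
From mathcomp Require Import mpoly.
From mathcomp Require Import boolp classical_sets reals.

Set Implicit Arguments.
Unset Strict Implicit.
Unset Printing Implicit Defensive.

Import Order.TTheory GRing.Theory Num.Theory.
Local Open Scope ring_scope.

(* Sites and variables are indexed by 'I_n, i.e. by 0, ..., n - 1, the          *)
(* clockwise successor of site i being ordS i.  Compositions, configurations   *)
(* and exponents of monomials all have type 'X_{1..n}.                         *)

Definition is_partition n (lam : 'X_{1..n}) : Prop :=
  forall i j : 'I_n, (i <= j)%N -> (lam j <= lam i)%N.

(* S_lam, as a duplicate-free list *)
Definition rearr n (lam : 'X_{1..n}) : seq 'X_{1..n} :=
  undup [seq [multinom lam (s i) | i < n] | s : 'S_n].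

Definition swap_comp n (i : 'I_n) (eta : 'X_{1..n}) : 'X_{1..n} :=
  [multinom eta (tperm i (ordS i) j) | j < n].

(* (eta_n, eta_1, ..., eta_(n-1)) *)
Definition rot_comp n (eta : 'X_{1..n}) : 'X_{1..n} :=
  [multinom eta (ord_pred j) | j < n].

Section PushTASEP.
Variables (R : realType) (n : nat).
Variables (lam : 'X_{1..n}) (x : 'I_n -> R) (t : R).
Implicit Types (eta zeta sigma : 'X_{1..n}) (p i j : 'I_n).

Definition tint (m : nat) : R := \sum_(k < m) t ^+ k.

Definition set_site sigma i (r : nat) : 'X_{1..n} :=
  [multinom if k == i then r else sigma k | k < n].

(* the sites of species smaller than r, clockwise from the site after p *)
Definition lower_sites eta p (r : nat) : seq 'I_n :=
  [seq i <- rot p.+1 (enum 'I_n) | (eta i < r)%N].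

Definition jump_prob eta p (r : nat) i : R :=
  t ^+ index i (lower_sites eta p r) / tint (count (fun a => a < r)%N lam).

(* Probability that the cascade ends in zeta, when a particle of species r is  *)
(* active at p, eta is the configuration before the bell and sigma the current *)
(* one.  A particle of species 0 is never active, so r = 0 means that the      *)
(* procedure has stopped.  The active species strictly decreases, hence the    *)
(* bound fuel on the number of moves is never hit as long as r <= fuel.        *)
Fixpoint cascade (fuel : nat) eta sigma p (r : nat) zeta : R :=
  if r == 0%N then (sigma == zeta)%:R else
  if fuel is fuel'.+1 then
    \sum_(i <- lower_sites eta p r)
      jump_prob eta p r i *
      cascade fuel' eta (set_site sigma i r) i (eta i) zeta
  else 0.

Definition bell_prob j eta zeta : R :=
  cascade (eta j) eta (set_site eta j 0) j (eta j) zeta.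

Definition rate eta zeta : R := \sum_(j < n) (x j)^-1 * bell_prob j eta zeta.

(* pi is a probability distribution on S_lam with pi Q = 0, for Q the          *)
(* generator of the chain; only the values of pi on S_lam matter.              *)
Definition stationary (pi : 'X_{1..n} -> R) : Prop :=
  [/\ forall eta, eta \in rearr lam -> 0 <= pi eta,
      \sum_(eta <- rearr lam) pi eta = 1 &
      forall zeta, zeta \in rearr lam ->
        \sum_(eta <- rearr lam | eta != zeta) pi eta * rate eta zeta =
        pi zeta * \sum_(eta <- rearr lam | eta != zeta) rate zeta eta].

End PushTASEP.

Lemma ddiff_exists n (K : comNzRingType) (i j : 'I_n) (f : {mpoly K[n]}) :
  exists g : {mpoly K[n]}, ('X_i - 'X_j) * g == f - msym (tperm i j) f.
Proof.
pose P (f : {mpoly K[n]}) :=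
  exists g : {mpoly K[n]}, ('X_i - 'X_j) * g == f - msym (tperm i j) f.
have P0 c : P c%:MP by exists 0; rewrite mulr0 -[c%:MP]mulr1 mul_mpolyC msymZ msym1 subrr.
have PD f1 f2 : P f1 -> P f2 -> P (f1 + f2).
  move=> [g1 /eqP e1] [g2 /eqP e2]; exists (g1 + g2).
  by rewrite mulrDr e1 e2 msymD opprD addrACA.
have PM f1 f2 : P f1 -> P f2 -> P (f1 * f2).
  move=> [g1 /eqP e1] [g2 /eqP e2].
  exists (g1 * f2 + msym (tperm i j) f1 * g2).
  rewrite mulrDr mulrA e1 mulrCA e2 msymM mulrBl mulrBr.
  by rewrite addrA subrK.
have PX k : P 'X_k.
  rewrite /P msymX.
  have -> : [multinom U_(k)%MM ((tperm i j)^-1%g l) | l < n]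
            = U_(tperm i j k)%MM :> 'X_{1..n}.
    apply/mnmP=> l; rewrite mnmE !mnm1E tpermV.
    by rewrite -(inj_eq (@perm_inj _ (tperm i j))) tpermK.
  case: tpermP => [->|->|_ _].
  - by exists 1; rewrite mulr1.
  - by exists (-1); rewrite mulrN1 opprB.
  - by exists 0; rewrite mulr0 subrr.
have PXm m : P 'X_[m].
  rewrite mpolyXE_id; apply: (big_ind P) => [|//|k _]; first by rewrite -mpolyC1.
  elim: (m k) => [|d IH]; first by rewrite expr0 -mpolyC1.
  by rewrite exprS; apply: PM.
rewrite -/(P f) (mpolyE f); apply: (big_ind P) => [|//|m _].
  by rewrite -mpolyC0.
by rewrite -mul_mpolyC; apply: PM.
Qed.

Section Operators.
Variables (K : fieldType) (q t : K) (n : nat).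
Implicit Types (f : {mpoly K[n]}) (eta nu : 'X_{1..n}) (i j : 'I_n).

(* (f - s_i f) / (x_i - x_(i+1)) *)
Definition ddiff i f : {mpoly K[n]} := xchoose (ddiff_exists i (ordS i) f).

(* Only used for i.+1 < n: otherwise ordS i wraps around. *)
Definition opL i f : {mpoly K[n]} :=
  (t *: 'X_i - 'X_(ordS i)) * ddiff i f.

Definition opT i f : {mpoly K[n]} := t *: f - opL i f.

Definition opTinv i f : {mpoly K[n]} := t^-1 *: f - t^-1 *: opL i f.

(* f(q x_n, x_1, ..., x_(n-1)) *)
Definition omega f : {mpoly K[n]} :=
  f \mPo [tuple (if i == 0%N :> nat then q else 1) *: 'X_(ord_pred i) | i < n].

Definition opY i f : {mpoly K[n]} :=
  t ^- i *:
  foldr opTinv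
    (omega (foldr opT f [seq k : 'I_n <- enum 'I_n | (k < i)%N]))
    [seq k : 'I_n <- enum 'I_n | (i <= k)%N & (k.+1 < n)%N].

Definition eigval i eta : K :=
  q ^+ eta i *
  t ^- (#|[set j : 'I_n | (i < j)%N && (eta i <= eta j)%N]| +
         #|[set j : 'I_n | (j < i)%N && (eta i < eta j)%N]|).

Definition psum_le (a b : seq nat) : Prop :=
  forall k, (sumn (take k a) <= sumn (take k b))%N.

Definition dominance (a b : seq nat) : Prop := sumn a = sumn b /\ psum_le a b.

Definition plus_part eta : seq nat := sort geq eta.

Definition comp_le eta nu : Prop :=
  dominance (plus_part eta) (plus_part nu) \/
  plus_part eta = plus_part nu /\ psum_le eta nu.

(* E is the nonsymmetric Macdonald polynomial E_eta *)
Definition is_nsMacdonald eta (E : {mpoly K[n]}) : Prop :=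
  [/\ forall zeta, zeta \in msupp E -> comp_le zeta eta,
      E@_eta = 1 &
      forall i, opY i E = eigval i eta *: E].

(* F eta is the ASEP polynomial F_eta, for all eta in S_lam *)
Record is_ASEP_family (lam : 'X_{1..n}) (F : 'X_{1..n} -> {mpoly K[n]}) :
    Prop := {
  ASEP_homog : forall eta, eta \in rearr lam -> F eta \is (mdeg lam).-homog;
  ASEP_init : is_nsMacdonald lam (F lam);
  ASEP_swap : forall eta i, eta \in rearr lam -> (i.+1 < n)%N ->
    (eta (ordS i) < eta i)%N -> opT i (F eta) = F (swap_comp i eta);
  ASEP_fix : forall eta i, eta \in rearr lam -> (i.+1 < n)%N ->
    eta i = eta (ordS i) -> opT i (F eta) = t *: F eta;
  ASEP_rot : forall eta i, eta \in rearr lam -> i.+1 = n ->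
    q ^+ eta i *: F eta = omega (F (rot_comp eta))
}.

Definition MacdonaldP (lam : 'X_{1..n}) (F : 'X_{1..n} -> {mpoly K[n]}) :
  {mpoly K[n]} := \sum_(eta <- rearr lam) F eta.

End Operators.

(* Q(q,t), as the fraction field of Q[t][q] *)
Definition Qqt : fieldType := {fraction {poly {poly rat}}}.
Definition Kq : Qqt := tofrac 'X.
Definition Kt : Qqt := tofrac 'X%:P.

Section Specialisation.
Variables (R : realType) (t : R).

(* value of a polynomial in q and t at q = 1 and the real number t *)
Definition eval_q1 (a : {poly {poly rat}}) : R := (map_poly ratr a.[1]).[t].

Definition spec_q1_to (r : Qqt) (v : R) : Prop :=
  exists a b : {poly {poly rat}},
    [/\ eval_q1 b != 0, r = (tofrac a : Qqt) / (tofrac b : Qqt) &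
        v = eval_q1 a / eval_q1 b].

Definition regular_q1 (r : Qqt) : Prop := exists v, spec_q1_to r v.

(* meaningful when regular_q1 r; 0 otherwise *)
Definition spec_q1 (r : Qqt) : R := xget 0 [set v | spec_q1_to r v]%classic.

(* f(x; 1, t) *)
Definition value_q1 n (x : 'I_n -> R) (f : {mpoly Qqt[n]}) : R :=
  mmap spec_q1 x f.

End Specialisation.

(* Main.v *)
Require Import Defs.
From HB Require Import structures.
From mathcomp Require Import all_boot all_order all_fingroup all_algebra.
From mathcomp Require Import mpoly.
From mathcomp Require Import boolp classical_sets reals.
From mathcomp Require Import zify ring lra.

Set Implicit Arguments.
Unset Strict Implicit.
Unset Printing Implicit Defensive.

Import Order.TTheory GRing.Theory Num.Theory.
Local Open Scope ring_scope.

(**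
The polynomials F_eta at q = 1 satisfy the exchange relations
F(s_i x) = F(x) R_i(x) and a rotation relation.  Each bell is the fixed point of
a tour of the active particle around the ring, on which the R_i act as
intertwiners: R_i(x) M(s_i x) = M(x) R_i(x) for the transition operator M(x).
When x_n exceeds the other x_j, the cycle of n - 1 swaps and one rotation is a
stochastic operator that fixes both F and F M, and its irreducibility gives
F M = kappa F; both sides being rational in x_n, this holds for all x > 0.

Regularity at q = 1 does not follow from the definition of E_lam.  A weight
vector of weight lam is built by removing one box from each nonzero part of lam
and applying the intertwiners T_i + c and f |-> x_1 f(x_2, ..., x_n, x_1 / q).
At q = 1 it is x_1 ... x_k times a combination of the smaller family with
nonnegative regular coefficients, hence at least x^lam on positive x, so its
coefficient at x^lam does not vanish at q = 1.  Weight spaces being lines, as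
the limit t -> 1 shows, the normalised vector is E_lam.
*)

(** * Cherednik operators over a domain *)

(** The chain is used twice: it receives its stationary law from the polynomials, and it helps to
    construct them. At real t the values F_eta(x; 1, t) have no evident sign. Once the exchange
    relations hold for one content, Perron's argument for the chain of that content makes its whole
    family nonnegative, and this is what lets the lower bound x^lam pass to the next content. No
    pole at q = 1 arises on the way, because each denominator 1 - q^a t^b has b > 0 and t < 1. The
    bound speaks of values and not of coefficients; it is read along points where x^lam outgrows
    every smaller monomial.

    Two specialisations go in opposite directions. At t = 1 with q generic the Y_i are diagonal on
    monomials and separate them, which settles uniqueness; q = 1 with t real gives the values. Both
    are treated by one relation [Rel] between a polynomial and its specialisation, preserved by all
    the operators. This also covers t = 0, where T_i is not invertible and the exchange relations
    come by specialising those at generic t. *)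

Lemma ordS_val n (i : 'I_n) : (i.+1 < n)%N -> ordS i = i.+1 :> nat.
Proof. by move=> h /=; rewrite modn_small. Qed.

Lemma ordS_neq n (i : 'I_n) : (i.+1 < n)%N -> i != ordS i.
Proof. by move=> h; apply/eqP => e; have := ordS_val h; rewrite -e; lia. Qed.

Lemma ord_pred_val n (i : 'I_n) : (0 < i)%N -> ord_pred i = i.-1 :> nat.
Proof.
move=> h /=; have hi := ltn_ord i.
have -> : (i + n).-1 = (i.-1 + n)%N by lia.
by rewrite modnDr modn_small //; lia.
Qed.

Lemma ord_pred_val0 n (i : 'I_n) : i = 0%N :> nat -> ord_pred i = n.-1 :> nat.
Proof. by move=> h /=; have hi := ltn_ord i; rewrite h add0n modn_small //; lia. Qed.

Lemma ord_neq n (i j : 'I_n) : (i : nat) <> j -> i != j.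
Proof. by move=> h; apply/eqP => e; apply: h; rewrite e. Qed.

Section OrdLists.
Variable n : nat.
Implicit Types (i j k : 'I_n).

(** [ilo i] indexes the factors T to the right of omega in Y_i, and [ihi i] the inverse factors to
    its left. *)
Definition ilo i : seq 'I_n := [seq k : 'I_n <- enum 'I_n | (k < i)%N].
Definition ihi i : seq 'I_n := [seq k : 'I_n <- enum 'I_n | (i <= k)%N & (k.+1 < n)%N].

Lemma val_filter_enum (p : pred nat) :
  map val [seq k : 'I_n <- enum 'I_n | p k] = [seq k <- iota 0 n | p k].
Proof. by rewrite -val_enum_ord filter_map. Qed.

Lemma filter_iota_lt a m : (a <= m)%N -> [seq k <- iota 0 m | (k < a)%N] = iota 0 a.
Proof.
move=> h; rewrite -(subnKC h) iotaD filter_cat add0n.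
rewrite (@eq_in_filter _ _ xpredT) ?filter_predT; last first.
  by move=> k; rewrite mem_iota => /andP[_ ->].
rewrite (@eq_in_filter _ _ pred0) ?filter_pred0 ?cats0 //.
by move=> k; rewrite mem_iota => /andP[h1 _]; rewrite ltnNge h1.
Qed.

Lemma val_lo i : map val (ilo i) = iota 0 i.
Proof. by rewrite (@val_filter_enum (fun m => (m < i)%N)) filter_iota_lt // ltnW. Qed.

Lemma val_hi i : map val (ihi i) = iota i (n.-1 - i).
Proof.
rewrite (@val_filter_enum (fun m => (i <= m)%N && (m.+1 < n)%N)).
have hn := ltn_ord i; have e : n = (i + (n.-1 - i) + 1)%N by lia.
rewrite [in iota 0 n]e !iotaD !filter_cat !add0n.
rewrite (@eq_in_filter _ _ pred0) ?filter_pred0; last first.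
  by move=> k; rewrite mem_iota /= add0n => h; apply/negbTE/negP => /andP[]; lia.
rewrite (@eq_in_filter _ _ xpredT) ?filter_predT; last first.
  by move=> k; rewrite mem_iota /= => /andP[h1 h2]; rewrite h1 /=; lia.
rewrite (@eq_in_filter _ _ pred0) ?filter_pred0 ?cats0 //.
by move=> k; rewrite mem_iota /= => h; apply/negbTE/negP => /andP[]; lia.
Qed.

Lemma lo0 i : i = 0%N :> nat -> ilo i = [::].
Proof. by move=> h; apply: (inj_map val_inj); rewrite val_lo h. Qed.

Lemma lo_S i : (i.+1 < n)%N -> ilo (ordS i) = rcons (ilo i) i.
Proof.
move=> h; apply: (inj_map val_inj).
by rewrite map_rcons !val_lo ordS_val // -addn1 iotaD cats1.
Qed.

Lemma hi_S i : (i.+1 < n)%N -> ihi i = i :: ihi (ordS i).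
Proof.
move=> h; apply: (inj_map val_inj); rewrite /= !val_hi ordS_val //.
by have -> : (n.-1 - i)%N = (n.-1 - i.+1).+1 by lia.
Qed.

Lemma hi_last i : i.+1 = n -> ihi i = [::].
Proof.
by move=> h; apply: (inj_map val_inj); rewrite val_hi; have -> : (n.-1 - i)%N = 0%N by lia.
Qed.

Lemma hi_mem i k : k \in ihi i -> (i <= k)%N && (k.+1 < n)%N.
Proof. by rewrite mem_filter => /andP[]. Qed.

Lemma lo_mem i k : k \in ilo i -> (k < i)%N && (k.+1 < n)%N.
Proof. by rewrite mem_filter => /andP[h _]; have := ltn_ord i; lia. Qed.

End OrdLists.

Section DAHA.
Variables (K : fieldType) (n : nat) (A : idomainType) (C : {rmorphism K -> A}).
Variables (q t : K) (X : 'I_n -> A) (S : 'I_n -> {rmorphism A -> A}).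
Variables (T : 'I_n -> A -> A) (W Wi : {rmorphism A -> A}).
Implicit Types (f g : A) (i j k : 'I_n) (c : K).
Local Notation tm := (C t).

(** The algebra is generated over K by the [X k]: an identity between operators is checked on 1 and
    propagated through multiplication by each [X k]. *)
Hypothesis gen_ind : forall P : A -> Prop, P 1 ->
  (forall f g, P f -> P g -> P (f + g)) -> (forall c f, P f -> P (C c * f)) ->
  (forall k f, P f -> P (X k * f)) -> forall f, P f.
Hypothesis DX_neq0 : forall i, (i.+1 < n)%N -> X i - X (ordS i) != 0.
Hypothesis S_C : forall i c, S i (C c) = C c.
Hypothesis S_X : forall i k, S i (X k) = X (tperm i (ordS i) k).
(** T_i enters only through its definition cleared of the denominator x_i - x_(i+1); in a domain
    this determines it ([T_uniq]). *)
Hypothesis T_E : forall i f, (X i - X (ordS i)) * T i f =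
  (1 - tm) * X (ordS i) * f + (tm * X i - X (ordS i)) * S i f.
Hypothesis W_C : forall c, W (C c) = C c.
Hypothesis W_X : forall k,
  W (X k) = C (if k == 0%N :> nat then q else 1) * X (ord_pred k).
Hypothesis WK : cancel W Wi.
Hypothesis WiK : cancel Wi W.
Hypothesis t_neq0 : t != 0.
Hypothesis q_neq0 : q != 0.

Lemma rmorph_gen_ext (F G : {rmorphism A -> A}) :
  (forall c, F (C c) = G (C c)) -> (forall k, F (X k) = G (X k)) -> F =1 G.
Proof.
move=> hC hX; elim/gen_ind => [|f g e1 e2|c f e|k f e].
- by rewrite !rmorph1.
- by rewrite !rmorphD e1 e2.
- by rewrite !rmorphM hC e.
- by rewrite !rmorphM hX e.
Qed.

Lemma S_K i f : S i (S i f) = f.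
Proof.
apply: (@rmorph_gen_ext (S i \o S i) idfun) => [c|k] /=.
- by rewrite !S_C.
- by rewrite !S_X tpermK.
Qed.

Lemma T_uniq i f g : (i.+1 < n)%N ->
  (X i - X (ordS i)) * g =
    (1 - tm) * X (ordS i) * f + (tm * X i - X (ordS i)) * S i f ->
  T i f = g.
Proof. by move=> h e; apply: (mulfI (DX_neq0 h)); rewrite e T_E. Qed.

Section One.
Variable i : 'I_n.
Hypothesis hi : (i.+1 < n)%N.

Lemma TD f g : T i (f + g) = T i f + T i g.
Proof. by apply: (T_uniq hi); rewrite mulrDr !T_E rmorphD; ring. Qed.

Lemma TM_sym f g : S i g = g -> T i (g * f) = g * T i f.
Proof. by move=> e; apply: (T_uniq hi); rewrite mulrCA !T_E rmorphM e; ring. Qed.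

Lemma TC c f : T i (C c * f) = C c * T i f.
Proof. by apply: TM_sym; rewrite S_C. Qed.

Lemma Tu f : T i ((1 - tm) * f) = (1 - tm) * T i f.
Proof. by apply: TM_sym; rewrite rmorphB rmorph1 S_C. Qed.

Lemma TN f : T i (- f) = - T i f.
Proof. by rewrite -mulN1r TM_sym ?mulN1r // rmorphN rmorph1. Qed.

Lemma TB f g : T i (f - g) = T i f - T i g.
Proof. by rewrite TD TN. Qed.

Lemma T_of_sym f : S i f = f -> T i f = tm * f.
Proof. by move=> e; apply: (T_uniq hi); rewrite e; ring. Qed.

Lemma T1 : T i 1 = tm.
Proof. by rewrite T_of_sym ?rmorph1 // mulr1. Qed.

Lemma TX f : T i (X i * f) = X (ordS i) * (T i f + (1 - tm) * f).
Proof. by apply: (T_uniq hi); rewrite mulrCA mulrDr T_E rmorphM S_X tpermL; ring. Qed.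

Lemma TXS f : T i (X (ordS i) * f) = X i * T i f - (1 - tm) * (X (ordS i) * f).
Proof.
apply: (T_uniq hi); rewrite mulrBr mulrCA T_E rmorphM S_X tpermR; ring.
Qed.

Lemma TX_other k f : k != i -> k != ordS i -> T i (X k * f) = X k * T i f.
Proof. by move=> h1 h2; apply: TM_sym; rewrite S_X tpermD // eq_sym. Qed.

Lemma T_quad f : T i (T i f) = (tm - 1) * T i f + tm * f.
Proof.
apply: (T_uniq hi); apply: (mulfI (DX_neq0 hi)).
have e : (X i - X (ordS i)) * S i (T i f) =
    - ((1 - tm) * X i * S i f + (tm * X (ordS i) - X i) * f).
  have := congr1 (S i) (T_E i f).
  rewrite !(rmorphM, rmorphD, rmorphB, rmorphN, rmorph1) !S_X !S_C tpermL tpermR S_K => e.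
  by rewrite -e; ring.
have e1 := T_E i f; set a := T i f in e e1 *; set b := S i a in e *.
transitivity (((X i - X (ordS i)) * a) * ((tm - 1) * (X i - X (ordS i)))
   + (X i - X (ordS i)) ^+ 2 * tm * f); first by ring.
transitivity ((1 - tm) * X (ordS i) * ((X i - X (ordS i)) * a)
   + (tm * X i - X (ordS i)) * ((X i - X (ordS i)) * b)); last by ring.
by rewrite e e1; ring.
Qed.

(** The inverse of T_i, read off from the quadratic relation. *)
Definition Ti f := C t^-1 * (T i f + (1 - tm) * f).

Lemma tmV : C t^-1 * tm = 1.
Proof. by rewrite -rmorphM mulVf ?rmorph1. Qed.

Lemma TiK f : T i (Ti f) = f.
Proof.
rewrite /Ti TC TD Tu T_quad.
transitivity ((C t^-1 * tm) * f); first by ring.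
by rewrite tmV mul1r.
Qed.

Lemma TKi f : Ti (T i f) = f.
Proof.
rewrite /Ti T_quad; transitivity ((C t^-1 * tm) * f); first by ring.
by rewrite tmV mul1r.
Qed.

Lemma tmTi f : tm * Ti f = T i f + (1 - tm) * f.
Proof. by rewrite /Ti mulrA [tm * _]mulrC tmV mul1r. Qed.

Lemma TiC c f : Ti (C c * f) = C c * Ti f.
Proof. by rewrite /Ti TC; ring. Qed.

Lemma TiXS f : Ti (X (ordS i) * f) = C t^-1 * (X i * T i f).
Proof. by rewrite /Ti TXS; ring. Qed.

Lemma TiX_other k f : k != i -> k != ordS i -> Ti (X k * f) = X k * Ti f.
Proof. by move=> h1 h2; rewrite /Ti TX_other //; ring. Qed.

End One.

Lemma T_comm i j f : (i.+1 < j)%N -> (j.+1 < n)%N -> T i (T j f) = T j (T i f).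
Proof.
move=> hij hj; have hi : (i.+1 < n)%N by lia.
have Si := ordS_val hi; have Sj := ordS_val hj.
elim/gen_ind: f => [|f g ef eg|c f ef|k f ef].
- by rewrite !T1 // -[tm]mulr1 !TC // !T1.
- by rewrite !TD // ef eg.
- by rewrite !TC // ef.
have ji : (j != i) && (j != ordS i) by rewrite !ord_neq ?Si //; lia.
have Sji : (ordS j != i) && (ordS j != ordS i) by rewrite !ord_neq ?Si ?Sj //; lia.
case/andP: ji => n1 n2; case/andP: Sji => n3 n4.
have [->|nki] := eqVneq k i.
  rewrite [T j (X i * f)]TX_other 1?eq_sym // !TX // TX_other 1?eq_sym //.
  by rewrite TD // Tu // ef.
have [->|nkSi] := eqVneq k (ordS i).
  rewrite [T j (X (ordS i) * f)]TX_other 1?eq_sym // !TXS // TB // Tu //.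
  by rewrite !TX_other 1?eq_sym // ef.
have [->|nkj] := eqVneq k j.
  by rewrite [T i (X j * f)]TX_other // !TX // TX_other // TD // Tu // ef.
have [->|nkSj] := eqVneq k (ordS j).
  rewrite [T i (X (ordS j) * f)]TX_other // !TXS // TB // Tu //.
  by rewrite !TX_other // ef.
by rewrite !TX_other // ef.
Qed.

(** Induction on f: each of the three variables concerned is pushed through both triple products,
    and the extra terms agree by the quadratic relation. The other variables commute with both
    generators. *)
Lemma T_braid i f (j := ordS i) : (i.+2 < n)%N ->
  T i (T j (T i f)) = T j (T i (T j f)).
Proof.
rewrite {}/j => hn; have hi : (i.+1 < n)%N by lia.
have Si : ordS i = i.+1 :> nat := ordS_val hi.
have hj : ((ordS i).+1 < n)%N by rewrite Si.
have Sj : ordS (ordS i) = i.+2 :> nat by rewrite (ordS_val hj) Si.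
set j := ordS i in hj Si Sj *.
have n1 : (ordS j != i) && (ordS j != ordS i) by rewrite !ord_neq ?Sj ?Si //; lia.
have n2 : (i != j) && (i != ordS j) by rewrite !ord_neq ?Sj ?Si //; lia.
have Tij g : T i (X (ordS j) * g) = X (ordS j) * T i g by case/andP: n1; exact: TX_other.
have Tji g : T j (X i * g) = X i * T j g by case/andP: n2; exact: TX_other.
have TX1 g : T i (X i * g) = X j * (T i g + (1 - tm) * g) by exact: TX.
have TX2 g : T j (X j * g) = X (ordS j) * (T j g + (1 - tm) * g) by exact: TX.
have TXS1 g : T i (X j * g) = X i * T i g - (1 - tm) * (X j * g) by exact: TXS.
have TXS2 g : T j (X (ordS j) * g) = X j * T j g - (1 - tm) * (X (ordS j) * g).
  exact: TXS.
have Tu1 := Tu hi; have Tu2 := Tu hj.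
elim/gen_ind: f => [|f g ef eg|c f ef|k f ef].
- by rewrite !T1 // -[tm]mulr1 !TC // !T1 // -[tm]mulr1 !TC // !T1.
- by rewrite !TD // ef eg.
- by rewrite !TC // ef.
have qi : T i (T i f) = (tm - 1) * T i f + tm * f by rewrite T_quad.
have qj : T j (T j f) = (tm - 1) * T j f + tm * f by rewrite T_quad.
have qij : T i (T i (T j f)) = (tm - 1) * T i (T j f) + tm * T j f by rewrite T_quad.
have qji : T j (T j (T i f)) = (tm - 1) * T j (T i f) + tm * T i f by rewrite T_quad.
have [->|nki] := eqVneq k i.
  rewrite !(TX1, Tji, TX2, Tij, TD) // !(Tu1, Tu2, TD) // ef.
  by rewrite qi qj; ring.
have [->|nkj] := eqVneq k j.
  rewrite !(TXS1, TXS2, TX1, TX2, Tij, Tji, TD hi, TD hj, TN hi, TN hj, Tu1, Tu2).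
  by rewrite ?ef ?qi ?qj ?qij ?qji; ring.
have [->|nkSj] := eqVneq k (ordS j).
  rewrite !(TXS1, TXS2, TX1, TX2, Tij, Tji, TD hi, TD hj, TN hi, TN hj, Tu1, Tu2).
  by rewrite ?ef ?qi ?qj ?qij ?qji; ring.
have Tk a g : (a == i) || (a == j) -> T a (X k * g) = X k * T a g.
  by case/orP => /eqP ->; apply: TX_other.
by rewrite !Tk ?eqxx ?orbT // ef.
Qed.

Lemma WT i f : (i.+2 < n)%N -> W (T (ordS i) f) = T i (W f).
Proof.
move=> hn; have hi : (i.+1 < n)%N by lia.
have Si : ordS i = i.+1 :> nat := ordS_val hi.
have hj : ((ordS i).+1 < n)%N by rewrite Si.
have Sj : ordS (ordS i) = i.+2 :> nat by rewrite (ordS_val hj) Si.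
have WX1 : W (X (ordS i)) = X i by rewrite W_X Si /= rmorph1 mul1r ordSK.
have WX2 : W (X (ordS (ordS i))) = X (ordS i) by rewrite W_X Sj /= rmorph1 mul1r ordSK.
have WS g : W (S (ordS i) g) = S i (W g).
  apply: (@rmorph_gen_ext (W \o S (ordS i)) (S i \o W)) => [c|k] /=.
    by rewrite S_C !W_C S_C.
  rewrite S_X W_X [in RHS]W_X rmorphM S_C S_X.
  case: (tpermP (ordS i) (ordS (ordS i)) k) => [->|->|/eqP n1 /eqP n2].
  - by rewrite Si Sj /= !ordSK tpermL.
  - by rewrite Si Sj /= !ordSK tpermR.
  congr (_ * X _); rewrite tpermD //.
  - by apply: contra n1 => /eqP ->; rewrite ord_predK.
  - by apply: contra n2 => /eqP ->; rewrite ord_predK.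
apply/esym/(T_uniq hi); have := congr1 W (T_E (ordS i) f).
by rewrite !(rmorphM, rmorphD, rmorphN, rmorph1) W_C WX1 WX2 WS.
Qed.

Lemma WiT i f : (i.+2 < n)%N -> Wi (T i f) = T (ordS i) (Wi f).
Proof. by move=> h; apply: (can_inj WK); rewrite WT // !WiK. Qed.

Lemma WiTi i f : (i.+2 < n)%N -> Wi (Ti i f) = Ti (ordS i) (Wi f).
Proof.
have WiC c : Wi (C c) = C c by apply: (can_inj WK); rewrite WiK W_C.
by move=> h; rewrite /Ti rmorphM rmorphD rmorphM rmorphB rmorph1 !WiC WiT.
Qed.

(** The relation of the affine Hecke algebra across the end of the line: omega^2 carries x_1, x_2 to
    q x_(n-1), q x_n. As both acquire the same factor q, it cancels from [T_E], which is homogeneous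
    in the variables. *)
Lemma W2T i j f : i = 0%N :> nat -> j.+2 = n ->
  W (W (T i f)) = T j (W (W f)).
Proof.
move=> i0 jn; have hi : (i.+1 < n)%N by lia.
have hj : (j.+1 < n)%N by lia.
have Si := ordS_val hi; have Sj := ordS_val hj.
have lj : ord_pred i = ordS j by apply: ord_inj; rewrite (ord_pred_val0 i0) Sj; lia.
have WWX k : W (W (X k)) =
    C (if (k < 2)%N then q else 1) * X (ord_pred (ord_pred k)).
  rewrite W_X rmorphM W_C W_X mulrA -rmorphM; congr (C _ * _).
  have [k0|k0] := posnP k.
    rewrite (ord_pred_val0 k0); case: eqP => [e|_]; first lia.
    by rewrite k0 mulr1.
  by rewrite (ord_pred_val k0) mul1r; case: eqP => e; case: ltnP => // e'; lia.
have pi : ord_pred (ord_pred i) = j by rewrite lj ordSK.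
have pSi : ord_pred (ord_pred (ordS i)) = ordS j by rewrite ordSK lj.
have WS g : W (W (S i g)) = S j (W (W g)).
  apply: (@rmorph_gen_ext (W \o (W \o S i)) (S j \o (W \o W))) => [c|k] /=.
    by rewrite S_C !W_C S_C.
  rewrite S_X !WWX rmorphM S_C S_X.
  case: (tpermP i (ordS i) k) => [->|->|/eqP n1 /eqP n2].
  - by rewrite pi pSi tpermL Si i0.
  - by rewrite pi pSi tpermR Si i0.
  congr (_ * X _); rewrite tpermD //.
  - by rewrite -pi; apply: contra n1 => /eqP /(can_inj (@ord_predK _)) /(can_inj (@ord_predK _)) ->.
  - by rewrite -pSi; apply: contra n2 => /eqP /(can_inj (@ord_predK _)) /(can_inj (@ord_predK _)) ->.
apply/esym/(T_uniq hj).
have Cq : C q != 0 by rewrite fmorph_eq0.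
have := congr1 (W \o W) (T_E i f) => /=.
rewrite !(rmorphM, rmorphD, rmorphN, rmorph1) !W_C WS !WWX pi pSi Si i0 /= => e.
by apply: (mulfI Cq); rewrite mulrA mulrBr e; ring.
Qed.

Definition Y i f := C (t ^- i) * foldr Ti (W (foldr T f (ilo i))) (ihi i).

Lemma foldr_mul (F : 'I_n -> A -> A) (s : seq 'I_n) a f :
  (forall k g, k \in s -> F k (a * g) = a * F k g) ->
  foldr F (a * f) s = a * foldr F f s.
Proof.
elim: s => //= k s IH h; rewrite IH ?h ?mem_head // => j g js.
by apply: h; rewrite inE js orbT.
Qed.

Lemma foldr_comm (F : 'I_n -> A -> A) (s : seq 'I_n) (G : A -> A) f :
  (forall k g, k \in s -> F k (G g) = G (F k g)) ->
  foldr F (G f) s = G (foldr F f s).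
Proof.
elim: s => //= k s IH h; rewrite IH ?h ?mem_head // => j g js.
by apply: h; rewrite inE js orbT.
Qed.

Lemma YC i c f : Y i (C c * f) = C c * Y i f.
Proof.
rewrite /Y foldr_mul => [|k g /lo_mem /andP[_ h]]; last by rewrite TC.
rewrite rmorphM W_C foldr_mul => [|k g /hi_mem /andP[_ h]]; last by rewrite TiC.
by ring.
Qed.

Lemma foldr_add (F : 'I_n -> A -> A) (s : seq 'I_n) f g :
  (forall k f g, k \in s -> F k (f + g) = F k f + F k g) ->
  foldr F (f + g) s = foldr F f s + foldr F g s.
Proof.
elim: s => //= k s IH h; rewrite IH ?h ?mem_head // => j f' g' js.
by apply: h; rewrite inE js orbT.
Qed.

Lemma YD i f g : Y i (f + g) = Y i f + Y i g.
Proof.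
rewrite /Y foldr_add => [|k f' g' /lo_mem /andP[_ h]]; last by rewrite TD.
rewrite rmorphD foldr_add => [|k f' g' /hi_mem /andP[_ h]]; last by rewrite /Ti TD //; ring.
by ring.
Qed.

(** The outer T_i cancels the outermost inverse factor of Y_i and the inner one extends the product
    after omega. Through this recursion facts on Y_1 spread to all Y_i. *)
Lemma Y_rec i f : (i.+1 < n)%N -> T i (Y i (T i f)) = tm * Y (ordS i) f.
Proof.
move=> h; rewrite /Y lo_S // foldr_rcons hi_S // [foldr _ _ (_ :: _)]/= TC // TiK //.
by rewrite mulrA -rmorphM ordS_val // exprS invfM mulVKf.
Qed.

(** By the braid relation T_(i+1) crosses the inverse factors and comes out as T_i; omega then turns
    T_i back into T_(i+1) by [WT]. This is why Y_1 commutes with it. *)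
Lemma foldTi_comm j i i' f : (i'.+1 < n)%N -> i' = i.+1 :> nat -> (j <= i)%N ->
  T i' (foldr Ti f (ihi j)) = foldr Ti (T i f) (ihi j).
Proof.
move=> h' ei hj; have h : (i.+1 < n)%N by lia.
have ei' : i' = ordS i by apply: ord_inj; rewrite ordS_val.
have [d] := ubnP (i - j)%N; elim: d j hj => // d IH j hj hd.
have hjn : (j.+1 < n)%N by lia.
rewrite hi_S //=; have [e|ne] := eqVneq (j : nat) i.
  have {}e : j = i by apply: ord_inj.
  rewrite e -ei' hi_S //=; set g := foldr Ti f _.
  have -> : foldr Ti (T i f) (ihi (ordS i')) = T i g.
    rewrite /g foldr_comm // => k u /hi_mem /andP[h1 h2].
    move: h1; rewrite ordS_val // => h1.
    by rewrite /Ti -T_comm; [rewrite TC // TD // Tu|lia|lia].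
  have br u : T i (T i' (T i u)) = T i' (T i (T i' u)) by rewrite ei' T_braid //; lia.
  apply: (can_inj (TKi h)); apply: (can_inj (TKi h')).
  by rewrite TiK // TiK // -br TiK // TiK.
have hij : (ordS j <= i)%N by rewrite ordS_val //; lia.
rewrite -IH //; last by rewrite ordS_val //; lia.
by rewrite /Ti TC // TD // Tu // -T_comm //; lia.
Qed.

Lemma Y0_T j i f : j = 0%N :> nat -> (0 < i)%N -> (i.+1 < n)%N ->
  Y j (T i f) = T i (Y j f).
Proof.
move=> j0 i0 h; rewrite /Y lo0 //= TC //; congr (_ * _).
have e : i = ordS (ord_pred i) by rewrite ord_predK.
have ep := ord_pred_val i0.
rewrite (@foldTi_comm j (ord_pred i)) //; [|by lia|by lia].
by congr foldr; rewrite {1}e WT //; lia.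
Qed.

Lemma tm_neq0 : tm != 0.
Proof. by rewrite fmorph_eq0. Qed.

Lemma Y_T_lt j i f : (j < i)%N -> (i.+1 < n)%N -> Y j (T i f) = T i (Y j f).
Proof.
have [m] := ubnP j; elim: m j f => // m IH j f hm hji h.
have [j0|jp] := posnP j; first by apply: Y0_T; lia.
have e : j = ordS (ord_pred j) by rewrite ord_predK.
have ep := ord_pred_val jp; set p := ord_pred j in e ep.
have hp : (p.+1 < n)%N by lia.
apply: (mulfI tm_neq0); rewrite -TC // e -!Y_rec // [in LHS]T_comm //; [|lia].
rewrite IH //; [|lia|lia].
by rewrite T_comm //; lia.
Qed.

(** The critical case is j = i + 2, where t^2 Y_j = T_(i+1) T_i Y_i T_i T_(i+1). The braid relation
    turns an outer T_i into T_(i+1) next to Y_i, which commutes with it by [Y_T_lt], and back on the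
    other side. *)
Lemma Y_T_gt j i f : (i.+1 < j)%N -> Y j (T i f) = T i (Y j f).
Proof.
have [m] := ubnP j; elim: m j f => // m IH j f hm hij.
have hj := ltn_ord j; have h : (i.+1 < n)%N by lia.
have jp : (0 < j)%N by lia.
have e : j = ordS (ord_pred j) by rewrite ord_predK.
have ep := ord_pred_val jp; set p := ord_pred j in e ep.
have hp : (p.+1 < n)%N by lia.
apply: (mulfI tm_neq0); rewrite -TC // e -!Y_rec //.
have [e2|ne2] := eqVneq (p : nat) i.+1; last first.
  by rewrite -T_comm ?IH ?(T_comm (i:=i) (j:=p)) //; lia.
have ei : p = ordS i by apply: ord_inj; rewrite ordS_val.
apply: (mulfI tm_neq0); rewrite -!TC // -?TC // ei -!Y_rec // -ei.
have br u : T i (T p (T i u)) = T p (T i (T p u)) by rewrite ei T_braid //; lia.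
by rewrite [T i (T p (T i f))]br [Y i (T p _)]Y_T_lt ?[RHS]br //; lia.
Qed.

Definition wtv f (y : 'I_n -> K) := forall i, Y i f = C (y i) * f.

(** Moving Y_i or Y_(i+1) past T_i leaves a term (1 - t) y_(i+1) f, up to sign; c is the constant
    that absorbs it in both cases. *)
Lemma wtv_T f y i c : (i.+1 < n)%N -> wtv f y ->
  c * (y (ordS i) - y i) = (1 - t) * y (ordS i) ->
  wtv (T i f + C c * f) (fun k => y (tperm i (ordS i) k)).
Proof.
move=> h wf hc.
have hcA : C c * (C (y (ordS i)) - C (y i)) = (1 - tm) * C (y (ordS i)).
  by rewrite -(rmorph1 C) -!rmorphB -!rmorphM hc.
move=> k; rewrite YD YC wf.
have [->|nki] := eqVneq k i.
  have e : Y i (T i f) = C (y (ordS i)) * (T i f + (1 - tm) * f).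
    rewrite -(TKi h (Y i (T i f))) Y_rec // wf /Ti TC // TC //.
    transitivity (C t^-1 * tm * C (y (ordS i)) * (T i f + (1 - tm) * f)); first by ring.
    by rewrite tmV mul1r.
  rewrite tpermL e.
  transitivity (C (y (ordS i)) * T i f + ((1 - tm) * C (y (ordS i)) + C c * C (y i)) * f).
    by ring.
  by rewrite -hcA; ring.
have [->|nkS] := eqVneq k (ordS i).
  have e : Y (ordS i) (T i f) = C (y i) * T i f - (1 - tm) * C (y (ordS i)) * f.
    have := Y_rec (Ti i f) h; rewrite TiK // wf TC // /Ti YC YD.
    have -> : Y (ordS i) ((1 - tm) * f) = (1 - tm) * (C (y (ordS i)) * f).
      by rewrite -(rmorph1 C) -rmorphB YC wf.
    rewrite mulrA [tm * _]mulrC tmV mul1r => ->; ring.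
  rewrite tpermR e.
  transitivity (C (y i) * T i f + (C c * C (y (ordS i)) - (1 - tm) * C (y (ordS i))) * f).
    by ring.
  by rewrite -hcA; ring.
rewrite tpermD 1?eq_sym //.
have -> : Y k (T i f) = T i (Y k f).
  have [lt|ge] := ltnP k i; first exact: Y_T_lt.
  apply: Y_T_gt; move: nki nkS; rewrite -!val_eqE /= modn_small // => /eqP ? /eqP ?; lia.
by rewrite wf TC //; ring.
Qed.

Section Phi.
Variable z : 'I_n.
Hypothesis z0 : z = 0%N :> nat.
Hypothesis n2 : (1 < n)%N.

(** The affine intertwiner: it raises the degree by one and shifts the weight cyclically, the
    eigenvalue that wraps around gaining a factor q. *)
Definition Phi f := X z * Wi f.

Lemma Wi_C c : Wi (C c) = C c.
Proof. by apply: (can_inj WK); rewrite WiK W_C. Qed.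

Lemma PhiC c f : Phi (C c * f) = C c * Phi f.
Proof. by rewrite /Phi rmorphM Wi_C; ring. Qed.

Lemma T_Phi i f : (i.+2 < n)%N -> T (ordS i) (Phi f) = Phi (T i f).
Proof.
move=> h; have Si : ordS i = i.+1 :> nat by rewrite ordS_val //; lia.
have h1 : ((ordS i).+1 < n)%N by rewrite Si.
have SSi : ordS (ordS i) = i.+2 :> nat by rewrite (ordS_val h1) Si.
by rewrite /Phi TX_other ?WiT //; apply: ord_neq; rewrite ?SSi ?Si z0.
Qed.

(** Each step uses T_i^-1 X_(i+1) = t^-1 X_i T_i: the last variable descends to X_j while every
    inverse becomes a T. From the first site on, the inverse product of Y_1 thus becomes the direct
    product in Y_n. *)
Lemma foldTi_X j (l : 'I_n) f : l.+1 = n ->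
  foldr Ti (X l * f) (ihi j) = C (t ^- (n.-1 - j)) * (X j * foldr T f (ihi j)).
Proof.
move=> hl; have [d] := ubnP (n - j)%N; elim: d j => // d IH j hd.
have hj := ltn_ord j.
have [e|ne] := eqVneq j.+1 n.
  have -> : l = j by apply: ord_inj; lia.
  have -> : (n.-1 - j)%N = 0%N by lia.
  by rewrite hi_last // expr0 invr1 rmorph1 mul1r.
have h : (j.+1 < n)%N by lia.
have Sj := ordS_val h.
rewrite hi_S //= IH; last by rewrite Sj; lia.
rewrite TiC // TiXS // mulrA -rmorphM; congr (C _ * _).
rewrite Sj; have -> : (n.-1 - j)%N = (n.-1 - j.+1).+1 by lia.
by rewrite exprSr invfM.
Qed.

Lemma Y0_Phi (l : 'I_n) f : l.+1 = n -> Y z (Phi f) = C q * Phi (Y l f).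
Proof.
move=> hl; rewrite /Y (lo0 z0) z0 expr0 invr1 rmorph1 mul1r [foldr T _ [::]]/= /Phi rmorphM WiK W_X z0 eqxx.
have -> : ord_pred z = l by apply: ord_inj; rewrite ord_pred_val0 //; lia.
rewrite -mulrA foldr_mul => [|k g /hi_mem /andP[_ h]]; last by rewrite TiC.
rewrite foldTi_X // (hi_last hl) [foldr Ti _ [::]]/= rmorphM Wi_C WK.
have -> : ilo l = ihi z.
  by apply: (inj_map val_inj); rewrite val_lo val_hi z0; congr iota; lia.
have -> : (n.-1 - z)%N = l by lia.
by ring.
Qed.

Lemma Wi_foldTi f (s : seq 'I_n) : (forall k, k \in s -> (k.+2 < n)%N) ->
  Wi (foldr Ti f s) = foldr Ti (Wi f) (map (@ordS n) s).
Proof.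
elim: s => //= k s IH h; rewrite WiTi ?h ?mem_head // IH // => j js.
by apply: h; rewrite inE js orbT.
Qed.

(** The factor X_1 crosses by T_1 X_1 = t X_2 T_1^-1 and omega X_2 = X_1. What remains compares
    T_1^-1 before omega with T_(n-1)^-1 after it, which is [W2T]. *)
Lemma Y1_Phi f : Y (ordS z) (Phi f) = Phi (Y z f).
Proof.
have hz : (z.+1 < n)%N by lia.
have Sz : ordS z = 1%N :> nat by rewrite ordS_val // z0.
have [l hl] : exists l : 'I_n, l.+1 = n.
  by exists (ord_pred z); rewrite ord_pred_val0 //; lia.
pose m' := ord_pred l; have mE : m' = n.-2 :> nat by rewrite /m' ord_pred_val; lia.
have m2 : m'.+2 = n by lia.
rewrite /Y lo_S // (lo0 z0) Sz expr1 z0 expr0 invr1 rmorph1 mul1r [rcons _ _]/= [foldr T _ _]/= [foldr T _ [::]]/=.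
rewrite {1}/Phi TX // -tmTi //.
rewrite mulrCA rmorphM W_C rmorphM W_X Sz /= rmorph1 mul1r ordSK.
rewrite foldr_mul => [|k g /hi_mem /andP[_ h]]; last by rewrite TiC.
rewrite mulrA tmV mul1r foldr_mul => [|k g /hi_mem /andP[h1 h2]]; last first.
  rewrite Sz in h1; rewrite TiX_other //; apply: ord_neq; rewrite ?ordS_val // z0; lia.
rewrite /Phi; congr (_ * _).
have -> : ihi z = rcons (ilo m') m'.
  apply: (inj_map val_inj); rewrite map_rcons val_lo val_hi z0.
  have -> : (n.-1 - 0)%N = (m' + 1)%N by lia.
  by rewrite iotaD cats1 add0n.
rewrite foldr_rcons Wi_foldTi; last by move=> k /lo_mem /andP[]; lia.
have -> : map (@ordS n) (ilo m') = ihi (ordS z).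
  apply: (inj_map val_inj); rewrite val_hi Sz -map_comp.
  have -> : map (val \o @ordS n) (ilo m') = map (succn \o val) (ilo m').
    by apply/eq_in_map => k /lo_mem /andP[_ h] /=; rewrite modn_small.
  rewrite map_comp val_lo (_ : 1%N = 1 + 0)%N // iotaDl.
  have -> : (n.-1 - (1 + 0))%N = m' by lia.
  exact: eq_map.
congr foldr; apply: (can_inj WK); rewrite WiK.
by rewrite /Ti !(rmorphM, rmorphD, rmorphN, rmorph1) !W_C (W2T _ z0 m2) WiK.
Qed.

Lemma YS_Phi i f : (i.+1 < n)%N -> Y (ordS i) (Phi f) = Phi (Y i f).
Proof.
have [m] := ubnP i; elim: m i f => // m IH i f hm h.
have [i0|ip] := posnP i.
  have -> : i = z by apply: ord_inj; rewrite i0.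
  exact: Y1_Phi.
have e : i = ordS (ord_pred i) by rewrite ord_predK.
have ep := ord_pred_val ip; set p := ord_pred i in e ep.
have hp : (p.+1 < n)%N by lia.
apply: (mulfI tm_neq0); rewrite -Y_rec //.
have eP g : T i (Phi g) = Phi (T p g) by rewrite e T_Phi //; lia.
have eY g : Y i (Phi g) = Phi (Y p g) by rewrite {1}e IH //; lia.
by rewrite eP eY eP Y_rec // -e PhiC.
Qed.

Lemma wtv_Phi f y : wtv f y ->
  wtv (Phi f) (fun k => (if k == 0%N :> nat then q else 1) * y (ord_pred k)).
Proof.
move=> wf k; have [k0|kp] := posnP k.
  have -> : k = z by apply: ord_inj; rewrite k0.
  rewrite (@Y0_Phi (ord_pred z)); last by rewrite ord_pred_val0 //; lia.
  by rewrite wf PhiC rmorphM mulrA.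
rewrite -[in LHS](ord_predK k) YS_Phi; last by rewrite ord_pred_val //; have := ltn_ord k; lia.
by rewrite wf PhiC mul1r.
Qed.

End Phi.

End DAHA.

(** * Hecke and Cherednik operators on polynomials *)

Lemma mpolyC_ind_comm (A : comNzRingType) n (P : {mpoly A[n]} -> Prop) : P 1 ->
  (forall f g, P f -> P g -> P (f + g)) -> (forall c f, P f -> P (c *: f)) ->
  (forall k f, P f -> P ('X_k * f)) -> forall f, P f.
Proof.
move=> P1 PD PZ PX f.
have P0 : P 0 by rewrite -(scale0r 1); apply: PZ.
rewrite (mpolyE f); apply: (big_ind P) => // m _; apply: PZ.
rewrite mpolyXE_id.
apply: (big_rec P) => // i g _ Pg.
elim: (m i) => [|d IH]; first by rewrite expr0 mul1r.
by rewrite exprS -mulrA; apply: PX.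
Qed.

Section Concrete.
Variables (K : fieldType) (q t : K) (n : nat).
Implicit Types (f g : {mpoly K[n]}) (i j k : 'I_n) (eta : 'X_{1..n}).

Definition mpolyC_rm : {rmorphism K -> {mpoly K[n]}} := @mpolyC n K.

Definition msym_rm i : {rmorphism {mpoly K[n]} -> {mpoly K[n]}} :=
  msym (tperm i (ordS i)).

Definition omega_tuple : n.-tuple {mpoly K[n]} :=
  [tuple (if i == 0%N :> nat then q else 1) *: 'X_(ord_pred i) | i < n].

Definition omega_rm : {rmorphism {mpoly K[n]} -> {mpoly K[n]}} :=
  comp_mpoly omega_tuple.

Definition omegai_tuple : n.-tuple {mpoly K[n]} :=
  [tuple (if i.+1 == n :> nat then q^-1 else 1) *: 'X_(ordS i) | i < n].

Definition omegai_rm : {rmorphism {mpoly K[n]} -> {mpoly K[n]}} :=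
  comp_mpoly omegai_tuple.

Lemma omegaE f : omega q f = omega_rm f.
Proof. by []. Qed.

Lemma mpolyC_ind (P : {mpoly K[n]} -> Prop) : P 1 ->
  (forall f g, P f -> P g -> P (f + g)) -> (forall c f, P f -> P (c%:MP * f)) ->
  (forall k f, P f -> P ('X_k * f)) -> forall f, P f.
Proof.
move=> P1 PD PC PX; apply: mpolyC_ind_comm => // c f.
by rewrite -mul_mpolyC; apply: PC.
Qed.

Lemma subX_neq0 i : (i.+1 < n)%N -> 'X_i - 'X_(ordS i) != 0 :> {mpoly K[n]}.
Proof.
move=> h; apply/eqP => /(congr1 (mcoeff U_(i)%MM)).
rewrite mcoeffB !mcoeffX mcoeff0 eqxx eq_mnm1 eq_sym (negbTE (ordS_neq h)) subr0.
by move/eqP; rewrite oner_eq0.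
Qed.

Lemma msym_mpolyC (s : 'S_n) c : msym s c%:MP = c%:MP :> {mpoly K[n]}.
Proof. by rewrite /msym mmapC. Qed.

Lemma msym_X (s : 'S_n) k : msym s 'X_k = 'X_(s k) :> {mpoly K[n]}.
Proof. by rewrite /msym mmapX mmap1U. Qed.

Lemma ddiffE i f :
  ('X_i - 'X_(ordS i)) * ddiff i f = f - msym (tperm i (ordS i)) f.
Proof. by apply/eqP; apply: (xchooseP (ddiff_exists i (ordS i) f)). Qed.

Lemma opT_E i f : ('X_i - 'X_(ordS i)) * opT t i f =
  (1 - t%:MP) * 'X_(ordS i) * f +
  (t%:MP * 'X_i - 'X_(ordS i)) * msym (tperm i (ordS i)) f.
Proof.
rewrite /opT /opL -!mul_mpolyC.
have := ddiffE i f; move: (ddiff i f) (msym _ f) => d sf.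
move: ('X_i) ('X_(ordS i)) (t%:MP) => a b c e.
transitivity (c * (a - b) * f - (c * a - b) * ((a - b) * d)); first by ring.
by rewrite e; ring.
Qed.

Lemma omega_mpolyC c : omega_rm c%:MP = c%:MP.
Proof. exact: comp_mpolyC. Qed.

Lemma omega_X k :
  omega_rm 'X_k = (if k == 0%N :> nat then q else 1)%:MP * 'X_(ord_pred k).
Proof.
by rewrite /omega_rm /= comp_mpolyXU -tnth_nth tnth_mktuple mul_mpolyC.
Qed.

Lemma omegai_X k :
  omegai_rm 'X_k = (if k.+1 == n :> nat then q^-1 else 1)%:MP * 'X_(ordS k).
Proof.
by rewrite /omegai_rm /= comp_mpolyXU -tnth_nth tnth_mktuple mul_mpolyC.
Qed.

Lemma omegai_mpolyC c : omegai_rm c%:MP = c%:MP.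
Proof. exact: comp_mpolyC. Qed.

Hypothesis q_neq0 : q != 0.

Lemma ordS_eq0 k : (ordS k == 0%N :> nat) = (k.+1 == n).
Proof.
have hk := ltn_ord k; have [e|ne] := eqVneq k.+1 n; first by rewrite /= e modnn.
by rewrite /= modn_small //; lia.
Qed.

Lemma omega_rmK : cancel omega_rm omegai_rm.
Proof.
move=> f; apply: (@rmorph_gen_ext _ _ _ mpolyC_rm (fun i => 'X_i) mpolyC_ind
  (omegai_rm \o omega_rm) idfun) => [c|k] /=.
  by rewrite omega_mpolyC omegai_mpolyC.
rewrite omega_X rmorphM omegai_mpolyC omegai_X mulrA -mpolyCM ord_predK.
rewrite -ordS_eq0 ord_predK; case: eqP => _; last by rewrite mul1r mpolyC1 mul1r.
by rewrite mulfV // mpolyC1 mul1r.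
Qed.

Lemma omegai_rmK : cancel omegai_rm omega_rm.
Proof.
move=> f; apply: (@rmorph_gen_ext _ _ _ mpolyC_rm (fun i => 'X_i) mpolyC_ind
  (omega_rm \o omegai_rm) idfun) => [c|k] /=.
  by rewrite omegai_mpolyC omega_mpolyC.
rewrite omegai_X rmorphM omega_mpolyC omega_X mulrA -mpolyCM ordSK.
rewrite ordS_eq0; case: eqP => _; last by rewrite mul1r mpolyC1 mul1r.
by rewrite mulVf // mpolyC1 mul1r.
Qed.

Section OpT.
Variable i : 'I_n.
Hypothesis hi : (i.+1 < n)%N.

Lemma opTD f g : opT t i (f + g) = opT t i f + opT t i g.
Proof. exact: (@TD _ _ _ mpolyC_rm t _ msym_rm (@opT K t n) subX_neq0 opT_E i hi f g). Qed.

Lemma opTZ c f : opT t i (c *: f) = c *: opT t i f.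
Proof.
rewrite -!mul_mpolyC.
exact: (@TC _ _ _ mpolyC_rm t _ msym_rm (@opT K t n) subX_neq0 (fun i c => msym_mpolyC _ c) opT_E i hi c f).
Qed.

Lemma opT0 : opT t i 0 = 0.
Proof. by have := opTZ 0 0; rewrite !scale0r. Qed.

Lemma opT_sum (I : Type) (r : seq I) (P : pred I) (F : I -> {mpoly K[n]}) :
  opT t i (\sum_(j <- r | P j) F j) = \sum_(j <- r | P j) opT t i (F j).
Proof. exact: (big_morph _ opTD opT0). Qed.

Lemma opT_quad f : opT t i (opT t i f) = (t - 1) *: opT t i f + t *: f.
Proof.
rewrite -!mul_mpolyC mpolyCB mpolyC1.
exact: (@T_quad _ _ _ mpolyC_rm t _ msym_rm (@opT K t n) mpolyC_ind subX_neq0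
  (fun i c => msym_mpolyC _ c) (fun i k => msym_X _ k) opT_E i hi f).
Qed.

Lemma opTM_sym f g : msym (tperm i (ordS i)) g = g ->
  opT t i (g * f) = g * opT t i f.
Proof. exact: (@TM_sym _ _ _ mpolyC_rm t _ msym_rm (@opT K t n) subX_neq0 opT_E i hi f g). Qed.

End OpT.

Hypothesis t_neq0 : t != 0.

Lemma opT_comm i j f : (i.+1 < j)%N -> (j.+1 < n)%N ->
  opT t i (opT t j f) = opT t j (opT t i f).
Proof.
move=> h1 h2.
exact: (@T_comm _ _ _ mpolyC_rm q t _ msym_rm (@opT K t n) mpolyC_ind subX_neq0
  (fun i c => msym_mpolyC _ c) (fun i k => msym_X _ k) opT_E t_neq0 q_neq0 i j f h1 h2).
Qed.

Lemma opT_braid i f : (i.+2 < n)%N ->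
  opT t i (opT t (ordS i) (opT t i f)) = opT t (ordS i) (opT t i (opT t (ordS i) f)).
Proof.
move=> h.
exact: (@T_braid _ _ _ mpolyC_rm q t _ msym_rm (@opT K t n) mpolyC_ind subX_neq0
  (fun i c => msym_mpolyC _ c) (fun i k => msym_X _ k) opT_E t_neq0 q_neq0 i f h).
Qed.

Lemma omega_opT i f : (i.+2 < n)%N ->
  omega q (opT t (ordS i) f) = opT t i (omega q f).
Proof.
move=> h.
exact: (@WT _ _ _ mpolyC_rm q t _ msym_rm (@opT K t n) omega_rm mpolyC_ind subX_neq0
  (fun i c => msym_mpolyC _ c) (fun i k => msym_X _ k) opT_E omega_mpolyC omega_X t_neq0 q_neq0 i f h).
Qed.

Lemma opTinvE i f : opTinv t i f = Ti mpolyC_rm t (@opT K t n) i f.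
Proof.
rewrite /Ti /opTinv /opT /= -!mul_mpolyC.
by move: (opL _ _ _) (t^-1%:MP) (t%:MP) => L a b; ring.
Qed.

Lemma opTK i f : (i.+1 < n)%N -> opTinv t i (opT t i f) = f.
Proof.
move=> hi; rewrite opTinvE.
exact: (@TKi _ _ _ mpolyC_rm t _ msym_rm (@opT K t n) mpolyC_ind subX_neq0
  (fun i c => msym_mpolyC _ c) (fun i k => msym_X _ k) opT_E t_neq0 i hi f).
Qed.

Lemma opYE i f : opY q t i f = Y mpolyC_rm t (@opT K t n) omega_rm i f.
Proof.
rewrite /opY /Y -mul_mpolyC; congr (_ * _).
rewrite -[omega q _]/(omega_rm _); set s := [seq k : 'I_n <- _ | _ & _].
rewrite /ihi -/s; elim: s => //= k s ->.
by rewrite opTinvE.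
Qed.

Lemma opYD i f g : opY q t i (f + g) = opY q t i f + opY q t i g.
Proof.
rewrite !opYE.
exact: (@YD _ _ _ mpolyC_rm t _ msym_rm (@opT K t n) omega_rm subX_neq0 opT_E i f g).
Qed.

Lemma opYZ i c f : opY q t i (c *: f) = c *: opY q t i f.
Proof.
rewrite !opYE -!mul_mpolyC.
exact: (@YC _ _ _ mpolyC_rm t _ msym_rm (@opT K t n) omega_rm subX_neq0
  (fun i c => msym_mpolyC _ c) opT_E omega_mpolyC i c f).
Qed.

Lemma opY_rec i f : (i.+1 < n)%N ->
  opT t i (opY q t i (opT t i f)) = t *: opY q t (ordS i) f.
Proof.
move=> h; rewrite !opYE -mul_mpolyC.
exact: (@Y_rec _ _ _ mpolyC_rm t _ msym_rm (@opT K t n) omega_rm mpolyC_ind subX_neq0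
  (fun i c => msym_mpolyC _ c) (fun i k => msym_X _ k) opT_E t_neq0 i f h).
Qed.

Lemma opY_opT f (y : 'I_n -> K) i c : (i.+1 < n)%N ->
  (forall k, opY q t k f = y k *: f) ->
  c * (y (ordS i) - y i) = (1 - t) * y (ordS i) ->
  forall k, opY q t k (opT t i f + c *: f) =
    y (tperm i (ordS i) k) *: (opT t i f + c *: f).
Proof.
move=> hi hy hc k.
have := @wtv_T _ _ _ mpolyC_rm q t _ msym_rm (@opT K t n) omega_rm mpolyC_ind subX_neq0
  (fun i c => msym_mpolyC _ c) (fun i k => msym_X _ k) opT_E omega_mpolyC omega_X
  t_neq0 q_neq0 f y i c hi.
move=> H; have {}H := H _ hc k.
rewrite opYE -!mul_mpolyC; apply: H => j.
by rewrite -opYE hy mul_mpolyC.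
Qed.

Lemma opY_Phi f (y : 'I_n -> K) (z : 'I_n) : z = 0%N :> nat -> (1 < n)%N ->
  (forall k, opY q t k f = y k *: f) ->
  forall k, opY q t k ('X_z * omegai_rm f) =
    ((if k == 0%N :> nat then q else 1) * y (ord_pred k)) *: ('X_z * omegai_rm f).
Proof.
move=> z0 n2 hy k.
have := @wtv_Phi _ _ _ mpolyC_rm q t _ msym_rm (@opT K t n) omega_rm omegai_rm mpolyC_ind subX_neq0
  (fun i c => msym_mpolyC _ c) (fun i k => msym_X _ k) opT_E omega_mpolyC omega_X
  omega_rmK omegai_rmK t_neq0 q_neq0 z z0 n2 f y.
move=> H; rewrite opYE -!mul_mpolyC; apply: H => j.
by rewrite -opYE hy mul_mpolyC.
Qed.

End Concrete.

(** * Eigenvalues as ranks, and the intertwiners on weight vectors *)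

Section Rank.
Variable n : nat.
Implicit Types (eta : 'X_{1..n}) (i j k : 'I_n).

(** A total order on positions, larger entries first and ties won by the later position; it makes
    the exponent of t in an eigenvalue a rank. *)
Definition beats eta j k := (eta k < eta j)%N || ((eta k == eta j) && (k < j)%N).

Definition rk eta k := #|[set j | beats eta j k]|.

Lemma eigvalE (K : fieldType) (q t : K) i eta :
  eigval q t i eta = q ^+ eta i * t ^- rk eta i.
Proof.
rewrite /eigval /rk; congr (_ * _ ^- _).
set A := [set j | _ & _]; set B := [set j | _ & _].
have dAB : A :&: B = finset.set0 by apply/setP => j; rewrite !inE; case: (ltngtP i j); rewrite ?andbF.
rewrite -cardsUI dAB cards0 addn0; apply: eq_card => j; rewrite !inE /beats.
case: (ltngtP i j) => h; rewrite ?andbF ?andbT ?orbF //=; last first.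
  by rewrite (ord_inj h) ltnn.
by case: (ltngtP (eta i) (eta j)).
Qed.

Lemma rk_swap eta i k : (i.+1 < n)%N -> eta i != eta (ordS i) ->
  rk (swap_comp i eta) k = rk eta (tperm i (ordS i) k).
Proof.
move=> hi ne; rewrite /rk -(card_preimset [set j | beats eta j (tperm i (ordS i) k)]
  (@perm_inj _ (tperm i (ordS i)))).
apply: eq_card => j; rewrite !inE /beats !mnmE.
have Si := ordS_val hi.
case: (tpermP i (ordS i) k) => [->|->|/eqP k1 /eqP k2];
  case: (tpermP i (ordS i) j) => [->|->|/eqP j1 /eqP j2]; rewrite ?ltnn //.
- by rewrite eq_sym (negbTE ne).
- congr (_ || (_ && _)); rewrite Si.
  by move: j1 j2; rewrite -!val_eqE /= -[(i.+1 %% n)%N]/(ordS i : nat) Si; lia.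
- by rewrite (negbTE ne).
- congr (_ || (_ && _)); rewrite Si.
  by move: j1 j2; rewrite -!val_eqE /= -[(i.+1 %% n)%N]/(ordS i : nat) Si; lia.
- congr (_ || (_ && _)); rewrite Si.
  by move: k1 k2; rewrite -!val_eqE /= -[(i.+1 %% n)%N]/(ordS i : nat) Si; lia.
- congr (_ || (_ && _)); rewrite Si.
  by move: k1 k2; rewrite -!val_eqE /= -[(i.+1 %% n)%N]/(ordS i : nat) Si; lia.
Qed.

Lemma rk_eq eta i : (i.+1 < n)%N -> eta i = eta (ordS i) ->
  rk eta i = (rk eta (ordS i)).+1.
Proof.
move=> hi e; have Si := ordS_val hi.
rewrite /rk (cardsD1 (ordS i)) inE /beats e ltnn eqxx Si ltnSn /=; congr _.+1.
apply: eq_card => j; rewrite !inE -(inj_eq val_inj) [val (ordS i)]Si.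
have [ej|nj] := eqVneq (val j) i.+1.
  have -> : j = ordS i by apply: ord_inj; rewrite Si.
  by rewrite ltnn Si ltnn andbF.
congr (_ || (_ && _)).
by move: nj; rewrite /=; lia.
Qed.

Lemma rk_lt eta i j : (eta j < eta i)%N -> (rk eta i < rk eta j)%N.
Proof.
move=> h; apply: proper_card; apply/properP; split.
  apply/fintype.subsetP => k; rewrite !inE /beats => /orP[h1|/andP[/eqP h1 _]].
    by rewrite (ltn_trans h h1).
  by rewrite -h1 h.
by exists i; rewrite !inE /beats ?ltnn ?andbF // h.
Qed.

Definition Phi_comp eta : 'X_{1..n} :=
  [multinom ((k == 0%N :> nat) + eta (ord_pred k))%N | k < n].

(** The entry that wraps around leaves the last position, where it wins every tie, for the first one
    with one more box, where it wins the same comparisons strictly. *)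
Lemma rk_Phi eta k : rk (Phi_comp eta) k = rk eta (ord_pred k).
Proof.
rewrite /rk -(card_preimset [set j | beats eta j (ord_pred k)] (can_inj (@ord_predK n))).
apply: eq_card => j; rewrite !inE /beats !mnmE.
have hj := ltn_ord j; have hk := ltn_ord k.
have [k0|kp] := posnP k; have [j0|jp] := posnP j.
- have -> : j = k by apply: ord_inj; rewrite k0 j0.
  by rewrite !ltnn !andbF.
- rewrite (ord_pred_val jp) (ord_pred_val0 k0) add0n add1n.
  by case: (ltngtP (eta (ord_pred k)) (eta (ord_pred j))); lia.
- rewrite (ord_pred_val kp) (ord_pred_val0 j0) add0n add1n.
  by case: (ltngtP (eta (ord_pred k)) (eta (ord_pred j))); lia.
rewrite !add0n; congr (_ || (_ && _)).
by rewrite (ord_pred_val jp) (ord_pred_val kp); lia.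
Qed.

End Rank.

Definition wt (K : fieldType) (q t : K) n (eta : 'X_{1..n}) (f : {mpoly K[n]}) :=
  forall i, opY q t i f = eigval q t i eta *: f.

Section Weights.
Variables (K : fieldType) (q t : K) (n : nat).
Implicit Types (f : {mpoly K[n]}) (i j k : 'I_n) (eta : 'X_{1..n}).
Hypotheses (q_neq0 : q != 0) (t_neq0 : t != 0).

(* The exponent of t in the denominator is positive when eta i > eta (ordS i), *)
(* so that there is no pole at q = 1.                                          *)
Definition wcoef eta i : K :=
  (1 - t) / (1 - q ^+ (eta i - eta (ordS i)) * t ^+ (rk eta (ordS i) - rk eta i)).

Lemma wt_opT eta f i : (i.+1 < n)%N -> (eta (ordS i) < eta i)%N ->
  1 - q ^+ (eta i - eta (ordS i)) * t ^+ (rk eta (ordS i) - rk eta i) != 0 ->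
  wt q t eta f -> wt q t (swap_comp i eta) (opT t i f + wcoef eta i *: f).
Proof.
move=> hi h nz wf k.
rewrite (@opY_opT _ q t n q_neq0 t_neq0 f (fun k => eigval q t k eta)) //; last first.
  have /ltnW hr := rk_lt h.
  have -> : eigval q t i eta =
      q ^+ (eta i - eta (ordS i)) * t ^+ (rk eta (ordS i) - rk eta i) *
      eigval q t (ordS i) eta.
    rewrite !eigvalE -{1}(subnK (ltnW h)) -{2}(subnK hr) !exprD invfM.
    move: (eta i - eta (ordS i))%N (rk eta (ordS i) - rk eta i)%N => a b.
    have tb : t ^+ b != 0 by rewrite expf_neq0.
    move: (t ^- rk eta i) (t ^+ b) tb (q ^+ a) (q ^+ eta (ordS i)) => u v nv x y.
    by field.
  by rewrite /wcoef; move: (eigval _ _ _ _) (_ * _) nz => u v nz; field.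
rewrite !eigvalE rk_swap ?mnmE //.
by apply/eqP => e; rewrite e ltnn in h.
Qed.

Lemma wt_Phi eta f (z : 'I_n) : z = 0%N :> nat -> (1 < n)%N ->
  wt q t eta f -> wt q t (Phi_comp eta) ('X_z * omegai_rm q n f).
Proof.
move=> z0 n2 wf k.
rewrite (@opY_Phi _ q t n q_neq0 t_neq0 f (fun k => eigval q t k eta) z) //.
rewrite !eigvalE rk_Phi mnmE exprD mulrA; congr ((_ * _ * _) *: _).
by case: eqP.
Qed.

(** T_i multiplies constants by t, so Y_i multiplies them by t to minus the number of its inverse
    factors. Among equal entries that number is the rank of i. *)
Lemma wt_1 : wt q t 0%MM (1 : {mpoly K[n]}).
Proof.
have h0 i : (0%MM : 'X_{1..n}) i = 0%N by rewrite mnm0E.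
have opT1 i : (i.+1 < n)%N -> opT t i 1 = t *: 1.
  move=> hi; rewrite -!mul_mpolyC mulr1.
  by rewrite (@T1 _ _ _ (mpolyC_rm K n) t _ (@msym_rm K n) (@opT K t n) (@subX_neq0 K n) (@opT_E K t n) i hi).
have key i : rk 0%MM i = (n.-1 - i)%N.
  rewrite /rk -(card_ord (n.-1 - i)).
  have hi := ltn_ord i.
  have e (k : 'I_(n.-1 - i)) : (i.+1 + k < n)%N by have := ltn_ord k; lia.
  rewrite -[RHS](@card_imset _ _ (fun k : 'I_(n.-1 - i) => Ordinal (e k))); last first.
    by move=> k l /(congr1 val) /= h; apply: ord_inj; lia.
  apply: eq_card => j; rewrite !inE /beats !h0 ltnn eqxx /=.
  apply/idP/imsetP => [h|[k _ ->] /=]; last by lia.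
  have hj := ltn_ord j; have hk : (j - i.+1 < n.-1 - i)%N by lia.
  by exists (Ordinal hk) => //; apply: ord_inj => /=; lia.
move=> i; rewrite eigvalE h0 expr0 mul1r key /opY.
have foldT (s : seq 'I_n) c : (forall k, k \in s -> (k.+1 < n)%N) ->
    foldr (opT t (n:=n)) (c *: 1) s = (t ^+ size s * c) *: 1.
  elim: s => [|k s IH] h; first by rewrite /= expr0 mul1r.
  rewrite [foldr _ _ _]/= IH => [|j js]; last by apply: h; rewrite inE js orbT.
  by rewrite opTZ ?opT1 ?h ?mem_head // scalerA exprS; congr (_ *: _); ring.
have foldTi (s : seq 'I_n) c : (forall k, k \in s -> (k.+1 < n)%N) ->
    foldr (opTinv t (n:=n)) (c *: 1) s = (t ^- size s * c) *: 1.
  elim: s => [|k s IH] h; first by rewrite /= expr0 invr1 mul1r.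
  rewrite [foldr _ _ _]/= IH => [|j js]; last by apply: h; rewrite inE js orbT.
  have hk : (k.+1 < n)%N by rewrite h ?mem_head.
  have -> a : opTinv t k (a *: 1) = (t^-1 * a) *: 1.
    have e : opT t k ((t^-1 * a) *: 1) = a *: (1 : {mpoly K[n]}).
      by rewrite opTZ // opT1 // scalerA mulrAC mulVf // mul1r.
    by rewrite -e opTK.
  by rewrite exprS invfM mulrA.
rewrite -[X in foldr (opT t (n:=n)) X]scale1r foldT; last by move=> k /lo_mem /andP[].
have -> c : omega q (c *: 1) = c *: (1 : {mpoly K[n]}).
  by rewrite -!mul_mpolyC mulr1; exact: omega_mpolyC.
rewrite foldTi; last by move=> k /hi_mem /andP[].
rewrite scalerA mulr1.
have -> : size [seq k : 'I_n <- enum 'I_n | (k < i)%N] = i.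
  by rewrite -(size_map val) (val_lo i) size_iota.
have -> : size [seq k : 'I_n <- enum 'I_n | (i <= k)%N & (k.+1 < n)%N] = (n.-1 - i)%N.
  by rewrite -(size_map val) (val_hi i) size_iota.
by congr (_ *: _); rewrite mulrCA mulVf ?mulr1 // expf_neq0.
Qed.

End Weights.

(** * Specialisation of the coefficients *)

Section MapMpoly.
Variables (A B : comNzRingType) (h : {rmorphism A -> B}) (n : nat).
Implicit Types f g : {mpoly A[n]}.

Lemma map_mpolyD f g : map_mpoly h (f + g) = map_mpoly h f + map_mpoly h g.
Proof. exact: rmorphD. Qed.

Lemma map_mpolyB f g : map_mpoly h (f - g) = map_mpoly h f - map_mpoly h g.
Proof. exact: rmorphB. Qed.

Lemma map_mpolyM f g : map_mpoly h (f * g) = map_mpoly h f * map_mpoly h g.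
Proof. exact: rmorphM. Qed.

Lemma map_mpoly1 : map_mpoly h (1 : {mpoly A[n]}) = 1.
Proof. exact: rmorph1. Qed.

End MapMpoly.

Section OmegaMorph.
Variables (K : fieldType) (q : K) (n : nat).
Implicit Types f g : {mpoly K[n]}.

Lemma omegaD f g : omega q (f + g) = omega q f + omega q g.
Proof. exact: comp_mpolyD. Qed.

Lemma omegaM f g : omega q (f * g) = omega q f * omega q g.
Proof. exact: (rmorphM (omega_rm q n)). Qed.

Lemma omegaZ c f : omega q (c *: f) = c *: omega q f.
Proof. exact: comp_mpolyZ. Qed.

Lemma omega1 : omega q (1 : {mpoly K[n]}) = 1.
Proof. exact: comp_mpoly1. Qed.

Lemma omega_XZ k :
  omega q 'X_k = (if k == 0%N :> nat then q else 1) *: 'X_(ord_pred k) :> {mpoly K[n]}.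
Proof. by rewrite -mul_mpolyC; exact: omega_X. Qed.

End OmegaMorph.

Section Rel.
Variables (P : idomainType) (K L : fieldType).
Variables (iota : {rmorphism P -> K}) (eps : {rmorphism P -> L}) (n : nat).
Hypothesis iota_inj : injective iota.
Implicit Types (f : {mpoly K[n]}) (g : {mpoly L[n]}) (i k : 'I_n) (m : 'X_{1..n}).

(** a has the value b under eps: it is a fraction over P whose denominator survives eps. Used with
    eps setting q = 1 at real t, and with eps setting t = 1 at generic q. *)
Definition relK (a : K) (b : L) :=
  exists d p, [/\ eps d != 0, iota d * a = iota p & eps d * b = eps p].

(** One denominator serves all coefficients, so that operators can be computed on [f0], over P
    itself. *)
Definition Rel f g := exists d (f0 : {mpoly P[n]}),
  [/\ eps d != 0, iota d *: f = map_mpoly iota f0 & eps d *: g = map_mpoly eps f0].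

Lemma iota_neq0 d : eps d != 0 -> iota d != 0.
Proof.
apply: contraNneq => h; have -> : d = 0 by apply: iota_inj; rewrite h rmorph0.
by rewrite rmorph0.
Qed.

Lemma relK_iota p : relK (iota p) (eps p).
Proof. by exists 1, p; rewrite !rmorph1 !mul1r oner_neq0. Qed.

Lemma relKD a b a' b' : relK a b -> relK a' b' -> relK (a + a') (b + b').
Proof.
move=> [d [p [nz h1 h2]]] [d' [p' [nz' h1' h2']]].
exists (d * d'), (p * d' + d * p'); split; first by rewrite rmorphM mulf_neq0.
- by rewrite !(rmorphM, rmorphD) -h1 -h1'; ring.
- by rewrite !(rmorphM, rmorphD) -h2 -h2'; ring.
Qed.

Lemma relKM a b a' b' : relK a b -> relK a' b' -> relK (a * a') (b * b').
Proof.
move=> [d [p [nz h1 h2]]] [d' [p' [nz' h1' h2']]].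
exists (d * d'), (p * p'); split; first by rewrite rmorphM mulf_neq0.
- by rewrite !rmorphM -h1 -h1'; ring.
- by rewrite !rmorphM -h2 -h2'; ring.
Qed.

Lemma relKN a b : relK a b -> relK (- a) (- b).
Proof.
move=> [d [p [nz h1 h2]]]; exists d, (- p); split => //.
- by rewrite rmorphN -h1 mulrN.
- by rewrite rmorphN -h2 mulrN.
Qed.

Lemma relK1 : relK 1 1.
Proof. by rewrite -(rmorph1 iota) -(rmorph1 eps); exact: relK_iota. Qed.

Lemma relK0 : relK 0 0.
Proof. by rewrite -(rmorph0 iota) -(rmorph0 eps); exact: relK_iota. Qed.

Lemma relKX a b j : relK a b -> relK (a ^+ j) (b ^+ j).
Proof.
move=> h; elim: j => [|j IH]; first by rewrite !expr0; exact: relK1.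
by rewrite !exprS; exact: relKM.
Qed.

Lemma relK_neq0 a b : relK a b -> b != 0 -> a != 0.
Proof.
move=> [d [p [nz h1 h2]]] nb; have np : eps p != 0 by rewrite -h2 mulf_neq0.
by apply: contraNneq (iota_neq0 np) => ha; rewrite -h1 ha mulr0.
Qed.

Lemma relKV a b : relK a b -> b != 0 -> relK a^-1 b^-1.
Proof.
move=> h nb; have na := relK_neq0 h nb; case: h => [d [p [nz h1 h2]]].
have np : eps p != 0 by rewrite -h2 mulf_neq0.
exists p, d; split=> //; first by rewrite -h1 mulfK.
by rewrite -h2 mulfK.
Qed.

Lemma relK_fun a b b' : relK a b -> relK a b' -> b = b'.
Proof.
move=> [d [p [nz h1 h2]]] [d' [p' [nz' h1' h2']]].
have e : d' * p = d * p'.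
  by apply: iota_inj; rewrite !rmorphM -h1 -h1'; ring.
apply: (mulfI (mulf_neq0 nz nz')); have := congr1 eps e; rewrite !rmorphM -h2 -h2' => e'.
by rewrite -!mulrA [LHS]mulrCA -e'; ring.
Qed.

Lemma Rel_coef f g m : Rel f g -> relK f@_m g@_m.
Proof.
move=> [d [f0 [nz h1 h2]]]; exists d, f0@_m; split=> //.
- by rewrite -mcoeffZ h1 mcoeff_map_mpoly.
- by rewrite -mcoeffZ h2 mcoeff_map_mpoly.
Qed.

Lemma Rel_fun f g g' : Rel f g -> Rel f g' -> g = g'.
Proof.
move=> h h'; apply/mpolyP => m.
exact: relK_fun (Rel_coef m h) (Rel_coef m h').
Qed.

Lemma RelD f g f' g' : Rel f g -> Rel f' g' -> Rel (f + f') (g + g').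
Proof.
move=> [d [p [nz h1 h2]]] [d' [p' [nz' h1' h2']]].
exists (d * d'), (d' *: p + d *: p'); split; first by rewrite rmorphM mulf_neq0.
- rewrite map_mpolyD !map_mpolyZ -h1 -h1' !scalerA rmorphM scalerDr.
  by rewrite [iota d' * _]mulrC.
- rewrite map_mpolyD !map_mpolyZ -h2 -h2' !scalerA rmorphM scalerDr.
  by rewrite [eps d' * _]mulrC.
Qed.

Lemma RelZ a b f g : relK a b -> Rel f g -> Rel (a *: f) (b *: g).
Proof.
move=> [d [p [nz h1 h2]]] [d' [p' [nz' h1' h2']]].
exists (d * d'), (p *: p'); split; first by rewrite rmorphM mulf_neq0.
- by rewrite !map_mpolyZ -h1 -h1' !scalerA rmorphM; congr (_ *: _); ring.
- by rewrite !map_mpolyZ -h2 -h2' !scalerA rmorphM; congr (_ *: _); ring.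
Qed.

Lemma RelB f g f' g' : Rel f g -> Rel f' g' -> Rel (f - f') (g - g').
Proof.
move=> h h'; rewrite -!scaleN1r; apply: RelD => //; apply: RelZ => //.
exact: relKN relK1.
Qed.

Lemma Rel_map (f0 : {mpoly P[n]}) : Rel (map_mpoly iota f0) (map_mpoly eps f0).
Proof. by exists 1, f0; rewrite !rmorph1 !scale1r oner_neq0. Qed.

Lemma RelX m : Rel 'X_[m] 'X_[m].
Proof. by have := Rel_map 'X_[m]; rewrite !map_mpolyX. Qed.

Lemma Rel1 : Rel 1 1.
Proof. by have := RelX 0%MM; rewrite !mpolyX0. Qed.

Lemma RelM f g f' g' : Rel f g -> Rel f' g' -> Rel (f * f') (g * g').
Proof.
move=> [d [p [nz h1 h2]]] [d' [p' [nz' h1' h2']]].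
exists (d * d'), (p * p'); split; first by rewrite rmorphM mulf_neq0.
- by rewrite map_mpolyM -h1 -h1' rmorphM -scalerAl -scalerAr scalerA.
- by rewrite map_mpolyM -h2 -h2' rmorphM -scalerAl -scalerAr scalerA.
Qed.

Lemma Rel_sum (I : eqType) (r : seq I) (F : I -> {mpoly K[n]}) (G : I -> {mpoly L[n]}) :
  (forall j, j \in r -> Rel (F j) (G j)) ->
  Rel (\sum_(j <- r) F j) (\sum_(j <- r) G j).
Proof.
elim: r => [|j r IH] h.
  by rewrite !big_nil; have := RelZ relK0 Rel1; rewrite !scale0r.
rewrite !big_cons; apply: RelD; first by apply: h; rewrite mem_head.
by apply: IH => k kr; apply: h; rewrite inE kr orbT.
Qed.

Lemma map_mpoly_msym (A B : comNzRingType) (h : {rmorphism A -> B}) (s : 'S_n)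
    (f : {mpoly A[n]}) : map_mpoly h (msym s f) = msym s (map_mpoly h f).
Proof. by apply/mpolyP => m; rewrite mcoeff_map_mpoly !mcoeff_sym mcoeff_map_mpoly. Qed.

(** The division by x_i - x_(i+1) is possible over P, so it creates no new denominator. By
    cancellation the quotients chosen over K and L are the images of the one over P. *)
Lemma Rel_ddiff i f g : (i.+1 < n)%N -> Rel f g -> Rel (ddiff i f) (ddiff i g).
Proof.
move=> hi [d [p [nz h1 h2]]].
have [p' /eqP e] := ddiff_exists i (ordS i) p.
exists d, p'; split=> //.
- apply: (mulfI (subX_neq0 K hi)); rewrite -scalerAr ddiffE scalerBr -msymZ h1.
  by have := congr1 (map_mpoly iota) e; rewrite map_mpolyM !map_mpolyB !map_mpolyX map_mpoly_msym => ->.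
- apply: (mulfI (subX_neq0 L hi)); rewrite -scalerAr ddiffE scalerBr -msymZ h2.
  by have := congr1 (map_mpoly eps) e; rewrite map_mpolyM !map_mpolyB !map_mpolyX map_mpoly_msym => ->.
Qed.

Lemma Rel_opL t t' i f g : (i.+1 < n)%N -> relK t t' -> Rel f g ->
  Rel (opL t i f) (opL t' i g).
Proof.
move=> hi ht h; apply: RelM; last exact: Rel_ddiff.
by apply: RelB; [apply: RelZ => //; exact: RelX|exact: RelX].
Qed.

Lemma Rel_opT t t' i f g : (i.+1 < n)%N -> relK t t' -> Rel f g ->
  Rel (opT t i f) (opT t' i g).
Proof. by move=> hi ht h; apply: RelB; [exact: RelZ|exact: Rel_opL]. Qed.

Lemma Rel_opTinv t t' i f g : (i.+1 < n)%N -> relK t t' -> t' != 0 -> Rel f g ->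
  Rel (opTinv t i f) (opTinv t' i g).
Proof.
move=> hi ht nt h; have hV := relKV ht nt.
by apply: RelB; apply: RelZ => //; exact: Rel_opL.
Qed.

Lemma Rel_omega q q' f g : relK q q' -> Rel f g -> Rel (omega q f) (omega q' g).
Proof.
move=> hq [d [p [nz h1 h2]]].
have key : Rel (omega q (map_mpoly iota p)) (omega q' (map_mpoly eps p)).
  elim/mpolyC_ind_comm: p {h1 h2} => [|p p' IH IH'|c p IH|k p IH].
  - by rewrite !map_mpoly1 !omega1; exact: Rel1.
  - rewrite (map_mpolyD iota) (map_mpolyD eps) (omegaD q) (omegaD q'); exact: RelD.
  - by rewrite !map_mpolyZ !omegaZ; apply: RelZ => //; exact: relK_iota.
  - rewrite !map_mpolyM !map_mpolyX !omegaM !omega_XZ; apply: RelM => //.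
    by apply: RelZ; [case: eqP => _ //; exact: relK1|exact: RelX].
case: key => d' [p' [nz' k1 k2]]; exists (d * d'), p'; split.
- by rewrite rmorphM mulf_neq0.
- by rewrite -k1 -h1 rmorphM mulrC -scalerA omegaZ.
- by rewrite -k2 -h2 rmorphM mulrC -scalerA omegaZ.
Qed.

Lemma Rel_opY q q' t t' i f g : relK q q' -> relK t t' -> t' != 0 -> Rel f g ->
  Rel (opY q t i f) (opY q' t' i g).
Proof.
move=> hq ht nt h; apply: RelZ; first by apply: relKV; [exact: relKX|rewrite expf_neq0].
have hlo (s : seq 'I_n) : (forall k, k \in s -> (k.+1 < n)%N) -> 
    Rel (foldr (opT t (n:=n)) f s) (foldr (opT t' (n:=n)) g s).
  elim: s => [|k s IH] //= hs; apply: Rel_opT => //; first by rewrite hs ?mem_head.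
  by apply: IH => j js; apply: hs; rewrite inE js orbT.
set s := [seq k : 'I_n <- enum 'I_n | (i <= k)%N & _].
have : forall k, k \in s -> (k.+1 < n)%N by move=> k /hi_mem /andP[].
elim: s => [|k s IH] hs; last first.
  rewrite [foldr (opTinv t (n:=n)) _ _]/= [foldr (opTinv t' (n:=n)) _ _]/=.
  apply: Rel_opTinv => //; first by rewrite hs ?mem_head.
  by apply: IH => j js; apply: hs; rewrite inE js orbT.
by apply: Rel_omega => //; apply: hlo => k /lo_mem /andP[].
Qed.

End Rel.

(** * Weight spaces are lines *)

Lemma frac_ex (A : idomainType) (c : {fraction A}) :
  exists a b : A, b != 0 /\ c = tofrac a / tofrac b.
Proof.
elim/quotW: c => r; exists (\n_r), (\d_r); split; first exact: denom_ratioP.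
have nz : tofrac (\d_r) != 0 :> {fraction A} by rewrite tofrac_eq0 denom_ratioP.
apply: (canRL (mulfK nz)); rewrite /GRing.mul /= !piE.
apply/eqP; rewrite piE /= FracField.equivfE /FracField.mulf !numden_Ratio ?mulr1 ?oner_neq0 //.
  by rewrite mulrC.
all: exact: denom_ratioP.
Qed.

Section T1.
Variables (L : fieldType) (q : L) (n : nat).
Implicit Types (f : {mpoly L[n]}) (i j k : 'I_n) (m : 'X_{1..n}).
Hypothesis q_neq0 : q != 0.

Lemma opT_1 i f : opT 1 i f = msym (tperm i (ordS i)) f.
Proof. by rewrite /opT /opL !scale1r ddiffE opprB addrC subrK. Qed.

Lemma opTinv_1 i f : opTinv 1 i f = msym (tperm i (ordS i)) f.
Proof. by rewrite /opTinv invr1 !scale1r /opL scale1r ddiffE opprB addrC subrK. Qed.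

Lemma omega_Xm m (z : 'I_n) : z = 0%N :> nat ->
  omega q 'X_[m] = q ^+ m z *: 'X_[[multinom m (ordS j) | j < n]].
Proof.
move=> z0; rewrite /omega comp_mpolyX.
under eq_bigr do rewrite tnth_mktuple exprZn -mul_mpolyC.
rewrite big_split /= -rmorph_prod mul_mpolyC; congr (_ *: _).
  rewrite (bigD1 z) //= z0 big1 ?mulr1 // => i ni.
  rewrite ifN ?expr1n //; apply: contra ni => /eqP e.
  by apply/eqP/ord_inj; rewrite e z0.
rewrite [RHS]mpolyXE_id (reindex_inj (can_inj (@ordSK n))) /=.
by apply: eq_bigr => i _; rewrite mnmE ordSK.
Qed.

Lemma mcoeff_omega f m (l : 'I_n) : l.+1 = n ->
  (omega q f)@_m = q ^+ m l * f@_(rot_comp m).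
Proof.
move=> hl; have [z z0] : exists z : 'I_n, z = 0%N :> nat by exists (ordS l); rewrite /= hl modnn.
have zl : ordS l = z by apply: ord_inj; rewrite z0 /= hl modnn.
have om0 : omega q 0 = 0 :> {mpoly L[n]} by exact: comp_mpoly0.
rewrite {1}(mpolyE f) (big_morph _ (@omegaD _ q n) om0) raddf_sum /=.
have key m' : (omega q (f@_m' *: 'X_[m']))@_m =
    f@_m' * (q ^+ m' z * (m' == rot_comp m)%:R).
  rewrite omegaZ (omega_Xm _ z0) mcoeffZ mcoeffZ mcoeffX; congr (_ * (_ * (nat_of_bool _)%:R)).
  apply/eqP/eqP => [<-|->]; apply/mnmP => j; rewrite !mnmE ?ordSK //.
  by rewrite ord_predK.
under eq_bigr do rewrite key.
have [hm|hm] := boolP (rot_comp m \in msupp f).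
  rewrite (bigD1_seq (rot_comp m)) ?msupp_uniq //= eqxx mulr1 big1 ?addr0.
    by rewrite mulrC mnmE -zl ordSK.
  by move=> m' /negbTE ->; rewrite mulr0 mulr0.
rewrite (memN_msupp_eq0 hm) mulr0 big_seq big1 // => m' hm'.
by case: eqP => [e|_]; [rewrite -e hm' in hm|rewrite mulr0 mulr0].
Qed.

Lemma foldr_opTinv_1 f m j : (1 < n)%N ->
  (foldr (opTinv 1 (n:=n)) f (ihi j))@_m =
  f@_[multinom (if (k < j)%N then m k else
                 if k.+1 == n then m j else m (ordS k)) | k < n].
Proof.
move=> n2; have [d] := ubnP (n - j)%N; elim: d j m => // d IH j m hd.
have hj := ltn_ord j; have [e|ne] := eqVneq j.+1 n.
  rewrite hi_last //; congr (mcoeff _ _); apply/mnmP => k; rewrite mnmE.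
  have hk := ltn_ord k; case: ltnP => // hjk.
  have -> : k = j by apply: ord_inj; lia.
  by rewrite e eqxx.
have h : (j.+1 < n)%N by lia.
have Sj := ordS_val h.
rewrite hi_S // [foldr _ _ _]/= opTinv_1 mcoeff_sym IH; last by rewrite Sj; lia.
congr (mcoeff _ _); apply/mnmP => k; rewrite !mnmE Sj.
have hk := ltn_ord k; rewrite ltnS leq_eqVlt.
have [e|nkj] := eqVneq (k : nat) j.
  have -> : k = j by apply: ord_inj.
  by rewrite ltnn tpermL; case: eqP => // e'; rewrite e' eqxx in ne.
case: ltnP => hkj /=.
  by rewrite tpermD //; apply: ord_neq; rewrite ?Sj; lia.
rewrite tpermR; case: eqP => // nl.
by rewrite tpermD //; apply: ord_neq; rewrite ?Sj ordS_val; lia.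
Qed.

(** At t = 1 every T_i is the transposition s_i, and the transpositions in Y_i undo the rotation in
    omega: monomials become eigenvectors. *)
Lemma opY_1_coef i f m : (1 < n)%N -> (opY q 1 i f)@_m = q ^+ m i * f@_m.
Proof.
move=> n2; have [d] := ubnP i; elim: d i f m => // d IH i f m hd.
have hi := ltn_ord i; have [i0|ip] := posnP i.
  rewrite /opY -/(ilo i) (lo0 i0) -/(ihi i) {1}i0 expr0 invr1 scale1r [foldr (opT _ (n:=n)) _ _]/=.
  have ltF (k : 'I_n) : (k < i)%N = false by rewrite i0.
  rewrite foldr_opTinv_1 // (@mcoeff_omega _ _ (ord_pred i)); last first.
    by rewrite ord_pred_val0 //; lia.
  rewrite mnmE ltF (ord_pred_val0 i0) prednK ?eqxx //; last by lia.
  congr (_ * mcoeff _ _); apply/mnmP => k; rewrite mnmE mnmE ltF ord_predK.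
  case: eqP => // e; congr (m _); have [k0|kp] := posnP k.
    by apply: ord_inj; rewrite k0 i0.
  by have := ltn_ord k; rewrite (ord_pred_val kp) in e; lia.
have e : i = ordS (ord_pred i) by rewrite ord_predK.
have ep := ord_pred_val ip; set p := ord_pred i in e ep.
have hp : (p.+1 < n)%N by lia.
have := @opY_rec _ q 1 n (oner_neq0 _) p f hp; rewrite scale1r -e => <-.
rewrite !opT_1 mcoeff_sym IH; last by lia.
rewrite mnmE tpermL -e mcoeff_sym; congr (_ * mcoeff _ _).
by apply/mnmP => k; rewrite !mnmE tpermK.
Qed.

End T1.

Section Unique.
Variables (P : idomainType) (K L : fieldType).
Variables (iota : {rmorphism P -> K}) (eps : {rmorphism P -> L}) (n : nat).
Variables (q0 t0 u0 : P).
Implicit Types (f : {mpoly K[n]}) (i j k : 'I_n) (eta : 'X_{1..n}).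
Hypothesis n2 : (1 < n)%N.
Hypothesis iota_inj : injective iota.
Hypothesis iota_frac : forall c : K, exists a b : P, b != 0 /\ iota b * c = iota a.
Hypothesis u0_neq0 : u0 != 0.
(** u0 stands for t - 1. The kernel of eps lies in the ideal of u0, and no nonzero element is
    divisible by all its powers, so a nonzero vector can be rescaled to have a nonzero limit. *)
Hypothesis eps_u0 : forall a, eps a = 0 -> exists b, a = u0 * b.
Hypothesis u0_div : forall a, a != 0 -> exists N, forall b, a <> u0 ^+ N * b.
Hypothesis eps_t0 : eps t0 = 1.
Hypothesis eps_q0 : forall a b, eps q0 ^+ a = eps q0 ^+ b -> a = b.
Hypothesis L2 : 2%:R != 0 :> L.

Local Notation q := (iota q0).
Local Notation t := (iota t0).

Lemma clear_denom f : exists d (f0 : {mpoly P[n]}),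
  d != 0 /\ iota d *: f = map_mpoly iota f0.
Proof.
elim/mpolyC_ind_comm: f => [|f g [d [p [nz h]]] [d' [p' [nz' h']]]|c f [d [p [nz h]]]|k f [d [p [nz h]]]].
- by exists 1, 1; rewrite oner_neq0 rmorph1 scale1r map_mpoly1.
- exists (d * d'), (d' *: p + d *: p'); split; first exact: mulf_neq0.
  rewrite map_mpolyD !map_mpolyZ -h -h' !scalerA rmorphM scalerDr.
  by rewrite [iota d' * _]mulrC.
- have [a [b [nb hb]]] := iota_frac c; exists (d * b), (a *: p); split; first exact: mulf_neq0.
  by rewrite map_mpolyZ -h !scalerA rmorphM -hb; congr (_ *: _); ring.
- by exists d, ('X_k * p); split=> //; rewrite map_mpolyM map_mpolyX -h scalerAr.
Qed.

Lemma mpoly_neq0_coef (A : nzRingType) (f : {mpoly A[n]}) : f != 0 -> exists m, f@_m != 0.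
Proof.
move=> nf; case e : (msupp f) => [|m s].
  by case/negP: nf; apply/eqP/msuppnil0.
by exists m; rewrite -mcoeff_msupp e mem_head.
Qed.

(** As long as eps kills f, u0 divides all its coefficients; N bounds the order of one nonzero
    coefficient and drops at each division. *)
Lemma divide_out (f : {mpoly P[n]}) : f != 0 ->
  exists (e : P) (f1 : {mpoly P[n]}),
    [/\ e != 0, f = e *: f1 & map_mpoly eps f1 != 0].
Proof.
move=> nf; have [m nm] := mpoly_neq0_coef nf.
have [N hN] := u0_div nm; elim: N f {nf nm} hN => [|N IH] f hN.
  by case: (hN f@_m); rewrite expr0 mul1r.
have [h|h] := eqVneq (map_mpoly eps f) 0; last first.
  by exists 1, f; rewrite oner_neq0 scale1r.
have [b hb] : exists b : 'X_{1..n} -> P, forall m', f@_m' = u0 * b m'.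
  have hm m' : exists b, f@_m' = u0 * b.
    by apply: eps_u0; rewrite -mcoeff_map_mpoly h mcoeff0.
  by have [b hb] := choice hm; exists b.
pose f' := \sum_(m' <- msupp f) b m' *: 'X_[m'].
have ef : f = u0 *: f'.
  rewrite {1}(mpolyE f) /f' scaler_sumr; apply: eq_bigr => m' _.
  by rewrite scalerA -hb.
have [c ec|e [f1 [ne e1 h1]]] := IH f'.
  by apply: (hN c); rewrite ef mcoeffZ ec exprS mulrA.
exists (u0 * e), f1; split=> //; first exact: mulf_neq0.
by rewrite -scalerA -e1.
Qed.

Lemma rescale f : f != 0 -> exists c g, [/\ c != 0, g != 0 & Rel iota eps (c *: f) g].
Proof.
move=> nf; have [d [f0 [nd h0]]] := clear_denom f.
have nid a : a != 0 -> iota a != 0.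
  by move=> na; apply: contra na => /eqP e; apply/eqP/iota_inj; rewrite e rmorph0.
have nf0 : f0 != 0.
  apply: contra_neq nf => e; have := h0; rewrite e raddf0 => /eqP.
  by rewrite scaler_eq0 (negbTE (nid _ nd)) /= => /eqP.
have [e [f1 [ne e1 h1]]] := divide_out nf0.
exists (iota d / iota e), (map_mpoly eps f1); split=> //.
  by rewrite mulf_neq0 ?invr_eq0 ?nid.
rewrite mulrC -scalerA h0 e1 map_mpolyZ scalerA mulVf ?nid // scale1r.
exact: Rel_map.
Qed.

(** The nonzero limit of the rescaled vector is an eigenvector of the diagonal operators of
    [opY_1_coef], and powers of q separate monomials. The exponents r are free, as powers of t tend
    to 1; [wt_sym] applies this to a weight that is not that of eta. *)
Lemma wt_limit f (eta : 'X_{1..n}) (r : 'I_n -> nat) : f != 0 ->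
  (forall i, opY q t i f = (q ^+ eta i * t ^- r i) *: f) ->
  exists c (g : {mpoly L[n]}),
    [/\ c != 0, g@_eta != 0, Rel iota eps (c *: f) g & forall m, g@_m != 0 -> m = eta].
Proof.
move=> nf wf; have [c [g [nc ng hR]]] := rescale nf.
have tn0 : t != 0.
  by apply: (relK_neq0 iota_inj (relK_iota iota eps t0)); rewrite eps_t0 oner_neq0.
have hq := relK_iota iota eps q0; have ht := relK_iota iota eps t0.
have eq0 : eps q0 != 0.
  by apply/eqP => e; have := @eps_q0 1 2; rewrite e expr1 expr0n => /(_ erefl).
have supp m : g@_m != 0 -> m = eta.
  move=> nm; apply/mnmP => i; apply: eps_q0; apply: (mulIf nm).
  rewrite -(opY_1_coef eq0 i) // -mcoeffZ; congr (mcoeff _ _).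
  have r1 : Rel iota eps (opY q t i (c *: f)) (opY (eps q0) 1 i g).
    by rewrite -eps_t0; apply: Rel_opY => //; rewrite eps_t0 oner_neq0.
  apply: (Rel_fun iota_inj r1); rewrite opYZ // wf scalerA mulrC -scalerA.
  apply: RelZ => //; rewrite -[X in relK _ _ _ X]mulr1.
  apply: relKM; first exact: relKX.
  rewrite -[X in relK _ _ _ X]invr1; apply: relKV; rewrite ?oner_neq0 //.
  by rewrite -(expr1n _ (r i)) -eps_t0; apply: relKX.
exists c, g; split=> //.
by have [m nm] := mpoly_neq0_coef ng; rewrite -(supp m nm).
Qed.

Hypothesis q_neq0 : q != 0.

Lemma iota_t_neq0 : t != 0.
Proof.
by apply: (relK_neq0 iota_inj (relK_iota iota eps t0)); rewrite eps_t0 oner_neq0.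
Qed.

Lemma wt_coef_neq0 eta f : f != 0 -> wt q t eta f -> f@_eta != 0.
Proof.
move=> nf wf; have [i|c [g [nc ng hR _]]] := @wt_limit f eta (rk eta) nf.
  by rewrite wf eigvalE.
have := relK_neq0 iota_inj (Rel_coef eta hR) ng.
by rewrite mcoeffZ mulf_eq0 negb_or => /andP[].
Qed.

Lemma wt_unique eta f g : wt q t eta f -> wt q t eta g -> g@_eta = 1 ->
  f = f@_eta *: g.
Proof.
move=> wf wg g1; apply/eqP; rewrite -subr_eq0; apply/negPn/negP => h.
have wd : wt q t eta (f - f@_eta *: g).
  move=> i; have tn0 := iota_t_neq0; rewrite -scaleNr opYD // opYZ // wf wg.
  by rewrite scalerDr !scalerA mulrC.
by have := wt_coef_neq0 h wd; rewrite mcoeffB mcoeffZ g1 mulr1 subrr eqxx.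
Qed.

(** If h = T_i f - t f were nonzero, the quadratic relation would give T_i h = - h. In the limit t =
    1, h becomes a multiple of x^eta, fixed by s_i, hence equal to its own opposite. *)
Lemma wt_sym eta f i : (i.+1 < n)%N -> eta i = eta (ordS i) -> wt q t eta f ->
  opT t i f = t *: f.
Proof.
move=> hi e wf; apply/eqP; rewrite -subr_eq0; apply/negPn/negP => nh.
have tn0 := iota_t_neq0.
set h := opT t i f - t *: f in nh.
have eh : h = opT t i f + (- t) *: f by rewrite scaleNr.
(* The constant - t solves the intertwiner equation, because by [rk_eq] the eigenvalue at i is t^-1
   times the one at the next position. *)
have wh k : opY q t k h = eigval q t (tperm i (ordS i) k) eta *: h.
  rewrite eh (@opY_opT _ q t n q_neq0 tn0 f (fun k => eigval q t k eta)) //.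
  rewrite !eigvalE (rk_eq hi e) e exprSr invfM.
  by move: (q ^+ _) (t ^- _) => x y; field.
have Th : opT t i h = - h.
  have -> : opT t i h = opT t i (opT t i f) - t *: opT t i f.
    by rewrite /h -scaleNr opTD // opTZ // scaleNr.
  rewrite opT_quad // /h; move: (opT t i f) => a.
  rewrite scalerBl scale1r opprB; move: (t *: a) (t *: f) => u v.
  by rewrite addrAC [u - a - u]addrAC subrr add0r addrC.
have [k|c [g [nc ng hR hs]]] := @wt_limit h eta (fun k => rk eta (tperm i (ordS i) k)) nh.
  rewrite wh eigvalE; congr ((q ^+ _ * _) *: _).
  by case: tpermP => [->|->|]; rewrite ?e.
have r1 : Rel iota eps (opT t i (c *: h)) (opT 1 i g).
  by rewrite -eps_t0; apply: Rel_opT => //; exact: relK_iota.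
have r2 : Rel iota eps (opT t i (c *: h)) (- g).
  rewrite opTZ // Th scalerN -scaleN1r -[- g]scaleN1r; apply: RelZ => //.
  by apply: relKN; exact: relK1.
have := congr1 (mcoeff eta) (Rel_fun iota_inj r1 r2).
rewrite opT_1 mcoeff_sym mcoeffN.
have -> : [multinom eta (tperm i (ordS i) k) | k < n] = eta.
  by apply/mnmP => k; rewrite mnmE; case: tpermP => [->|->|].
move/eqP; rewrite -addr_eq0 -mulr2n -mulr_natr mulf_eq0 (negbTE ng) /=.
by rewrite (negbTE L2).
Qed.

End Unique.

Local Notation P2 := {poly {poly rat}}.
Local Notation L1 := {fraction {poly rat}}.

Definition iotaF : {rmorphism P2 -> Qqt} := @tofrac _.

(** The limit t = 1 with q kept: elements of [P2] are polynomials in q over Q[t], so the evaluation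
    acts on coefficients. *)
Definition eps1 : {rmorphism P2 -> L1} := @tofrac _ \o map_poly (horner_eval 1).

Lemma iotaF_inj : injective iotaF.
Proof. by move=> a b /eqP; rewrite tofrac_eq => /eqP. Qed.

Lemma iotaF_frac (c : Qqt) : exists a b : P2, b != 0 /\ iotaF b * c = iotaF a.
Proof.
have [a [b [nb ->]]] := frac_ex c; exists a, b; split=> //.
by rewrite mulrC divfK // tofrac_eq0.
Qed.

Lemma eps1_q : eps1 'X = tofrac 'X.
Proof. by rewrite /eps1 /= map_polyX. Qed.

Lemma eps1_t : eps1 'X%:P = 1.
Proof. by rewrite /eps1 /= map_polyC /= /horner_eval hornerX polyC1 tofrac1. Qed.

Lemma eps1_q_inj a b : eps1 'X ^+ a = eps1 'X ^+ b -> a = b.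
Proof.
rewrite eps1_q -!tofracXn => /eqP; rewrite tofrac_eq => /eqP.
by move/(congr1 (fun p : {poly rat} => size p)); rewrite !size_polyXn => -[].
Qed.

Lemma eps1_eq0 (a : P2) : eps1 a = 0 -> exists b, a = ('X - 1%:P)%:P * b.
Proof.
rewrite /eps1 /= => /eqP; rewrite tofrac_eq0 => /eqP h.
exists (map_poly (fun p : {poly rat} => p %/ ('X - 1%:P)) a); apply/polyP => j.
rewrite coefCM coef_map_id0 ?div0p //.
have : root (a`_j) 1.
  by have := congr1 (fun p : {poly rat} => p`_j) h; rewrite coef0 coef_map /= /horner_eval => /eqP.
by rewrite -dvdp_XsubCl => /divpK {1}<-; rewrite mulrC.
Qed.

Lemma XsubC1_div (a : P2) : a != 0 ->
  exists N, forall b, a <> (('X - 1%:P)%:P : P2) ^+ N * b.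
Proof.
move=> na; have nl : lead_coef a != 0 by rewrite lead_coef_eq0.
(* A power of t - 1 that divides a divides its leading coefficient in q, whose size exceeds every
   possible exponent. *)
exists (size (lead_coef a)) => b e.
have := congr1 (fun p : P2 => p`_(size a).-1) e.
rewrite -rmorphXn /= coefCM -/(lead_coef a) => e'.
have nb : b`_(size a).-1 != 0 by apply: contra_neq nl => h; rewrite e' h mulr0.
have := congr1 (fun p : {poly rat} => size p) e'.
rewrite size_monicM ?size_exp_XsubC ?monic_exp ?monicXsubC //.
move: nb; rewrite -size_poly_gt0.
by set x := size _; set y := size _; move: x y => x y; lia.
Qed.

Lemma L1_char : 2%:R != 0 :> L1.
Proof.
rewrite -(rmorph_nat (@tofrac {poly rat})) tofrac_eq0.
by rewrite -polyC_natr polyC_eq0.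
Qed.

Lemma XsubC1_neq0 : (('X - 1%:P)%:P : P2) != 0.
Proof. by rewrite polyC_eq0 polyXsubC_eq0. Qed.

Lemma KqE : Kq = iotaF 'X. Proof. by []. Qed.
Lemma Kq_neq0 : Kq != 0.
Proof. by rewrite tofrac_eq0 polyX_eq0. Qed.

Lemma Kt_neq0 : Kt != 0.
Proof. by rewrite tofrac_eq0 polyC_eq0 polyX_eq0. Qed.

Section UniqueQqt.
Variable n : nat.
Hypothesis n2 : (1 < n)%N.
Implicit Types (f g : {mpoly Qqt[n]}) (eta : 'X_{1..n}).

Lemma wtK_unique eta f g : wt Kq Kt eta f -> wt Kq Kt eta g -> g@_eta = 1 ->
  f = f@_eta *: g.
Proof.
exact: (@wt_unique _ _ _ iotaF eps1 n 'X 'X%:P _ n2 iotaF_inj iotaF_frac XsubC1_neq0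
  eps1_eq0 XsubC1_div eps1_t eps1_q_inj).
Qed.

Lemma wtK_sym eta f (i : 'I_n) : (i.+1 < n)%N -> eta i = eta (ordS i) ->
  wt Kq Kt eta f -> opT Kt i f = Kt *: f.
Proof.
exact: (@wt_sym _ _ _ iotaF eps1 n 'X 'X%:P _ n2 iotaF_inj iotaF_frac XsubC1_neq0
  eps1_eq0 XsubC1_div eps1_t eps1_q_inj L1_char Kq_neq0).
Qed.

End UniqueQqt.

(** * The exchange family of a weight vector *)

Section Rearr.
Variable n : nat.
Implicit Types (lam eta zeta : 'X_{1..n}) (i j k : 'I_n).

Lemma rearrP lam eta :
  reflect (exists s : 'S_n, eta = [multinom lam (s i) | i < n]) (eta \in rearr lam).
Proof.
rewrite mem_undup; apply: (iffP mapP) => [[s _ ->]|[s ->]]; exists s => //.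
by rewrite mem_enum.
Qed.

Lemma rearr_perm lam eta : (eta \in rearr lam) = perm_eq eta lam.
Proof.
apply/rearrP/tuple_permP => -[s e]; exists s.
  by rewrite e; congr val; apply: eq_from_tnth => i; rewrite !tnth_mktuple -multinomE.
by apply/mnmP => i; rewrite mnmE /fun_of_multinom (val_inj e) tnth_mktuple.
Qed.

Lemma rearr_refl lam : lam \in rearr lam.
Proof. by rewrite rearr_perm perm_refl. Qed.

Lemma rearr_sym lam eta : eta \in rearr lam -> lam \in rearr eta.
Proof. by rewrite !rearr_perm perm_sym. Qed.

Lemma rearr_act lam eta (s : 'S_n) :
  eta \in rearr lam -> [multinom eta (s i) | i < n] \in rearr lam.
Proof.
move=> /rearrP[u ->]; apply/rearrP; exists (s * u)%g.
by apply/mnmP => i; rewrite !mnmE permM.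
Qed.

Lemma swap_rearr lam eta i : eta \in rearr lam -> swap_comp i eta \in rearr lam.
Proof. exact: rearr_act. Qed.

Lemma rot_rearr lam eta : eta \in rearr lam -> rot_comp eta \in rearr lam.
Proof.
have inj : injective (@ord_pred n) by apply: can_inj (@ord_predK n).
move=> /(rearr_act (perm inj)).
have -> // : [multinom eta (perm inj i) | i < n] = rot_comp eta.
by apply/mnmP => i; rewrite !mnmE permE.
Qed.

Lemma swap_compK i : involutive (@swap_comp n i).
Proof. by move=> eta; apply/mnmP => k; rewrite !mnmE tpermK. Qed.

Lemma swap_compL eta i : swap_comp i eta i = eta (ordS i).
Proof. by rewrite mnmE tpermL. Qed.

Lemma swap_compR eta i : swap_comp i eta (ordS i) = eta i.
Proof. by rewrite mnmE tpermR. Qed.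

Lemma swap_compD eta i k : k != i -> k != ordS i -> swap_comp i eta k = eta k.
Proof. by move=> h1 h2; rewrite mnmE tpermD // eq_sym. Qed.

Lemma swap_comp_eq eta i : eta i = eta (ordS i) -> swap_comp i eta = eta.
Proof. by move=> e; apply/mnmP => k; rewrite mnmE; case: tpermP => [->|->|]. Qed.

Lemma swap_comm eta i j : (i.+1 < j)%N -> (j.+1 < n)%N ->
  swap_comp i (swap_comp j eta) = swap_comp j (swap_comp i eta).
Proof.
move=> hij hj; have Si : ordS i = i.+1 :> nat by rewrite ordS_val //; lia.
have Sj := ordS_val hj; apply/mnmP => k; rewrite !mnmE -!permM.
by rewrite [in LHS]conjgC tpermJ !tpermD //; apply: ord_neq; rewrite ?Si ?Sj; lia.
Qed.

Lemma swap_braid eta i : (i.+2 < n)%N ->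
  swap_comp i (swap_comp (ordS i) (swap_comp i eta)) =
  swap_comp (ordS i) (swap_comp i (swap_comp (ordS i) eta)).
Proof.
move=> hi; have Si : ordS i = i.+1 :> nat by rewrite ordS_val //; lia.
have SSi : ordS (ordS i) = i.+2 :> nat by rewrite ordS_val Si.
have [d1 d2] : ordS i != ordS (ordS i) /\ i != ordS (ordS i).
  by split; apply: ord_neq; rewrite SSi ?Si; lia.
have d3 : ordS i != i by apply: ord_neq; rewrite Si; lia.
have conj (x y z : 'I_n) : x != z -> y != z ->
    (tperm x y * (tperm y z * tperm x y))%g = tperm x z.
  by move=> xz yz; rewrite -{1}(tpermV x y) -conjgE tpermJ tpermR tpermD.
apply/mnmP => k; rewrite !mnmE -!permM conj //.
have [s1 s2] : ordS (ordS i) != i /\ ordS i != i by rewrite eq_sym.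
by rewrite [tperm i (ordS i)]tpermC [tperm (ordS i) (ordS (ordS i))]tpermC conj // tpermC.
Qed.

Definition ascent eta i := (i.+1 < n)%N && (eta i < eta (ordS i))%N.

(** Induction measure on rearrangements: swapping an ascent lowers it, and only the partition has no
    ascent. *)
Definition mes eta := (\sum_(i < n) i * eta i)%N.

Lemma mes_swap eta i : ascent eta i -> (mes (swap_comp i eta) < mes eta)%N.
Proof.
move=> /andP[hi h]; have Si := ordS_val hi.
have ne : ordS i != i by rewrite eq_sym ordS_neq //; lia.
rewrite /mes (bigD1 i) //= (bigD1 (ordS i)) //= [ltnRHS](bigD1 i) //=.
rewrite [X in (_ < _ + X)%N](bigD1 (ordS i)) //= swap_compL swap_compR.
have -> : (\sum_(k | (k != i) && (k != ordS i)) k * swap_comp i eta k =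
           \sum_(k | (k != i) && (k != ordS i)) k * eta k)%N.
  by apply: eq_bigr => k /andP[h1 h2]; rewrite swap_compD.
rewrite !addnA ltn_add2r -[(i.+1 %% n)%N]/(nat_of_ord (ordS i)) Si.
by move: (eta i) (eta (ordS i)) h => x y h; nia.
Qed.

Lemma partition_unique lam eta : is_partition lam -> is_partition eta ->
  eta \in rearr lam -> eta = lam.
Proof.
have srt zeta : is_partition zeta -> sorted geq zeta.
  move=> h; apply/(sortedP 0%N) => k; rewrite size_tuple => hk.
  have := h (Ordinal (ltnW hk)) (Ordinal hk) (leqnSn _).
  by rewrite /fun_of_multinom !(tnth_nth 0%N).
move=> h1 h2; rewrite rearr_perm => h; do 2!apply: val_inj => /=.
apply: (sorted_eq (leT := geq)) (srt _ h2) (srt _ h1) h => [x y z|x y]; rewrite /=; lia.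
Qed.

Lemma partition_adj lam : (forall i, (i.+1 < n)%N -> (lam (ordS i) <= lam i)%N) ->
  is_partition lam.
Proof.
move=> h i j; have [d] := ubnP (j - i)%N; elim: d j => // d IH j hd hij.
have [e|ne] := eqVneq (i : nat) j; first by have -> : i = j by apply: ord_inj.
have jp : (0 < j)%N by lia.
have ep := ord_pred_val jp; have hj := ltn_ord j.
rewrite -(ord_predK j); apply: leq_trans (h _ _) (IH _ _ _); lia.
Qed.

Lemma no_ascent lam eta : is_partition lam -> eta \in rearr lam ->
  (forall i, ~~ ascent eta i) -> eta = lam.
Proof.
move=> pl hr h; apply: partition_unique => //; apply: partition_adj => i hi.
by have := h i; rewrite /ascent hi /= -leqNgt.
Qed.

End Rearr.

Section Family.
Variables (n : nat) (V : Type) (T : 'I_n -> V -> V) (Z : V -> V).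
Variables (lam : 'X_{1..n}) (E : V).
Implicit Types (eta : 'X_{1..n}) (i j k : 'I_n) (v : V).
Hypothesis TZ : forall i v, (i.+1 < n)%N -> T i (Z v) = Z (T i v).
Hypothesis TTcomm : forall i j v, (i.+1 < j)%N -> (j.+1 < n)%N ->
  T i (T j v) = T j (T i v).
Hypothesis TTbraid : forall i v, (i.+2 < n)%N ->
  T i (T (ordS i) (T i v)) = T (ordS i) (T i (T (ordS i) v)).
Hypothesis plam : is_partition lam.
Hypothesis E_sym : forall i, (i.+1 < n)%N -> lam i = lam (ordS i) -> T i E = Z E.

(** eta is sorted along whichever ascents [pick] returns; [fam_local] shows that any other choice of
    ascents gives the same vector. Z stands for multiplication by t. *)
Fixpoint fam_rec d eta : V :=
  if d is d'.+1 then
    if [pick i | ascent eta i] is Some i then T i (fam_rec d' (swap_comp i eta)) else E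
  else E.

Definition fam eta := fam_rec (mes eta) eta.

Lemma fam_rec_fuel d eta : (mes eta <= d)%N -> fam_rec d eta = fam eta.
Proof.
rewrite /fam; have [m] := ubnP (mes eta); elim: m d eta => // m IH d eta hm hd.
case e : (mes eta) hd => [|m'] hd; case: d hd => [|d] hd //=; case: pickP => // i hi.
  by have := mes_swap hi; rewrite e.
by have := mes_swap hi => hs; congr (T _ _); rewrite !IH //; lia.
Qed.

Lemma famE eta : fam eta =
  if [pick i | ascent eta i] is Some i then T i (fam (swap_comp i eta)) else E.
Proof.
rewrite -(fam_rec_fuel (leqnSn _)) /=; case: pickP => // i hi; congr (T _ _).
by apply: fam_rec_fuel; apply: ltnW; apply: mes_swap.
Qed.

Lemma ascent_lam i : ascent lam i = false.
Proof.
apply/negP => /andP[hi]; rewrite ltnNge plam //.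
by have := ordS_val hi; lia.
Qed.

Lemma fam_lam : fam lam = E.
Proof. by rewrite famE; case: pickP => // i; rewrite ascent_lam. Qed.

Let local eta := (forall i, ascent eta i -> fam eta = T i (fam (swap_comp i eta))) /\
  (forall i, (i.+1 < n)%N -> eta i = eta (ordS i) -> T i (fam eta) = Z (fam eta)).

(** Diamond argument on [mes]: two ascents are reconciled by [TTcomm] when they are far apart and by
    [TTbraid] when they are adjacent. The tie relation belongs to the induction, since the braid
    relation carries a tie beside an ascent to a tie of a smaller rearrangement. *)
Lemma fam_local eta : eta \in rearr lam -> local eta.
Proof.
have [d] := ubnP (mes eta); elim: d eta => // d IH eta hd hr.
have [a ha|ha] := pickP (ascent eta); last first.
  have -> : eta = lam by apply: no_ascent => // i; rewrite ha.
  by split=> [i|i hi e]; [rewrite ascent_lam|rewrite fam_lam E_sym].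
have {}IH zeta : (mes zeta < mes eta)%N -> zeta \in rearr lam -> local zeta.
  by move=> hz; apply: IH; lia.
have st zeta i : ascent zeta i -> (mes zeta <= mes eta)%N -> zeta \in rearr lam ->
    [/\ swap_comp i zeta \in rearr lam, (mes (swap_comp i zeta) < mes eta)%N &
        local (swap_comp i zeta)].
  move=> hi hz hr'; have h1 := mes_swap hi; have h2 := swap_rearr i hr'.
  have h3 : (mes (swap_comp i zeta) < mes eta)%N by lia.
  by split=> //; apply: IH.
have far i j : (i.+1 < n)%N -> (j.+1 < n)%N -> (i.+1 < j)%N || (j.+1 < i)%N ->
    [/\ swap_comp i eta j = eta j, swap_comp i eta (ordS j) = eta (ordS j) &
      (forall v, T i (T j v) = T j (T i v)) /\
      swap_comp i (swap_comp j eta) = swap_comp j (swap_comp i eta)].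
  move=> hi hj hij; have Si := ordS_val hi; have Sj := ordS_val hj.
  split; try by apply: swap_compD; apply: ord_neq; lia.
  by case/orP: hij => h; split=> [v|]; rewrite ?(TTcomm _ h) ?(swap_comm _ h) //
     -?(TTcomm _ h) -?(swap_comm _ h).
have near i : (i.+2 < n)%N -> [/\ swap_comp i eta (ordS (ordS i)) = eta (ordS (ordS i))
     & swap_comp (ordS i) eta i = eta i].
  move=> hi; have Si : ordS i = i.+1 :> nat by rewrite ordS_val //; lia.
  have SSi : ordS (ordS i) = i.+2 :> nat by rewrite ordS_val Si.
  by split; apply: swap_compD; apply: ord_neq; lia.
(* The three patterns of entries at i, i+1, i+2: two ascents, an ascent followed by a tie, a tie
   followed by an ascent. *)
have braid i : (i.+2 < n)%N ->
    [/\ ascent eta i -> ascent eta (ordS i) ->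
           T i (fam (swap_comp i eta)) = T (ordS i) (fam (swap_comp (ordS i) eta)),
        ascent eta i -> eta (ordS i) = eta (ordS (ordS i)) ->
           T (ordS i) (T i (fam (swap_comp i eta))) = Z (T i (fam (swap_comp i eta))) &
        ascent eta (ordS i) -> eta i = eta (ordS i) ->
           T i (T (ordS i) (fam (swap_comp (ordS i) eta))) =
           Z (T (ordS i) (fam (swap_comp (ordS i) eta)))].
  move=> h2; have [e1 e2] := near _ h2; have h1 : (i.+1 < n)%N by lia.
  have h3 : ((ordS i).+1 < n)%N by rewrite ordS_val.
  have x1 zeta : swap_comp i zeta (ordS (ordS i)) = zeta (ordS (ordS i)).
    have Si := ordS_val h1; have SSi := ordS_val h3.
    by apply: swap_compD; apply: ord_neq; rewrite SSi Si; lia.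
  have x2 zeta : swap_comp (ordS i) zeta i = zeta i.
    have Si := ordS_val h1; have SSi := ordS_val h3.
    by apply: swap_compD; apply: ord_neq; rewrite ?SSi Si; lia.
  split.
  - move=> hi hj; have [[_ hi2] [_ hj2]] := (andP hi, andP hj).
    have [r1 m1 [A1 _]] := st _ _ hi (leqnn _) hr.
    have [r2 m2 [A2 _]] := st _ _ hj (leqnn _) hr.
    have a1 : ascent (swap_comp i eta) (ordS i).
      by rewrite /ascent h3 swap_compR x1 (ltn_trans hi2).
    have a2 : ascent (swap_comp (ordS i) eta) i.
      by rewrite /ascent h1 swap_compL x2 (ltn_trans hi2).
    have [_ _ [B1 _]] := st _ _ a1 (ltnW m1) r1.
    have [_ _ [B2 _]] := st _ _ a2 (ltnW m2) r2.
    rewrite (A1 _ a1) (A2 _ a2) (B1 i) ?(B2 (ordS i)); first by rewrite TTbraid ?swap_braid.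
      by rewrite /ascent h3 swap_compR x1 x2 swap_compR.
    by rewrite /ascent h1 x2 swap_compL swap_compL x1.
  - move=> hi e; have [_ hi2] := andP hi.
    have [r1 m1 [A1 _]] := st _ _ hi (leqnn _) hr.
    have a1 : ascent (swap_comp i eta) (ordS i) by rewrite /ascent h3 swap_compR x1 -e.
    have [_ _ [_ B1]] := st _ _ a1 (ltnW m1) r1.
    rewrite (A1 _ a1) -TTbraid // B1 // ?TZ //.
    by rewrite x2 swap_compL swap_compL x1.
  - move=> hi e; have [_ hi2] := andP hi.
    have [r1 m1 [A1 _]] := st _ _ hi (leqnn _) hr.
    have a1 : ascent (swap_comp (ordS i) eta) i by rewrite /ascent h1 swap_compL x2 e.
    have [_ _ [_ B1]] := st _ _ a1 (ltnW m1) r1.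
    rewrite (A1 _ a1) TTbraid // B1 // ?TZ //.
    by rewrite swap_compR x1 x2 swap_compR.
have [/andP[ha1 ha2] [_ _ [Ia Sa]]] := (ha, st _ _ ha (leqnn _) hr).
(* The ascent a is fixed; Q b says that choosing b gives the same vector as choosing a, and that
   this vector obeys the tie relation at b. *)
pose Q b := (ascent eta b -> T a (fam (swap_comp a eta)) = T b (fam (swap_comp b eta))) /\
   ((b.+1 < n)%N -> eta b = eta (ordS b) ->
      T b (T a (fam (swap_comp a eta))) = Z (T a (fam (swap_comp a eta)))).
suff hQ b : Q b.
  have ea : fam eta = T a (fam (swap_comp a eta)).
    rewrite famE; case: pickP => [i hi|/(_ a)]; last by rewrite ha.
    by have [h _] := hQ i; rewrite h.
  split=> b hb; first by have [h _] := hQ b; rewrite ea h.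
  by move=> e; have [_ h] := hQ b; rewrite ea h.
have [hb1|hb1] := boolP (b.+1 < n)%N; last first.
  by split=> [/andP[]|]; rewrite (negbTE hb1).
have Va := ordS_val ha1; have Vb := ordS_val hb1.
have [e|nab] := eqVneq a b; first by rewrite -e; split=> // _ e'; rewrite -e' ltnn in ha2.
have nab' : (a : nat) != b by rewrite (inj_eq (@ord_inj n)).
have [hab|hab] := boolP ((a.+1 < b)%N || (b.+1 < a)%N).
  have [e1 e2 [cT cs]] := far _ _ ha1 hb1 hab.
  split=> [hb|_ e]; last by rewrite -cT Sa ?e1 ?e2 // TZ.
  have [_ _ [Ib _]] := st _ _ hb (leqnn _) hr; rewrite orbC in hab.
  have [e3 e4 _] := far _ _ hb1 ha1 hab.
  have a1 : ascent (swap_comp a eta) b by rewrite /ascent hb1 e1 e2; case/andP: hb.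
  have a2 : ascent (swap_comp b eta) a by rewrite /ascent ha1 e3 e4.
  by rewrite (Ia b a1) (Ib a a2) cT cs.
have [e|e] : ordS a = b \/ ordS b = a.
  have [h|h] : a.+1 = b \/ b.+1 = a by lia.
    by left; apply: ord_inj; rewrite Va.
  by right; apply: ord_inj; rewrite Vb.
- subst b; have h2 : (a.+2 < n)%N by rewrite Va in hb1.
  by have [p1 p2 p3] := braid _ h2; split=> [hb|_ e]; [exact: p1|exact: p2].
- have h2 : (b.+2 < n)%N by rewrite -e Vb in ha1.
  have [p1 p2 p3] := braid _ h2; rewrite e in p1 p3.
  by split=> [hb|_ e']; [rewrite p1|apply: p3 => //; rewrite e' e].
Qed.

Lemma fam_swap eta i : eta \in rearr lam -> (i.+1 < n)%N -> (eta (ordS i) < eta i)%N ->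
  T i (fam eta) = fam (swap_comp i eta).
Proof.
move=> hr hi h; have [A _] := fam_local (swap_rearr i hr).
by rewrite (A i) ?swap_compK // /ascent hi swap_compL swap_compR.
Qed.

Lemma fam_fix eta i : eta \in rearr lam -> (i.+1 < n)%N -> eta i = eta (ordS i) ->
  T i (fam eta) = Z (fam eta).
Proof. by move=> hr; have [_ A] := fam_local hr; exact: A. Qed.

End Family.

Lemma foldr_inj (A : Type) (I : eqType) (F : I -> A -> A) s f g :
  (forall k, k \in s -> injective (F k)) -> foldr F f s = foldr F g s -> f = g.
Proof.
elim: s => [|k s IH] //= h /(h k (mem_head _ _)); apply: IH => j hj.
by apply: h; rewrite in_cons hj orbT.
Qed.

Section Insertion.
Variables (T : Type) (n : nat) (x : 'I_n -> T) (l : 'I_n).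
Implicit Types j k : 'I_n.

(** The last value is moved to position j. From j = 0, a rotation, to j = l, the identity, each step
    is one adjacent swap; this serves for the entries of a composition and later for the variables
    x. *)
Definition insertf j k : T :=
  if (k < j)%N then x k else if k == j then x l else x (ord_pred k).

Lemma insertf_swap j k : (j.+1 < n)%N ->
  insertf (ordS j) (tperm j (ordS j) k) = insertf j k.
Proof.
move=> hj; have Sj := ordS_val hj; rewrite /insertf Sj.
have [->|kj] := eqVneq k j; first by rewrite tpermL Sj !ltnn eqxx.
have [->|kS] := eqVneq k (ordS j).
  by rewrite tpermR ltnSn Sj ordSK ltnNge leqnSn.
have kj1 : (k : nat) != j by rewrite (inj_eq (@ord_inj n)).
have -> : tperm j (ordS j) k = k by rewrite tpermD // eq_sym.
rewrite (negbTE kS).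
by have -> : (k < j.+1)%N = (k < j)%N by lia.
Qed.

Hypothesis hl : l.+1 = n.

Lemma insertf_last k : insertf l k = x k.
Proof.
rewrite /insertf; have hk := ltn_ord k; case: ltnP => // h.
by have -> : k = l; [apply: ord_inj; lia|rewrite eqxx].
Qed.

Lemma insertf_first j k : j = 0%N :> nat -> insertf j k = x (ord_pred k).
Proof.
move=> j0; rewrite /insertf j0 /=; case: eqP => // ->; congr x.
by apply: ord_inj; rewrite (ord_pred_val0 j0); lia.
Qed.

End Insertion.

Section FamilyRot.
Variables (n : nat) (lam : 'X_{1..n}) (E : {mpoly Qqt[n]}).
Hypotheses (n2 : (1 < n)%N) (plam : is_partition lam) (wE : wt Kq Kt lam E).
Implicit Types (eta : 'X_{1..n}) (i j k l : 'I_n) (f g : {mpoly Qqt[n]}).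

Definition Gfam := fam (@opT Qqt Kt n) E.

Lemma Gfam_TZ i f : (i.+1 < n)%N -> opT Kt i (Kt *: f) = Kt *: opT Kt i f.
Proof. by move=> hi; rewrite opTZ. Qed.

Lemma Gfam_sym i : (i.+1 < n)%N -> lam i = lam (ordS i) -> opT Kt i E = Kt *: E.
Proof. by move=> hi e; exact: (wtK_sym n2 hi e wE). Qed.

Lemma Gfam_lam : Gfam lam = E.
Proof. exact: fam_lam. Qed.

Lemma Gfam_swap eta i : eta \in rearr lam -> (i.+1 < n)%N -> (eta (ordS i) < eta i)%N ->
  opT Kt i (Gfam eta) = Gfam (swap_comp i eta).
Proof.
exact: (fam_swap Gfam_TZ (fun i j v => @opT_comm _ _ _ n Kq_neq0 Kt_neq0 i j v)
  (fun i v => @opT_braid _ _ _ n Kq_neq0 Kt_neq0 i v) plam Gfam_sym).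
Qed.

Lemma Gfam_fix eta i : eta \in rearr lam -> (i.+1 < n)%N -> eta i = eta (ordS i) ->
  opT Kt i (Gfam eta) = Kt *: Gfam eta.
Proof.
exact: (fam_fix Gfam_TZ (fun i j v => @opT_comm _ _ _ n Kq_neq0 Kt_neq0 i j v)
  (fun i v => @opT_braid _ _ _ n Kq_neq0 Kt_neq0 i v) plam Gfam_sym).
Qed.

Lemma opTinvK i f : (i.+1 < n)%N -> opT Kt i (opTinv Kt i f) = f.
Proof.
move=> hi; have t0 := Kt_neq0.
have -> : opTinv Kt i f = Kt^-1 *: (opT Kt i f + (1 - Kt) *: f).
  rewrite /opTinv /opT; move: (opL _ _ _) => u.
  by rewrite -scalerBr; congr (_ *: _); rewrite scalerBl scale1r [RHS]addrC addrA subrK.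
rewrite opTZ //; apply: (canLR (scalerK t0)); rewrite opTD // opTZ // opT_quad //.
by rewrite addrAC -scalerDl addrA subrK subrr scale0r add0r.
Qed.

Lemma opTinvZ i c f : (i.+1 < n)%N -> opTinv Kt i (c *: f) = c *: opTinv Kt i f.
Proof.
by move=> hi; rewrite -{1}(opTinvK f hi) -opTZ // (opTK Kt_neq0).
Qed.

Lemma opTinvs_inj j f g :
  foldr (@opTinv Qqt Kt n) f (ihi j) = foldr (@opTinv Qqt Kt n) g (ihi j) -> f = g.
Proof.
apply: foldr_inj => k /hi_mem /andP[_ hk] u v e.
by rewrite -(opTinvK u hk) e (opTinvK v hk).
Qed.

Lemma opTinvs_Z j c f :
  foldr (@opTinv Qqt Kt n) (c *: f) (ihi j) = c *: foldr (@opTinv Qqt Kt n) f (ihi j).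
Proof.
have : all (fun k : 'I_n => (k.+1 < n)%N) (ihi j).
  by apply/allP => k /hi_mem /andP[].
elim: (ihi j) => [_|k s IH /andP[hk hs]]; first exact: erefl.
by rewrite [LHS]/= (IH hs) opTinvZ.
Qed.

Definition insert_last eta l j : 'X_{1..n} := [multinom insertf eta l j k | k < n].

Lemma insert_lastS eta l j : (j.+1 < n)%N ->
  insert_last eta l (ordS j) = swap_comp j (insert_last eta l j).
Proof.
move=> hj; apply/mnmP => k; rewrite !mnmE -[X in insertf _ _ _ X = _](tpermK j (ordS j)).
exact: insertf_swap.
Qed.

Lemma insert_last_rearr eta l j : l.+1 = n -> eta \in rearr lam ->
  insert_last eta l j \in rearr lam.
Proof.
move=> hl hr; have [d] := ubnP j; elim: d j => // d IH j hd.
have [j0|jp] := posnP j.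
  have -> : insert_last eta l j = rot_comp eta; last exact: rot_rearr.
  by apply/mnmP => k; rewrite !mnmE insertf_first.
have ep := ord_pred_val jp; have hj := ltn_ord j.
rewrite -(ord_predK j) insert_lastS; last by lia.
by apply: swap_rearr; apply: IH; lia.
Qed.

(** Ascents that avoid the last entry are sorted first, by omega T_(i+1) = T_i omega. Then eta is
    lam with one part moved to the end, and the relation is the eigenvalue equation of E for a
    single Y_p: its direct factors lead from E to [Gfam (rot_comp eta)], its inverse factors from
    [Gfam eta] to a multiple of E. *)
Lemma Gfam_rot eta l : eta \in rearr lam -> l.+1 = n ->
  Kq ^+ eta l *: Gfam eta = omega Kq (Gfam (rot_comp eta)).
Proof.
move=> hr hl; have [d] := ubnP (mes eta); elim: d eta hr => // d IH eta hr hd.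
have [i /andP[hi2 hi]|hs] := pickP (fun i => (i.+2 < n)%N && ascent eta i).
  have h1 : (i.+1 < n)%N by lia.
  have h3 : ((ordS i).+1 < n)%N by rewrite ordS_val.
  have := IH _ (swap_rearr i hr) (leq_trans (mes_swap hi) hd).
  have Si := ordS_val h1.
  rewrite swap_compD; [|by apply: ord_neq; lia|by apply: ord_neq; rewrite Si; lia].
  move/(congr1 (opT Kt i)); rewrite opTZ // (Gfam_swap (swap_rearr i hr)) //; last first.
    by rewrite swap_compL swap_compR; case/andP: hi.
  rewrite swap_compK => ->.
  rewrite -(@omega_opT _ Kq Kt n Kq_neq0 Kt_neq0 i (Gfam (rot_comp (swap_comp i eta))) hi2).
  congr (omega _ _).
  have rs : rot_comp (swap_comp i eta) = swap_comp (ordS i) (rot_comp eta).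
    apply/mnmP => k; rewrite !mnmE; congr (eta _).
    have [->|k1] := eqVneq k (ordS i); first by rewrite ordSK !tpermL ordSK.
    have [->|k2] := eqVneq k (ordS (ordS i)); first by rewrite ordSK !tpermR ordSK.
    rewrite [tperm (ordS i) _ k]tpermD 1?eq_sym // tpermD //.
      by rewrite -(inj_eq (can_inj (@ordSK n))) ord_predK eq_sym.
    by rewrite -(inj_eq (can_inj (@ordSK n))) ord_predK eq_sym.
  rewrite rs Gfam_swap ?swap_compK // -?rs ?rot_rearr ?swap_rearr //.
  by rewrite !mnmE !ordSK tpermL tpermR; case/andP: hi.
have srt i j : (i <= j)%N -> (j.+1 < n)%N -> (eta j <= eta i)%N.
  have [m] := ubnP (j - i)%N; elim: m j => // m IHm j hm hij hj.
  have [e|ne] := eqVneq (i : nat) j; first by have -> : i = j by apply: ord_inj.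
  have jp : (0 < j)%N by lia.
  have ep := ord_pred_val jp.
  apply: leq_trans (_ : (eta (ord_pred j) <= _)%N); last by apply: IHm; lia.
  have := hs (ord_pred j); rewrite /ascent ord_predK.
  have -> : ((ord_pred j).+2 < n)%N by lia.
  have -> : ((ord_pred j).+1 < n)%N by lia.
  by move=> /negbT; rewrite /= -leqNgt.
(* The first position whose entry is at most the last entry: inserting the latter there, in front of
   its equals, gives back the partition. *)
have [p hp pmin] := @arg_minnP _ l (fun k => eta k <= eta l)%N (fun k => k : nat) (leqnn _).
have lep k : (k < p)%N -> (eta l < eta k)%N.
  by move=> hk; rewrite ltnNge; apply/negP => /pmin; lia.
have hn k := ltn_ord k.
have gep k : (p <= k)%N -> (k.+1 < n)%N -> (eta k <= eta l)%N.
  by move=> h1 h2; apply: leq_trans hp; apply: srt.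
pose c := insert_last eta l.
have cr j : c j \in rearr lam by apply: insert_last_rearr.
have cj j : c j j = eta l by rewrite mnmE /insertf ltnn eqxx.
have cS j : (j.+1 < n)%N -> c j (ordS j) = eta j.
  move=> hj; have Sj := ordS_val hj; rewrite mnmE /insertf ordSK Sj ltnNge leqnSn /= ifN //.
  by rewrite eq_sym ordS_neq //; lia.
have cP j : (j.+1 < n)%N -> c (ordS j) j = eta j.
  by move=> hj; have Sj := ordS_val hj; rewrite mnmE /insertf Sj ltnSn.
have cswap j : (j.+1 < n)%N -> c (ordS j) = swap_comp j (c j) by exact: insert_lastS.
have cl : c l = eta by apply/mnmP => k; rewrite mnmE insertf_last.
have rkl : rk eta l = p.
  have -> : (p : nat) = size (ilo p) by rewrite -(size_map val) val_lo size_iota.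
  rewrite /rk -[RHS](card_uniqP _); last by rewrite filter_uniq ?enum_uniq.
  apply: eq_card => k; rewrite inE mem_filter mem_enum andbT /beats.
  have hk := hn k; have -> : (l < k)%N = false by lia.
  rewrite andbF orbF; apply/idP/idP => h; last exact: lep.
  rewrite ltnNge; apply/negP => hk2; have := gep k hk2.
  have [e|ne] := eqVneq k l; first by rewrite e ltnn in h.
  have /eqP : (k : nat) != l by rewrite (inj_eq (@ord_inj n)).
  by move: h; lia.
have cp : c p = lam.
  apply: partition_unique => //; apply: partition_adj => i hi.
  have Si := ordS_val hi; rewrite !mnmE /insertf Si ordSK.
  have [e|ne] := eqVneq i p.
    rewrite e ltnn [(p.+1 < p)%N]ltnNge leqnSn ifN; last first.
      by apply: ord_neq; rewrite -e Si; lia.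
    by apply: gep => //; rewrite -e.
  have ne' : (i : nat) != p by rewrite (inj_eq (@ord_inj n)).
  have [lt|gt] := ltnP i p.
    case: ltnP => [lt'|ge']; first by apply: srt; [rewrite Si|rewrite Si; have := hn p; lia].
    have -> : ordS i == p by apply/eqP/ord_inj; rewrite Si; lia.
    by apply: ltnW; apply: lep.
  rewrite ifF; last by lia.
  rewrite ifN; last by apply: ord_neq; rewrite Si; lia.
  have ip : (0 < i)%N by lia.
  by apply: srt => //; rewrite (ord_pred_val ip); lia.
have lo j : (j <= p)%N -> foldr (@opT _ Kt n) (Gfam (c j)) (ilo j) = Gfam (rot_comp eta).
  have [m] := ubnP j; elim: m j => // m IHm j hm hj.
  have [j0|jp] := posnP j.
    rewrite (lo0 j0) /=; congr (Gfam _).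
    by apply/mnmP => k; rewrite !mnmE insertf_first.
  have ep := ord_pred_val jp; have hjn := hn j.
  rewrite -(ord_predK j); set i := ord_pred j in ep *; have hi : (i.+1 < n)%N by lia.
  rewrite lo_S // foldr_rcons Gfam_swap //; last first.
    by rewrite cj cP //; apply: lep; lia.
  by rewrite cswap // swap_compK IHm //; lia.
(* Each inverse factor undoes a swap and keeps the rank of the travelling entry; at a tie it
   contributes t^-1 instead and the rank grows by one. *)
have hi j : (p <= j)%N -> Kt ^+ rk (c j) j *: foldr (@opTinv _ Kt n) (Gfam eta) (ihi j) =
    Kt ^+ p *: Gfam (c j).
  have [m] := ubnP (n - j)%N; elim: m j => // m IHm j hm hj.
  have [e|ne] := eqVneq j.+1 n.
    have -> : j = l by apply: ord_inj; lia.
    by rewrite hi_last // cl rkl.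
  have hj1 : (j.+1 < n)%N by have := hn j; lia.
  have Sj := ordS_val hj1.
  have /IHm : (n - ordS j < m)%N by rewrite Sj; have := hn j; lia.
  rewrite Sj (leq_trans hj (leqnSn _)) => /(_ isT).
  rewrite (hi_S hj1) => /(congr1 (opTinv Kt j)); rewrite (opTinvZ _ _ hj1) (opTinvZ _ _ hj1).
  have -> : foldr (@opTinv _ Kt n) (Gfam eta) (j :: ihi (ordS j)) =
    opTinv Kt j (foldr (@opTinv _ Kt n) (Gfam eta) (ihi (ordS j))) by [].
  move: (opTinv Kt j (foldr _ _ _)) => u.
  have := gep j hj hj1; rewrite leq_eqVlt => /orP[/eqP ej|ltj].
    have ec : c (ordS j) = c j by rewrite cswap // swap_comp_eq // cj cS.
    have tj : c j j = c j (ordS j) by rewrite cj cS.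
    have := opTK Kt_neq0 (Gfam (c j)) hj1; rewrite (Gfam_fix (cr j) hj1 tj) (opTinvZ _ _ hj1).
    rewrite ec (rk_eq hj1 tj); move: (opTinv Kt j (Gfam (c j))) => g; move: (Gfam (c j)) => g' <- e1.
    rewrite exprS -scalerA e1 !scalerA; congr (_ *: _); exact: mulrC.
  have dj : (c j (ordS j) < c j j)%N by rewrite cj cS.
  rewrite cswap // rk_swap // ?tpermR; last by rewrite neq_ltn dj orbT.
  by rewrite -(Gfam_swap (cr j) hj1 dj) (opTK Kt_neq0 _ hj1) => h; exact: h.
have := wE p; rewrite /opY -/(ilo p) -/(ihi p) eigvalE.
have := lo p (leqnn _); have := hi p (leqnn _); rewrite cp Gfam_lam => h1 h2.
rewrite h2 -[lam p]/(lam p) -{1}cp cj => h3.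
apply: (@opTinvs_inj p); rewrite opTinvs_Z.
have nz (k : nat) : Kt ^+ k != 0 by rewrite expf_neq0 ?Kt_neq0.
move: h1 h3; move: (foldr _ _ _) (foldr _ _ _) => u v h1 h3.
rewrite -[u](scalerKV (nz p)).
rewrite -(scalerK (nz (rk lam p)) v).
rewrite h1 h3 !scalerA; congr (_ *: _).
exact: mulrC.
Qed.

End FamilyRot.

(** * A bell as a tour of the active particle *)

Lemma rot_traject (T : Type) (f : T -> T) x m N : (m <= N)%N -> iter N f x = x ->
  rot m (traject f x N) = traject f (iter m f x) N.
Proof.
move=> hm hN; rewrite -{1}(subnKC hm) trajectD /rot drop_size_cat ?size_traject //.
rewrite take_size_cat ?size_traject // -{2}(subnK hm) trajectD -iterD subnK //.
by rewrite hN.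
Qed.

Lemma nth_traject_def (T : Type) (f : T -> T) x0 x m i : (i < m)%N ->
  nth x0 (traject f x m) i = iter i f x.
Proof. by move=> h; rewrite (set_nth_default x) ?size_traject // nth_traject. Qed.

Section CyclicLists.
Variable n : nat.
Implicit Types (i j k p : 'I_n).

Lemma iter_ordS_val (k : nat) i : iter k (@ordS n) i = ((i + k) %% n)%N :> nat.
Proof.
elim: k => [|k IH]; first by rewrite addn0 modn_small.
by rewrite [iter _ _ _]/= [nat_of_ord _]/= IH -addn1 modnDml addn1 addnS.
Qed.

Lemma iter_ordS_n i : iter n (@ordS n) i = i.
Proof. by apply: ord_inj; rewrite iter_ordS_val modnDr modn_small. Qed.

Lemma rot_enum_traject p : rot p.+1 (enum 'I_n) = traject (@ordS n) (ordS p) n.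
Proof.
have hp := ltn_ord p.
apply: (@eq_from_nth _ p) => [|i]; rewrite size_rot size_enum_ord ?size_traject // => hi.
rewrite nth_traject_def // /rot nth_cat size_drop size_enum_ord; apply: ord_inj.
rewrite iter_ordS_val [nat_of_ord (ordS p)]/= modnDml; case: ltnP => h.
  by rewrite nth_drop nth_enum_ord ?modn_small //; lia.
rewrite nth_take; last by lia.
rewrite nth_enum_ord; last by lia.
have -> : (p.+1 + i = (i - (n - p.+1)) + n)%N by lia.
by rewrite modnDr modn_small //; lia.
Qed.

Definition after j := traject (@ordS n) (ordS j) n.-1.

Lemma after_rcons j : traject (@ordS n) (ordS j) n = rcons (after j) j.
Proof.
have n0 : (0 < n)%N by have := ltn_ord j; lia.
have gen m : m = n.-1.+1 -> traject (@ordS n) (ordS j) m = rcons (after j) (iter m (@ordS n) j).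
  by move=> ->; rewrite trajectSr -iterSr.
by rewrite gen ?prednK // iter_ordS_n.
Qed.

Lemma after_uniq j : uniq (after j) /\ j \notin after j.
Proof.
have : uniq (rcons (after j) j) by rewrite -after_rcons -rot_enum_traject rot_uniq enum_uniq.
by rewrite rcons_uniq => /andP[].
Qed.

Lemma mem_after j i : (i \in after j) = (i != j).
Proof.
have [_ nj] := after_uniq j; have [->|ne] := eqVneq i j; first exact: negbTE.
have : i \in rcons (after j) j by rewrite -after_rcons -rot_enum_traject mem_rot mem_enum.
by rewrite mem_rcons in_cons (negbTE ne).
Qed.

Lemma after_nth j p A L : after j = A ++ p :: L ->
  (size A + (size L).+1 = n.-1)%N /\ p = iter (size A) (@ordS n) (ordS j).
Proof.
move=> e; have hs : (size A + (size L).+1 = n.-1)%N.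
  by have := congr1 size e; rewrite size_traject size_cat.
split=> //; have := congr1 (fun s => nth j s (size A)) e.
by rewrite nth_cat ltnn subnn /= nth_traject_def //; lia.
Qed.

Lemma after_split j p A L : after j = A ++ p :: L ->
  rot p.+1 (enum 'I_n) = L ++ j :: rcons A p.
Proof.
move=> e; have [hs ep] := after_nth e.
have hm : ((size A).+1 <= n)%N by have := ltn_ord j; lia.
rewrite rot_enum_traject ep -iterS -(rot_traject hm (iter_ordS_n (ordS j))) after_rcons e -cat_rcons rcons_cat.
by rewrite -ep /rot drop_size_cat ?size_rcons // take_size_cat ?size_rcons // cat_rcons.
Qed.

Lemma after_ordS j : after (ordS j) = map (@ordS n) (after j).
Proof.
rewrite /after; elim: n.-1 (ordS j) => [|m IH] i //=.
by rewrite IH.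
Qed.

Lemma after_adj i : (1 < n)%N -> exists L, after i = ordS i :: L /\ after (ordS i) = rcons L i.
Proof.
move=> n2; exists (traject (@ordS n) (ordS (ordS i)) n.-2).
have e : n.-1 = n.-2.+1 by lia.
rewrite /after e trajectS; split => //.
rewrite trajectSr -!iterSr; have -> : n.-2.+2 = n by lia.
by rewrite iter_ordS_n.
Qed.

Lemma after_adj_other i j : (i.+1 < n)%N -> j != i -> j != ordS i ->
  exists A L, after j = A ++ i :: ordS i :: L.
Proof.
move=> hi ji jSi; have [us nj] := after_uniq j.
have mi : i \in after j by rewrite mem_after eq_sym.
have [A [L e]] : exists A L, after j = A ++ i :: L.
  by case/splitPr: mi => A L; exists A, L.
have [hs ei] := after_nth e; case: L e hs => [|k L] e hs.
  case/negP: jSi; apply/eqP; rewrite ei -iterS -iterSr.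
  have -> : (size A).+2 = n by move: hs => /=; lia.
  by rewrite iter_ordS_n.
have e2 : after j = rcons A i ++ k :: L by rewrite cat_rcons.
have [_] := after_nth e2; rewrite size_rcons iterS -ei => ek.
by exists A, L; rewrite e ek.
Qed.

End CyclicLists.

Section Traveller.
Variables (R : realType) (n : nat) (t : R).
Hypothesis t01 : 0 <= t < 1.
Implicit Types (lam eta theta sigma : 'X_{1..n}) (i j k p : 'I_n) (g h : 'X_{1..n} -> R).

Definition swp i j eta : 'X_{1..n} := [multinom eta (tperm i j k) | k < n].

Lemma swp_rearr lam eta i j : eta \in rearr lam -> swp i j eta \in rearr lam.
Proof. exact: rearr_act. Qed.

Lemma swpL i j eta : swp i j eta i = eta j. Proof. by rewrite mnmE tpermL. Qed.
Lemma swpR i j eta : swp i j eta j = eta i. Proof. by rewrite mnmE tpermR. Qed.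
Lemma swpD i j k eta : k != i -> k != j -> swp i j eta k = eta k.
Proof. by move=> h1 h2; rewrite mnmE tpermD // eq_sym. Qed.

(* The active particle is stored at the bell site j, where it leaves a vacancy: *)
(* settling at i, with probability 1 - t if i is lower, swaps the entries i, j. *)
Definition meet_site j i h eta : R :=
  if (eta i < eta j)%N then (1 - t) * h (swp i j eta) + t * h eta else h eta.

Definition tour j h := foldr (meet_site j) h (after j).

Definition cexp lam fuel eta sigma p r g : R :=
  \sum_(zeta <- rearr lam) cascade lam t fuel eta sigma p r zeta * g zeta.

Lemma cexp0 lam fuel eta sigma p g : sigma \in rearr lam ->
  cexp lam fuel eta sigma p 0 g = g sigma.
Proof.
move=> hs; rewrite /cexp (bigD1_seq sigma) ?undup_uniq //=.
rewrite [X in X * _](_ : _ = 1); last by case: fuel => [|f] /=; rewrite eqxx.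
rewrite mul1r big1 ?addr0 // => z nz.
rewrite [X in X * _](_ : _ = 0) ?mul0r //.
by case: fuel => [|f] /=; rewrite eq_sym (negbTE nz).
Qed.

Lemma cexpS lam f eta sigma p r g : (0 < r)%N ->
  cexp lam f.+1 eta sigma p r g =
  \sum_(i <- lower_sites eta p r)
    jump_prob lam t eta p r i * cexp lam f eta (set_site sigma i r) i (eta i) g.
Proof.
move=> hr; rewrite /cexp.
under eq_bigr => z _ do rewrite [cascade _ _ f.+1 _ _ _ _ _]/= (gtn_eqF hr) mulr_suml.
rewrite exchange_big /=; apply: eq_bigr => i _.
by rewrite mulr_sumr; apply: eq_bigr => z _; rewrite mulrA.
Qed.

Definition bell lam j g eta : R :=
  cexp lam (eta j) eta (set_site eta j 0) j (eta j) g.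

Fixpoint geo (S : 'I_n -> R) (s : seq 'I_n) : R :=
  if s is i :: s' then S i + t * geo S s' else 0.

Lemma geo_cat S s1 s2 : geo S (s1 ++ s2) = geo S s1 + t ^+ size s1 * geo S s2.
Proof.
elim: s1 => [|i s IH] /=; first by rewrite add0r expr0 mul1r.
by rewrite IH exprS; ring.
Qed.

Lemma geo_index S s : uniq s -> \sum_(i <- s) t ^+ index i s * S i = geo S s.
Proof.
elim: s => [|i s IH] /=; first by rewrite big_nil.
move=> /andP[ni us]; rewrite big_cons /= eqxx expr0 mul1r -IH // mulr_sumr; congr (_ + _).
rewrite big_seq [RHS]big_seq; apply: eq_bigr => k hk; case: eqP => [e|_].
  by rewrite e hk in ni.
by rewrite exprS mulrA.
Qed.

Lemma tint_geo m : (1 - t) * tint t m = 1 - t ^+ m.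
Proof.
rewrite /tint; elim: m => [|m IH]; first by rewrite big_ord0 expr0; ring.
by rewrite big_ord_recr /= mulrDr IH exprS; ring.
Qed.

Lemma exp_lt1 m : (0 < m)%N -> t ^+ m < 1.
Proof. by move=> hm; case/andP: t01 => h0 h1; rewrite exprn_ilt1 // -lt0n. Qed.

Lemma tint_neq0 m : (0 < m)%N -> tint t m != 0.
Proof.
move=> hm; apply/eqP => e; have := tint_geo m; rewrite e mulr0.
by have := exp_lt1 hm; lra.
Qed.

(** One lap: the k-th lower site stops the particle with probability (1 - t) t^(k-1), and with the
    remaining power of t the particle passes them all. *)
Lemma foldr_meet_split j h eta (S : 'I_n -> R) A L : after j = A ++ L ->
  (forall i A' L', after j = A' ++ i :: L' -> (eta i < eta j)%N ->
     foldr (meet_site j) h L' (swp i j eta) = S i) ->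
  foldr (meet_site j) h L eta =
  (1 - t) * geo S [seq i <- L | (eta i < eta j)%N] +
  t ^+ size [seq i <- L | (eta i < eta j)%N] * h eta.
Proof.
elim: L A => [|i L IH] A e hS /=; first by rewrite mulr0 add0r expr0 mul1r.
rewrite {1}/meet_site (IH (rcons A i)) ?cat_rcons //.
by case: ifP => hi //=; rewrite (hS i A L) // exprS; ring.
Qed.

Section Cascade.
Variable lam : 'X_{1..n}.
Hypothesis lam0 : exists i, lam i = 0%N.

Lemma count_low eta r : eta \in rearr lam ->
  count (fun a => a < r)%N lam = size [seq i <- enum 'I_n | (eta i < r)%N].
Proof.
rewrite rearr_perm perm_sym => /seq.permP ->; rewrite size_filter.
have -> : (eta : seq nat) = [seq eta i | i <- enum 'I_n].
  have {1}-> : eta = [multinom eta i | i < n] by apply/mnmP => i; rewrite mnmE.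
  by rewrite /= /codom_tuple /=.
by rewrite count_map; apply: eq_count.
Qed.

Lemma rearr_has0 eta : eta \in rearr lam -> exists i, eta i = 0%N.
Proof.
move=> /rearrP[s ->]; have [i hi] := lam0; exists (s^-1%g i).
by rewrite mnmE permKV.
Qed.

(** With m lower sites per lap, each stopping with probability 1 - t, the k-th is chosen over all
    laps with probability (1 - t) t^(k-1) / (1 - t^m) = t^(k-1) / [m]_t. So a jump from p runs
    through the rest L of the lap, and a particle back at j starts again as a fresh bell in theta.
    The moves to come depend only on the species below r, on which eta and theta agree. *)
Lemma cexp_tour j g r fuel eta theta p L :
  eta \in rearr lam -> theta \in rearr lam -> theta j = r -> (r <= fuel)%N ->
  (forall i, (eta i < r)%N = (theta i < r)%N) ->
  (forall i, (theta i < r)%N -> eta i = theta i) ->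
  (p = j /\ L = after j) \/
    ((r <= theta p)%N /\ exists A, after j = A ++ p :: L) ->
  cexp lam fuel eta (set_site theta j 0) p r g =
  foldr (meet_site j) (bell lam j g) L theta.
Proof.
have [m] := ubnP r; elim: m r fuel eta theta p L => // m IH r fuel eta theta p L.
move=> hm he hth hj hf hlow heq hp.
have [A0 eA0] : exists A, after j = A ++ L.
  case: hp => [[_ ->]|[_ [A ->]]]; first by exists [::].
  by exists (rcons A p); rewrite cat_rcons.
have [r0|rp] := posnP r.
  have st : set_site theta j 0 = theta.
    by apply/mnmP => k; rewrite mnmE; case: eqP => // ->; rewrite hj.
  have ns : [seq i <- L | (theta i < theta j)%N] = [::].
    by rewrite hj r0; elim: (L).
  rewrite r0 cexp0 ?st // (foldr_meet_split (S := fun=> 0) eA0); last first.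
    by move=> i A' L' _; rewrite hj r0.
  by rewrite ns /= mulr0 add0r expr0 mul1r /bell hj r0 cexp0 ?st.
(* The value once the particle has settled at i: the displaced one, stored at j, tours the sites
   that follow i. *)
pose S i := foldr (meet_site j) (bell lam j g) (drop (index i (after j)).+1 (after j)) (swp i j theta).
have [us nj] := after_uniq j.
have after_drop i A L' : after j = A ++ i :: L' ->
    drop (index i (after j)).+1 (after j) = L'.
  move=> e; have ni : i \notin A by move: us; rewrite e cat_uniq /= negb_or -!andbA => /and5P[].
  by rewrite e index_cat (negbTE ni) /= eqxx addn0 -cat_rcons drop_size_cat ?size_rcons.
(* Kept general in the start q and the configuration [et], to cover both the jump from p and the
   fresh bell at j. *)
have key fu et q (hu : (r <= fu)%N) : et \in rearr lam ->
    (forall i, (et i < r)%N = (theta i < r)%N) ->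
    (forall i, (theta i < r)%N -> et i = theta i) ->
    cexp lam fu et (set_site theta j 0) q r g =
    geo S [seq i <- rot q.+1 (enum 'I_n) | (theta i < r)%N] /
    tint t (size [seq i <- enum 'I_n | (theta i < r)%N]).
  move=> het hl heqt; case: fu hu => [|f] hu; first by lia.
  rewrite cexpS // -(count_low _ hth).
  have -> : lower_sites et q r = [seq i <- rot q.+1 (enum 'I_n) | (theta i < r)%N].
    by apply: eq_filter => i; rewrite hl.
  set s := [seq i <- rot _ _ | _].
  have u : uniq s by rewrite filter_uniq // rot_uniq enum_uniq.
  rewrite -geo_index // mulr_suml big_seq [RHS]big_seq; apply: eq_bigr => i hi.
  have li : (theta i < r)%N by move: hi; rewrite mem_filter => /andP[].
  have ij : i != j by apply: contraTneq li => ->; rewrite hj ltnn.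
  rewrite /jump_prob; have -> : lower_sites et q r = s.
    by apply: eq_filter => k; rewrite hl.
  rewrite -!mulrA; congr (_ * _); rewrite mulrC; congr (_ * _).
  have [A' [L' e']] : exists A L', after j = A ++ i :: L'.
    have : i \in after j by rewrite mem_after.
    by case/splitPr => A L'; exists A, L'.
  rewrite /S (after_drop _ _ _ e') heqt //.
  have -> : set_site (set_site theta j 0) i r = set_site (swp i j theta) j 0.
    apply/mnmP => k; rewrite !mnmE; have [->|ki] := eqVneq k i.
      by rewrite (negbTE ij) tpermL hj.
    by case: (eqVneq k j) => // kj; rewrite tpermD // eq_sym.
  have h1 : (theta i < m)%N by apply: leq_trans li _.
  have h2 : (theta i <= f)%N by have := leq_trans li hu.
  apply: (IH _ f et (swp i j theta) i L' h1 het (swp_rearr i j hth) (swpR i j theta) h2).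
  - move=> k; have [->|ki] := eqVneq k i.
      by rewrite swpL hj (heqt _ li) ltnn; apply/esym/negbTE; rewrite -leqNgt ltnW.
    have [->|kj] := eqVneq k j.
      rewrite swpR ltnn; apply/negbTE; rewrite -leqNgt; have := hl j; rewrite hj ltnn => /negbT.
      by rewrite -leqNgt; apply: leq_trans (ltnW li).
    rewrite swpD //; have := hl k; have := heqt k.
    case: (ltnP (theta k) r) => h3 h4 h5; first by rewrite h4.
    have h6 : (r <= et k)%N by rewrite leqNgt h5.
    by rewrite !ltnNge (leq_trans (ltnW li) h6) (leq_trans (ltnW li) h3).
  - move=> k; have [->|ki] := eqVneq k i; first by rewrite swpL hj ltnNge (ltnW li).
    have [->|kj] := eqVneq k j; first by rewrite swpR ltnn.
    by rewrite swpD // => h3; apply: heqt; apply: ltn_trans li.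
  - by right; split; [rewrite swpL hj ltnW|exists A'].
set N := size [seq i <- enum 'I_n | (theta i < r)%N] in key.
have Npos : (0 < N)%N.
  have [i hi] := rearr_has0 hth; rewrite /N size_filter -has_count; apply/hasP.
  by exists i; rewrite ?mem_enum // hi.
rewrite (foldr_meet_split (S := S) eA0); last first.
  by move=> i A' L' e' _; rewrite /S (after_drop _ _ _ e').
rewrite (key fuel eta p) //.
have kj : bell lam j g theta =
    geo S [seq i <- rot j.+1 (enum 'I_n) | (theta i < r)%N] / tint t N.
  by rewrite /bell hj; apply: key.
rewrite kj hj (rot_enum_traject j) after_rcons filter_rcons hj ltnn.
have tN := tint_neq0 Npos; have tg := tint_geo N.
have sN q : size [seq i <- rot q.+1 (enum 'I_n) | (theta i < r)%N] = N.
  have /seq.permP e : perm_eq (rot q.+1 (enum 'I_n)) (enum 'I_n) by rewrite perm_rot.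
  by rewrite /N !size_filter e.
case: hp => [[-> ->]|[hp [A eA]]].
  rewrite rot_enum_traject after_rcons filter_rcons hj ltnn.
  have := sN j; rewrite rot_enum_traject after_rcons filter_rcons hj ltnn => ->.
  move: (geo _ _) => G; have -> : t ^+ N = 1 - (1 - t) * tint t N by rewrite tg; ring.
  by field.
have := sN j; rewrite rot_enum_traject after_rcons filter_rcons hj ltnn eA filter_cat /=.
rewrite [(theta p < r)%N]ltnNge hp /= size_cat => eN.
(* From p the lower sites of L come before those of A, from j those of A come first. Their numbers a
   and b add up to N. *)
rewrite (after_split eA) filter_cat /= hj ltnn filter_rcons [(theta p < r)%N]ltnNge hp /=.
rewrite !geo_cat.
set a := size _ in eN *; set b := size _ in eN *; move: (geo _ _) (geo _ _) => G1 G2.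
have -> : (1 - t) * G2 = (1 - t ^+ N) / tint t N * G2.
  by rewrite -tg; field.
have -> : t ^+ N = t ^+ a * t ^+ b by rewrite -exprD eN.
by field.
Qed.

Lemma bell_tour j g eta : eta \in rearr lam ->
  bell lam j g eta = tour j (bell lam j g) eta.
Proof.
by move=> he; rewrite {1}/bell (@cexp_tour j g (eta j) (eta j) eta eta j (after j)) //; left.
Qed.

Lemma bell0 j g eta : eta \in rearr lam -> eta j = 0%N -> bell lam j g eta = g eta.
Proof.
move=> he e; have st : set_site eta j 0 = eta.
  by apply/mnmP => k; rewrite mnmE; case: eqP => // ->; rewrite e.
by rewrite /bell e cexp0 st.
Qed.

End Cascade.

End Traveller.

(** * Exchange of bells *)

(** The transpose of T_i: [sum_tau] moves T_i from the vectors of an exchange family to their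
    coefficients. *)
Definition tau (K : fieldType) (t : K) n (i : 'I_n) (w : 'X_{1..n} -> K)
    (zeta : 'X_{1..n}) : K :=
  if (zeta i < zeta (ordS i))%N then w (swap_comp i zeta) + (t - 1) * w zeta
  else if (zeta (ordS i) < zeta i)%N then t * w (swap_comp i zeta) else t * w zeta.

Section PushOps.
Variables (R : realType) (n : nat) (t : R).
Hypothesis t01 : 0 <= t < 1.
Hypothesis n2 : (1 < n)%N.
Implicit Types (lam eta theta : 'X_{1..n}) (i j k : 'I_n) (g h : 'X_{1..n} -> R).

Local Notation mt := (@meet_site R n t).
Local Notation tr := (@tour R n t).

Definition has0 eta := [exists i, eta i == 0%N].

Lemma has0P eta : reflect (exists i, eta i = 0%N) (has0 eta).
Proof. by apply: (iffP existsP) => -[i /eqP h]; exists i => //; apply/eqP. Qed.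

Lemma has0_rearr lam eta : eta \in rearr lam -> has0 eta = has0 lam.
Proof.
by move=> h; apply/has0P/has0P => h0; [apply: (rearr_has0 h0 (rearr_sym h))|apply: (rearr_has0 h0 h)].
Qed.

(* The value 0 without vacancies makes the identities below unconditional. *)
Definition Bop j g eta : R := if has0 eta then bell t eta j g eta else 0.

Lemma cascade_perm lam eta fuel e s p r z : eta \in rearr lam ->
  cascade eta t fuel e s p r z = cascade lam t fuel e s p r z.
Proof.
rewrite rearr_perm => /seq.permP hp; elim: fuel s p r => [|f IH] s p r //=.
case: eqP => // _; apply: eq_bigr => i _.
by rewrite IH /jump_prob hp.
Qed.

Lemma rearr_perm_eq lam eta : eta \in rearr lam -> perm_eq (rearr eta) (rearr lam).
Proof.
move=> h; apply: uniq_perm; rewrite ?undup_uniq // => z.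
by rewrite !rearr_perm; move: h; rewrite rearr_perm => h; rewrite (permPr h).
Qed.

Lemma bell_perm lam theta j g : theta \in rearr lam ->
  bell t theta j g =1 bell t lam j g.
Proof.
move=> h eta; rewrite /bell /cexp (perm_big _ (rearr_perm_eq h)) /=.
by apply: eq_bigr => z _; rewrite (cascade_perm _ _ _ _ _ _ h).
Qed.

Lemma Bop_bell lam eta j g : has0 lam -> eta \in rearr lam ->
  Bop j g eta = \sum_(z <- rearr lam) bell_prob lam t j eta z * g z.
Proof. by move=> h0 h; rewrite /Bop (has0_rearr h) h0 (bell_perm _ _ h). Qed.

Lemma meet_siteE j i h eta : mt j i h eta =
  if (eta i < eta j)%N then (1 - t) * h (swp i j eta) + t * h eta else h eta.
Proof. by []. Qed.

Lemma foldr_meet_ext lam j h h' L : (forall eta, eta \in rearr lam -> h eta = h' eta) ->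
  forall eta, eta \in rearr lam -> foldr (mt j) h L eta = foldr (mt j) h' L eta.
Proof.
move=> e; elim: L => [|i L IH] //= eta he; rewrite /meet_site.
by case: ifP => // _; rewrite !IH // swp_rearr.
Qed.

Lemma foldr_meetZ j c h L : foldr (mt j) (fun e => c * h e) L =
  (fun e => c * foldr (mt j) h L e).
Proof.
elim: L => [|i L IH] //=; rewrite IH; apply: funext => e; rewrite /meet_site.
by case: ifP => // _; ring.
Qed.

Lemma Bop_tour j g : Bop j g = tr j (Bop j g).
Proof.
apply: funext => eta; have [h0|h0] := boolP (has0 eta); last first.
  rewrite /tour (foldr_meet_ext (h' := fun=> 0 * 0) _ _ _ (rearr_refl eta)).
    by rewrite foldr_meetZ mul0r /Bop (negbTE h0).
  by move=> z hz; rewrite /Bop (has0_rearr hz) (negbTE h0) mul0r.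
rewrite {1}/Bop h0 (bell_tour t01 (elimT (has0P eta) h0)) ?rearr_refl //.
apply: (foldr_meet_ext _ _ _ (rearr_refl eta)) => z hz.
by rewrite /Bop (has0_rearr hz) h0 (bell_perm _ _ hz).
Qed.

Lemma Bop0 j g eta : eta j = 0%N -> Bop j g eta = g eta.
Proof.
move=> e; have h0 : has0 eta by apply/has0P; exists j.
by rewrite /Bop h0 bell0 ?rearr_refl.
Qed.

Lemma Bop_no0 j g eta : ~~ has0 eta -> Bop j g eta = 0.
Proof. by move=> /negbTE h; rewrite /Bop h. Qed.

Lemma foldr_meet_low j r h h' L : (forall eta, (eta j < r)%N -> h eta = h' eta) ->
  forall eta, (eta j < r)%N -> foldr (mt j) h L eta = foldr (mt j) h' L eta.
Proof.
move=> e; elim: L => [|i L IH] //= eta he; rewrite /meet_site.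
by case: ifP => // hi; rewrite !IH // swpR (ltn_trans hi).
Qed.

Lemma foldr_meet_diff j h h' L eta : (forall z : 'X_{1..n}, (z j < eta j)%N -> h z = h' z) ->
  foldr (mt j) h L eta - foldr (mt j) h' L eta =
  t ^+ count (fun i => eta i < eta j)%N L * (h eta - h' eta).
Proof.
move=> e; elim: L => [|i L IH] /=; first by rewrite expr0 mul1r.
rewrite /meet_site; case: ifP => hi; last by rewrite IH.
rewrite (foldr_meet_low L e); last by rewrite swpR.
rewrite exprS -mulrA -IH; ring.
Qed.

(** Induction on the species stored at j: if two solutions agree below it, a lap multiplies their
    difference by t^m, where m counts the lower sites. A vacancy gives m > 0, so t^m < 1 and the
    difference is 0. *)
Lemma Bop_unique j g h : h = tr j h -> (forall eta, eta j = 0%N -> h eta = g eta) ->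
  (forall eta, ~~ has0 eta -> h eta = 0) -> h = Bop j g.
Proof.
move=> hf hb h0; apply: funext => eta; have [d] := ubnP (eta j).
elim: d eta => // d IH eta hd.
have [z|z] := boolP (has0 eta); last by rewrite h0 // Bop_no0.
have [r0|rp] := posnP (eta j); first by rewrite hb // Bop0.
have := @foldr_meet_diff j h (Bop j g) (after j) eta; rewrite -!/(tr _ _) -hf -Bop_tour.
move=> /(_ (fun z hz => IH z (leq_trans hz hd))).
set m := count _ _; have hm : (0 < m)%N.
  rewrite -has_count; apply/hasP; case/has0P: z => i hi; exists i; last by rewrite hi.
  by rewrite mem_after; apply: contraTneq rp => <-; rewrite hi.
have := exp_lt1 t01 hm; move: (t ^+ m) (h eta) (Bop j g eta) => u a b hu e.
have : (1 - u) * (a - b) = 0 by rewrite mulrBl mul1r -e subrr.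
by move=> /eqP; rewrite mulf_eq0 !subr_eq0 => /orP[/eqP|/eqP //]; lra.
Qed.

Lemma Bop_linear j c d g h :
  Bop j (fun e => c * g e + d * h e) = (fun e => c * Bop j g e + d * Bop j h e).
Proof.
apply: funext => eta; rewrite /Bop; case: ifP => _; last by ring.
rewrite /bell /cexp !mulr_sumr -big_split /=; apply: eq_bigr => z _; ring.
Qed.

Lemma Bop1 j eta : has0 eta -> Bop j (fun=> 1) eta = 1.
Proof.
pose h eta : R := if has0 eta then 1 else 0.
suff <- : h = Bop j (fun=> 1) by rewrite /h => ->.
apply: Bop_unique => [|z hz|z /negbTE]; rewrite /h; last by move=> ->.
  apply: funext => z; rewrite /tour; symmetry.
  rewrite (foldr_meet_ext (h' := fun=> h z * 1) _ _ _ (rearr_refl z)); last first.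
    by move=> e he; rewrite mulr1 (has0_rearr he).
  rewrite foldr_meetZ -[RHS]mulr1; congr (_ * _).
  elim: (after j) (z) => [|i L IH] e //=; rewrite /meet_site !IH.
  by case: ifP => // _; ring.
by have -> : has0 z by apply/has0P; exists j.
Qed.

Lemma cascade_ge0 lam fuel e s p r z : 0 <= cascade lam t fuel e s p r z.
Proof.
have [t0 _] := andP t01.
elim: fuel s p r => [|f IH] s p r /=; case: eqP => // _; rewrite ?ler0n //.
apply: sumr_ge0 => i _; rewrite mulr_ge0 // /jump_prob divr_ge0 ?exprn_ge0 //.
by rewrite /tint sumr_ge0 // => k _; rewrite exprn_ge0.
Qed.

(** It plays t times the inverse of [tau t i], in a form that makes sense at t = 0. *)
Definition taup i h eta : R := tau t i h eta + (1 - t) * h eta.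

Lemma taupK i h : taup i (tau t i h) = (fun e => t * h e).
Proof.
apply: funext => e; rewrite /taup /tau swap_compL swap_compR swap_compK.
by case: ltngtP => [_|_|_]; ring.
Qed.

Lemma tauK i h : tau t i (taup i h) = (fun e => t * h e).
Proof.
apply: funext => e; rewrite /taup /tau swap_compL swap_compR swap_compK.
by case: ltngtP => [_|_|_]; ring.
Qed.

Lemma swp_swap i eta : swp (ordS i) i eta = swap_comp i eta.
Proof. by rewrite /swp tpermC. Qed.

(** The link between bells and the Hecke algebra: a meeting of neighbouring sites is a Hecke
    generator up to the swap of the two sites. *)
Lemma meet_taup i h : mt i (ordS i) (fun e => h (swap_comp i e)) = taup i h.
Proof.
apply: funext => e; rewrite /meet_site /taup /tau swp_swap swap_compK.
by case: ltngtP => [_|_|e0]; [ring|ring|rewrite (swap_comp_eq (esym e0)); ring].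
Qed.

Lemma meet_conj i h :
  mt (ordS i) i h = (fun e => mt i (ordS i) (fun e => h (swap_comp i e)) (swap_comp i e)).
Proof.
apply: funext => e; rewrite /meet_site swp_swap swap_compL swap_compR !swap_compK.
by [].
Qed.

Lemma swp_conj i k e : k != i -> k != ordS i ->
  swap_comp i (swp k (ordS i) e) = swp k i (swap_comp i e).
Proof.
move=> ki kS; apply/mnmP => l; rewrite !mnmE -!permM.
by rewrite [(tperm k i * _)%g]conjgC tpermJ tpermL tpermD // eq_sym.
Qed.

Lemma foldr_meet_conj i h L : i \notin L -> ordS i \notin L ->
  foldr (mt (ordS i)) h L =
  (fun e => foldr (mt i) (fun e => h (swap_comp i e)) L (swap_comp i e)).
Proof.
elim: L => [|k L IH] /=; first by move=> _ _; apply: funext => e; rewrite swap_compK.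
rewrite !in_cons !negb_or => /andP[ik hi] /andP[Sk hS]; rewrite IH //.
have [ki kS] : k != i /\ k != ordS i by rewrite ![k == _]eq_sym.
by apply: funext => e; rewrite !meet_siteE swap_compL swap_compD // swp_conj.
Qed.

Definition half_turn i L h eta := foldr (mt i) h L (swap_comp i eta).

(** The tour from i meets i+1 first and then L, the tour from i+1 meets L first and i last. They are
    products of the same two operators in opposite orders, so [taup] carries fixed points of the
    second to fixed points of the first. *)
Lemma tour_adj i : exists L, forall h,
  tr i h = taup i (half_turn i L h) /\ tr (ordS i) h = half_turn i L (taup i h).
Proof.
have [L [e1 e2]] := after_adj i n2; exists L => h.
have [u1 i1] := after_uniq i; have [u2 i2] := after_uniq (ordS i).
move: u1 i1 i2; rewrite e1 e2 /= !in_cons mem_rcons in_cons !negb_or.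
move=> /andP[SL _] /andP[iS iL] /andP[_ _]; rewrite /tour e1 e2 /=; split.
  rewrite -meet_taup; congr meet_site; apply: funext => e.
  by rewrite /half_turn swap_compK.
rewrite foldr_rcons foldr_meet_conj // /half_turn; apply: funext => e.
have -> // : (fun e0 => mt (ordS i) i h (swap_comp i e0)) = taup i h.
by apply: funext => e'; rewrite meet_conj swap_compK meet_taup.
Qed.

Lemma tau_no0 i h : (forall eta, ~~ has0 eta -> h eta = 0) ->
  forall eta, ~~ has0 eta -> tau t i h eta = 0.
Proof.
move=> h0 eta z; rewrite /tau !h0 //; first by do 2?case: ifP => _; ring.
by rewrite (has0_rearr (swap_rearr i (rearr_refl eta))).
Qed.

Lemma taup_Bop i g : taup i (Bop (ordS i) g) = Bop i (taup i g).
Proof.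
apply: Bop_unique => [|eta e0|eta z].
- have [L hL] := tour_adj i; have [-> _] := hL (taup i (Bop (ordS i) g)).
  by have [_ <-] := hL (Bop (ordS i) g); rewrite -Bop_tour.
- by rewrite -!meet_taup /meet_site e0 /= Bop0 // swap_compR.
- by rewrite /taup tau_no0 // ?Bop_no0 ?mulr0 ?addr0 // => *; exact: Bop_no0.
Qed.

Lemma tau_Bop i g : tau t i (Bop i g) = Bop (ordS i) (tau t i g).
Proof.
apply: Bop_unique => [|eta e0|eta z].
- have [L hL] := tour_adj i; have [_ ->] := hL (tau t i (Bop i g)).
  rewrite {1}Bop_tour; have [-> _] := hL (Bop i g).
  rewrite tauK taupK; apply: funext => e; rewrite /half_turn.
  by rewrite foldr_meetZ.
- rewrite /tau e0 ltn0; case: ltnP => [_|]; first by rewrite Bop0 // swap_compL.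
  by rewrite leqn0 => /eqP e; rewrite Bop0.
- by apply: tau_no0 => // *; exact: Bop_no0.
Qed.

Lemma tau_meet i j k h : j != i -> j != ordS i -> k != i -> k != ordS i ->
  tau t i (mt j k h) = mt j k (tau t i h).
Proof.
move=> ji jS ki kS; apply: funext => e; rewrite /tau /meet_site !swap_compD // !swpD 1?eq_sym //.
have -> : swp k j (swap_comp i e) = swap_comp i (swp k j e).
  apply/mnmP => l; rewrite !mnmE -!permM [(tperm k j * _)%g]conjgC tpermJ.
  by rewrite (@tpermD _ i _ k) 1?eq_sym // tpermD // eq_sym.
by case: (e k < e j)%N; case: ltngtP => _; ring.
Qed.

(** An identity of Yang-Baxter type on the species at i, i+1 and j, which depends only on their
    relative order: a finite check. *)
Lemma tau_meet2_nat (F : nat -> nat -> nat -> R) :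
  let m1 F a b c := if (a < c)%N then (1 - t) * F c b a + t * F a b c else F a b c in
  let m2 F a b c := if (b < c)%N then (1 - t) * F a c b + t * F a b c else F a b c in
  let ta F a b c := if (a < b)%N then F b a c + (t - 1) * F a b c
                    else if (b < a)%N then t * F b a c else t * F a b c in
  forall a b c : nat, ta (m1 (m2 F)) a b c = m1 (m2 (ta F)) a b c.
Proof.
move=> m1 m2 ta a b c; rewrite /ta /m1 /m2 {ta m1 m2}.
have [ab|ab|ab] := ltngtP a b; have [bc|bc|bc] := ltngtP b c; have [ac|ac|ac] := ltngtP a c;
  try lia; try subst b; try subst c; try subst a;
  rewrite ?ltnn ?(ltnNge b a) ?(ltnNge a b) ?(ltnNge c b) ?(ltnNge b c) ?(ltnNge a c) ?(ltnNge c a)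
    ?(ltnW ab) ?(ltnW bc) ?(ltnW ac) -?ltnNge ?ab ?bc ?ac /=; ring.
Qed.

Definition put3 i j eta a b c : 'X_{1..n} :=
  [multinom if k == i then a else if k == ordS i then b else if k == j then c else eta k | k < n].

Lemma tau_meet2 i j h : (i.+1 < n)%N -> j != i -> j != ordS i ->
  tau t i (mt j i (mt j (ordS i) h)) = mt j i (mt j (ordS i) (tau t i h)).
Proof.
move=> hi ji jS; have Si : ordS i != i by rewrite eq_sym ordS_neq.
have [ij Sj iS] : [/\ i != j, ordS i != j & i != ordS i] by split=> //; rewrite eq_sym.
apply: funext => e.
have pi a b c : put3 i j e a b c i = a by rewrite mnmE eqxx.
have pS a b c : put3 i j e a b c (ordS i) = b by rewrite mnmE (negbTE Si) eqxx.
have pj a b c : put3 i j e a b c j = c by rewrite mnmE (negbTE ji) (negbTE jS) eqxx.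
have ext (f f' : 'X_{1..n}) : f i = f' i -> f (ordS i) = f' (ordS i) -> f j = f' j ->
    (forall k, k != i -> k != ordS i -> k != j -> f k = f' k) -> f = f'.
  move=> h1 h2 h3 h4; apply/mnmP => k.
  have [->//|k1] := eqVneq k i; have [->//|k2] := eqVneq k (ordS i).
  by have [->//|k3] := eqVneq k j; exact: h4.
have po a b c k : k != i -> k != ordS i -> k != j -> put3 i j e a b c k = e k.
  by move=> k1 k2 k3; rewrite mnmE (negbTE k1) (negbTE k2) (negbTE k3).
have s1 a b c : swap_comp i (put3 i j e a b c) = put3 i j e b a c.
  apply: ext => [|||k k1 k2 k3]; rewrite ?swap_compL ?swap_compR ?swap_compD ?pi ?pS ?pj ?po //.
have s2 a b c : swp i j (put3 i j e a b c) = put3 i j e c b a.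
  apply: ext => [|||k k1 k2 k3]; rewrite ?swpL ?swpR ?swpD ?pi ?pS ?pj ?po //.
have s3 a b c : swp (ordS i) j (put3 i j e a b c) = put3 i j e a c b.
  apply: ext => [|||k k1 k2 k3]; rewrite ?swpL ?swpR ?swpD ?pi ?pS ?pj ?po //.
have -> : e = put3 i j e (e i) (e (ordS i)) (e j).
  by apply: ext => [|||k k1 k2 k3]; rewrite ?pi ?pS ?pj ?po.
have := tau_meet2_nat (fun a b c => h (put3 i j e a b c)) (e i) (e (ordS i)) (e j).
rewrite /tau /meet_site !(s1, s2, s3, pi, pS, pj) /= => ->.
by [].
Qed.

(** The lap from j meets i and i+1 in succession: [tau_meet2] passes this pair, [tau_meet] the other
    sites, and [Bop_unique] concludes. *)
Lemma tau_Bop_comm i j g : (i.+1 < n)%N -> j != i -> j != ordS i ->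
  tau t i (Bop j g) = Bop j (tau t i g).
Proof.
move=> hi ji jS; apply: Bop_unique => [|eta e0|eta z]; last first.
- by apply: tau_no0 => // *; exact: Bop_no0.
- by rewrite /tau !Bop0 // swap_compD.
rewrite {1}Bop_tour /tour; have [A [L e]] := after_adj_other hi ji jS.
have [us _] := after_uniq j; move: us; rewrite e cat_uniq => /and3P[_ /hasPn hA].
rewrite 2!cons_uniq in_cons negb_or -!andbA => /and4P[iS iL SL _].
have iA : i \notin A by apply: hA; rewrite mem_head.
have SA : ordS i \notin A by apply: hA; rewrite !in_cons eqxx orbT.
have mv s h : i \notin s -> ordS i \notin s -> tau t i (foldr (mt j) h s) = foldr (mt j) (tau t i h) s.
  elim: s => [|k s IH] //=; rewrite !in_cons !negb_or => /andP[ik is'] /andP[Sk Ss].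
  by rewrite tau_meet ?IH // eq_sym.
by rewrite !foldr_cat mv //= tau_meet2 // mv.
Qed.

Lemma Bop_rot j g : Bop j (fun e => g (rot_comp e)) = (fun e => Bop (ordS j) g (rot_comp e)).
Proof.
symmetry; apply: Bop_unique => [|eta e0|eta z]; last first.
- by rewrite Bop_no0 // (has0_rearr (rot_rearr (rearr_refl eta))).
- by rewrite Bop0 // mnmE ordSK.
have rs k e : rot_comp (swp k j e) = swp (ordS k) (ordS j) (rot_comp e).
  apply/mnmP => l; rewrite !mnmE; congr (e _).
  have [->|l1] := eqVneq l (ordS k); first by rewrite ordSK !tpermL ordSK.
  have [->|l2] := eqVneq l (ordS j); first by rewrite ordSK !tpermR ordSK.
  rewrite [tperm (ordS k) _ l]tpermD 1?eq_sym // tpermD //.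
    by rewrite -(inj_eq (can_inj (@ordSK n))) ord_predK eq_sym.
  by rewrite -(inj_eq (can_inj (@ordSK n))) ord_predK eq_sym.
have mv h s : foldr (mt j) (fun e => h (rot_comp e)) s =
    (fun e => foldr (mt (ordS j)) h (map (@ordS n) s) (rot_comp e)).
  elim: s => [|k s IH] //=; rewrite IH; apply: funext => e; rewrite /meet_site.
  by rewrite rs [rot_comp e (ordS k)]mnmE [rot_comp e (ordS j)]mnmE !ordSK.
by rewrite /tour mv -after_ordS -/(tr _ _) -Bop_tour.
Qed.

End PushOps.

(** * Positive operators and irreducibility *)

Section Perron.
Variables (R : realFieldType) (T : eqType) (Om : seq T) (e0 : T).
Variables (phi : T -> R) (S : (T -> R) -> T -> R).
Hypothesis S01 : forall g, (forall e, e \in Om -> 0 <= g e <= 1) ->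
  forall e, e \in Om -> 0 <= S g e <= 1.
Hypothesis S_inv : forall g, \sum_(e <- Om) phi e * S g e = \sum_(e <- Om) phi e * g e.
(** A weak form of irreducibility: all nonempty absorbing sets share the point e0, which will be
    [lam] for both operators considered. *)
Hypothesis S_irr : forall A : pred T,
  (forall e, e \in Om -> A e -> S (fun x => (A x)%:R) e = 1) ->
  (exists2 e, e \in Om & A e) -> A e0.

Lemma sum_eq0_ge0 (F : T -> R) : (forall e, e \in Om -> 0 <= F e) ->
  \sum_(e <- Om) F e = 0 -> forall e, e \in Om -> F e = 0.
Proof.
elim: (Om) => [|a s IH] h; first by move=> _ e; rewrite in_nil.
have ha : 0 <= F a by apply: h; rewrite mem_head.
have hs e : e \in s -> 0 <= F e by move=> he; apply: h; rewrite in_cons he orbT.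
have hS : 0 <= \sum_(e <- s) F e by rewrite big_seq sumr_ge0.
rewrite big_cons => h0 e; rewrite in_cons => /predU1P[->|he]; first by lra.
by apply: IH => //; lra.
Qed.

(** With g the indicator of phi > 0, every term phi (g - S g) is nonnegative, and by invariance they
    sum to 0. *)
Lemma pos_absorbing e : e \in Om -> 0 < phi e -> S (fun x => ((0 < phi x)%R)%:R) e = 1.
Proof.
set g := (fun x => ((0 < phi x)%R)%:R : R) => he hp.
have g01 x : 0 <= g x <= 1 by rewrite /g; case: (0 < phi x); rewrite ?ler01 ?lexx.
have hS x : x \in Om -> 0 <= S g x <= 1 by apply: S01 => y _.
have h := @sum_eq0_ge0 (fun x => phi x * (g x - S g x)).
have h1 : phi e * (g e - S g e) == 0.
  apply/eqP; apply: h => //.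
    move=> x /hS /andP[a b]; rewrite {1}/g; case: ltP => hx'.
      by rewrite mulr_ge0 ?(ltW hx') // subr_ge0.
    by rewrite sub0r mulrN -mulNr mulr_ge0 // oppr_ge0.
  under eq_bigr do rewrite mulrBr.
  by rewrite sumrB S_inv subrr.
have ge : g e = 1 by rewrite /g hp.
by move: h1; rewrite mulf_eq0 (gt_eqF hp) /= ge subr_eq0 => /eqP.
Qed.

Lemma pos_contains : (exists2 e, e \in Om & 0 < phi e) -> 0 < phi e0.
Proof. by apply: S_irr => e; exact: pos_absorbing. Qed.

End Perron.

Section PerronConsequences.
Variables (R : realFieldType) (T : eqType) (Om : seq T) (e0 : T).
Variables (S : (T -> R) -> T -> R).
Hypothesis S01 : forall g, (forall e, e \in Om -> 0 <= g e <= 1) ->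
  forall e, e \in Om -> 0 <= S g e <= 1.
Hypothesis S_irr : forall A : pred T,
  (forall e, e \in Om -> A e -> S (fun x => (A x)%:R) e = 1) ->
  (exists2 e, e \in Om & A e) -> A e0.
Implicit Type phi : T -> R.

(** The sets phi > 0 and phi < 0 cannot both be nonempty, as both would contain e0. *)
Lemma invariant_ge0 phi :
  (forall g, \sum_(e <- Om) phi e * S g e = \sum_(e <- Om) phi e * g e) ->
  (exists2 e, e \in Om & 0 < phi e) -> forall e, e \in Om -> 0 <= phi e.
Proof.
move=> h hp e he; rewrite leNgt; apply/negP => hn.
have h1 := pos_contains S01 h S_irr hp.
have h' g : \sum_(e <- Om) (- phi e) * S g e = \sum_(e <- Om) (- phi e) * g e.
  under eq_bigr do rewrite mulNr.
  by under [RHS]eq_bigr do rewrite mulNr; rewrite !sumrN h.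
have := pos_contains S01 h' S_irr; rewrite oppr_gt0 ltNge (ltW h1) => /(_ _)/notF; apply.
by exists e; rewrite ?oppr_gt0.
Qed.

Lemma invariant_eq0 phi :
  (forall g, \sum_(e <- Om) phi e * S g e = \sum_(e <- Om) phi e * g e) ->
  \sum_(e <- Om) phi e = 0 -> forall e, e \in Om -> phi e = 0.
Proof.
move=> h h0.
have h' g : \sum_(e <- Om) (- phi e) * S g e = \sum_(e <- Om) (- phi e) * g e.
  under eq_bigr do rewrite mulNr.
  by under [RHS]eq_bigr do rewrite mulNr; rewrite !sumrN h.
case: (pselect (exists2 e, e \in Om & 0 < phi e)) => he.
- by apply: sum_eq0_ge0 => //; apply: invariant_ge0.
- move=> e he'; apply/eqP; rewrite -oppr_eq0; apply/eqP; move: e he'.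
  apply: sum_eq0_ge0; last by rewrite sumrN h0 oppr0.
  by move=> e he'; rewrite oppr_ge0 leNgt; apply/negP => hp; apply: he; exists e.
Qed.

End PerronConsequences.

Lemma reindex_rearr (V : nmodType) n (lam : 'X_{1..n}) (f : 'X_{1..n} -> 'X_{1..n})
    (G : 'X_{1..n} -> V) :
  injective f -> (forall eta, eta \in rearr lam -> f eta \in rearr lam) ->
  \sum_(eta <- rearr lam) G (f eta) = \sum_(eta <- rearr lam) G eta.
Proof.
move=> finj fO; rewrite -(big_map f predT G); apply: perm_big.
have u : uniq [seq f eta | eta <- rearr lam] by rewrite map_inj_uniq // undup_uniq.
have sub : {subset [seq f eta | eta <- rearr lam] <= rearr lam} by move=> e /mapP[e' h ->]; exact: fO.
have [_ e] := uniq_min_size u sub (eq_leq (esym (size_map f (rearr lam)))).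
exact: (uniq_perm u (undup_uniq _) e).
Qed.

Lemma sum_tau (K : fieldType) (V : lmodType K) (t : K) n (lam : 'X_{1..n}) (i : 'I_n)
    (w : 'X_{1..n} -> K) (G H : 'X_{1..n} -> V) :
  (forall z, z \in rearr lam -> (z (ordS i) < z i)%N -> H z = G (swap_comp i z)) ->
  (forall z, z \in rearr lam -> z i = z (ordS i) -> H z = t *: G z) ->
  (forall z, z \in rearr lam -> (z i < z (ordS i))%N ->
     H z = (t - 1) *: G z + t *: G (swap_comp i z)) ->
  \sum_(z <- rearr lam) w z *: H z = \sum_(z <- rearr lam) tau t i w z *: G z.
Proof.
move=> hd ht ha.
pose A (z : 'X_{1..n}) : K :=
  if (z i < z (ordS i))%N then t else if (z (ordS i) < z i)%N then 1 else 0.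
pose D (z : 'X_{1..n}) : K :=
  if (z i < z (ordS i))%N then t - 1 else if (z (ordS i) < z i)%N then 0 else t.
have -> : \sum_(z <- rearr lam) w z *: H z =
   \sum_(z <- rearr lam) (w z * A z) *: G (swap_comp i z) +
   \sum_(z <- rearr lam) (w z * D z) *: G z.
  rewrite -big_split /= big_seq [RHS]big_seq; apply: eq_bigr => z hz; rewrite /A /D.
  case: ltngtP => h.
  - by rewrite ha // scalerDr !scalerA addrC.
  - by rewrite hd // mulr1 mulr0 scale0r addr0.
  - by rewrite ht // mulr0 scale0r add0r scalerA.
rewrite -(@reindex_rearr _ n lam (swap_comp i)
   (fun z => (w z * A z) *: G (swap_comp i z))); first last.
- by move=> z; exact: swap_rearr.
- exact: (can_inj (@swap_compK n i)).
rewrite -big_split /=; apply: eq_bigr => z _.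
rewrite swap_compK -scalerDl; congr (_ *: _).
rewrite /A /D /tau swap_compL swap_compR.
by case: ltngtP => _; ring.
Qed.

Section Stationarity.
Variables (R : realType) (n : nat) (t : R) (lam : 'X_{1..n}).
Hypothesis t01 : 0 <= t < 1.
Hypothesis n2 : (1 < n)%N.
Hypothesis plam : is_partition lam.
Hypothesis lam0 : has0 lam.
Implicit Types (eta zeta : 'X_{1..n}) (i j k : 'I_n) (g h : 'X_{1..n} -> R) (x : 'I_n -> R).

Local Notation Om := (rearr lam).

Lemma Bop_le1 j g : (forall e, e \in Om -> 0 <= g e <= 1) ->
  forall e, e \in Om -> 0 <= Bop t j g e <= 1.
Proof.
move=> hg e he; rewrite !(Bop_bell _ _ _ lam0 he).
have e1 := Bop1 t01 j; have := e1 e; rewrite (has0_rearr he) lam0 => /(_ isT).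
rewrite (Bop_bell _ _ _ lam0 he) => <-.
have b0 (z : 'X_{1..n}) : 0 <= bell_prob lam t j e z by exact: cascade_ge0.
apply/andP; split.
  by rewrite big_seq sumr_ge0 // => z hz; rewrite mulr_ge0 //; case/andP: (hg z hz).
rewrite big_seq [leRHS]big_seq ler_sum // => z hz; rewrite ler_wpM2l //.
by case/andP: (hg z hz).
Qed.

Definition Mop x g eta : R := \sum_j (x j)^-1 * Bop t j g eta.

Lemma Mop_rate x g eta : eta \in Om ->
  Mop x g eta = \sum_(z <- Om) rate lam x t eta z * g z.
Proof.
move=> he; rewrite /Mop; under eq_bigr do rewrite (Bop_bell _ _ _ lam0 he) mulr_sumr.
rewrite exchange_big /=; apply: eq_bigr => z _; rewrite /rate mulr_suml.
by apply: eq_bigr => j _; rewrite mulrA.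
Qed.

Definition kap x : R := \sum_j (x j)^-1.

Lemma Mop1 x eta : eta \in Om -> Mop x (fun=> 1) eta = kap x.
Proof.
move=> he; apply: eq_bigr => j _.
by rewrite Bop1 // ?mulr1 // (has0_rearr he).
Qed.

Lemma kap_gt0 x : (forall i, 0 < x i) -> 0 < kap x.
Proof.
move=> hx; have [i _] : exists i, lam i = 0%N by apply/has0P.
rewrite /kap (bigD1 i) //= ltr_pwDl ?invr_gt0 // sumr_ge0 // => j _.
by rewrite invr_ge0 ltW.
Qed.

(** * Irreducibility of the chain *)

Definition dstep j eta i := if (eta i < eta j)%N then swp i j eta else eta.

Lemma dstep_rearr j eta L : eta \in Om -> foldl (dstep j) eta L \in Om.
Proof.
elim: L eta => [|i L IH] eta //= he; apply: IH; rewrite /dstep.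
by case: ifP => // _; exact: swp_rearr.
Qed.

(** A convex combination of values at most 1 can equal 1 only if the term of weight 1 - t > 0,
    settling at the site just met, equals 1. *)
Lemma meet_eq1 j g L : (forall e, e \in Om -> g e <= 1) ->
  (forall e, e \in Om -> foldr (meet_site t j) g L e <= 1) /\
  (forall e, e \in Om -> foldr (meet_site t j) g L e = 1 -> g (foldl (dstep j) e L) = 1).
Proof.
move=> hg; have [t0 t1] := andP t01; elim: L => [|i L [IH1 IH2]] //=; split=> e he.
  rewrite meet_siteE; case: ifP => _; last exact: IH1.
  by have := IH1 _ he; have := IH1 _ (swp_rearr i j he); nra.
rewrite meet_siteE /dstep; case: ifP => hi h1; last exact: IH2.
apply: IH2; first exact: swp_rearr.
have := IH1 _ he; have := IH1 _ (swp_rearr i j he) => h2 h3.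
have h4 : 0 < 1 - t by lra.
have h5 : (1 - t) * (1 - foldr (meet_site t j) g L (swp i j e)) <= 0 by nra.
by rewrite pmulr_rle0 // in h5; lra.
Qed.

(** The stored species only decreases along the tour. It is still at least s only if everything met
    so far was, and a site below s can rise to s only by receiving such a stored species. *)
Lemma dtour_inv j eta s L : uniq L -> j \notin L ->
  let e := foldl (dstep j) eta L in
  [/\ forall i, i \notin L -> i != j -> e i = eta i,
      (s <= e j)%N -> (s <= eta j)%N /\ (forall i, i \in L -> (s <= eta i)%N) &
      forall p A B, L = A ++ p :: B -> (s <= e p)%N -> (eta p < s)%N ->
        (s <= eta j)%N /\ (forall i, i \in A -> (s <= eta i)%N)].
Proof.
elim/last_ind: L => [|L q IH] /=.
  by move=> _ _; split=> // p [|? ?] B.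
rewrite rcons_uniq mem_rcons in_cons negb_or => /andP[qL uL] /andP[jq jL].
have [h1 h2 h3] := IH uL jL; rewrite foldl_rcons; set e := foldl _ _ _ in h1 h2 h3 *.
have eq : e q = eta q by apply: h1; rewrite // eq_sym.
split.
- move=> i; rewrite mem_rcons in_cons negb_or => /andP[iq iL] ij.
  by rewrite /dstep; case: ifP => _; rewrite ?swpD // h1.
- rewrite /dstep; case: ifP => hq.
    rewrite swpR eq => hs; have [|a b] := h2; first by rewrite eq in hq; lia.
    by split=> // i; rewrite mem_rcons in_cons => /predU1P[->|/b].
  move=> hs; have [a b] := h2 hs; split=> // i; rewrite mem_rcons in_cons => /predU1P[->|/b //].
  by move: hq; rewrite eq; lia.
- move=> p A B; case/lastP: B => [|B q'].
    rewrite cats1 => /eqP; rewrite eqseq_rcons => /andP[/eqP <- /eqP <-].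
    rewrite /dstep; case: ifP => hq; last by rewrite eq; lia.
    by rewrite swpL => hs _; apply: h2.
  rewrite -rcons_cons -rcons_cat => /eqP; rewrite eqseq_rcons => /andP[/eqP eL /eqP eq'].
  have pL : p \in L by rewrite eL mem_cat mem_head orbT.
  have pq : p != q by apply: contraNneq qL => <-.
  have pj : p != j by apply: contraNneq jL => <-.
  have -> : dstep j e q p = e p by rewrite /dstep; case: ifP => _ //; rewrite swpD.
  exact: (h3 p A B eL).
Qed.

Definition dring eta j := foldl (dstep j) eta (after j).

Lemma dring0 eta j : has0 eta -> dring eta j j = 0%N.
Proof.
move=> /has0P[i hi]; have [us nj] := after_uniq j.
apply/eqP; rewrite -leqn0 leqNgt; apply/negP => h.
have [_ h2 _] := dtour_inv eta 1 us nj; have [h3 h4] := h2 h.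
have [e|ne] := eqVneq i j; first by rewrite -e hi in h3.
by have := h4 i; rewrite mem_after ne hi => /(_ isT).
Qed.

Definition nge s eta := #|[set i | (s <= eta i)%N]|.

Lemma nge_rearr s eta : eta \in Om -> nge s eta = nge s lam.
Proof.
move=> /rearrP[u ->]; rewrite /nge -(card_imset _ (@perm_inj _ u)); apply: eq_card => i.
rewrite !inE; apply/imsetP/idP => [[k]|h]; first by rewrite inE mnmE => h ->.
by exists (u^-1%g i); rewrite ?inE ?mnmE permKV.
Qed.

Lemma card_lt_ord (c : nat) : (c <= n)%N -> #|[set i : 'I_n | (i < c)%N]| = c.
Proof.
move=> hc; have -> : #|[set i : 'I_n | (i < c)%N]| = #|[seq i : 'I_n <- enum 'I_n | (i < c)%N]|.
  by apply: eq_card => i; rewrite inE mem_filter mem_enum andbT.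
rewrite (card_uniqP _); last by rewrite filter_uniq ?enum_uniq.
by rewrite -(size_map val) (@val_filter_enum n (fun m => (m < c)%N)) filter_iota_lt // size_iota.
Qed.

Lemma nge_le s eta : (nge s eta <= n)%N.
Proof. by rewrite -[leqRHS]card_ord max_card. Qed.

(** A site p below s rises only if j and all sites met before p, among them those of index below p,
    held at least s. For p at or beyond [nge s lam] that is one site too many. *)
Lemma dring_step s eta j : (0 < s)%N -> eta \in Om ->
  (forall p : 'I_n, (nge s lam <= p)%N -> (p < j)%N -> (eta p < s)%N) ->
  forall p : 'I_n, (nge s lam <= p)%N -> (p <= j)%N -> (dring eta j p < s)%N.
Proof.
move=> s0 he IH p cp pj.
have h0 : has0 eta by rewrite (has0_rearr he).
have [->|npj] := eqVneq p j; first by rewrite dring0.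
have npj' : (p : nat) != j by rewrite (inj_eq (@ord_inj n)).
have lpj : (p < j)%N by lia.
have hp := IH p cp lpj; rewrite ltnNge; apply/negP => hs.
have [us nj] := after_uniq j; have [_ _ h3] := dtour_inv eta s us nj.
have [A [B eA]] : exists A B, after j = A ++ p :: B.
  have : p \in after j by rewrite mem_after.
  by case/splitPr => A B; exists A, B.
have [h4 h5] := h3 p A B eA hs hp.
(* As i < p < j, both are met after the passage from the last site to the first, and i comes
   first. *)
have low i : (i < p)%N -> i \in A.
  move=> hi; have hn := ltn_ord j.
  have [hsz ep] := after_nth eA.
  pose m := (n - j.+1 + i)%N.
  have ei : i = iter m (@ordS n) (ordS j).
    apply: ord_inj; rewrite iter_ordS_val [nat_of_ord (ordS j)]/= modnDml /m.
    have -> : (j.+1 + (n - j.+1 + i) = i + n)%N by lia.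
    by rewrite modnDr modn_small.
  have vp : (p : nat) = ((j.+1 + size A) %% n)%N.
    by rewrite {1}ep iter_ordS_val [nat_of_ord (ordS j)]/= modnDml.
  have sA : (m < size A)%N.
    rewrite ltnNge; apply/negP => hm; have hh : (j.+1 + size A < n + p)%N by rewrite /m in hm; lia.
    case: (ltnP (j.+1 + size A) n) => h; first by rewrite modn_small in vp => //; lia.
    have e2 : (j.+1 + size A = (j.+1 + size A - n) + n)%N by lia.
    by move: vp; rewrite e2 modnDr modn_small; lia.
  have : nth j (after j) m = i by rewrite nth_traject_def ?ei //; lia.
  by rewrite eA nth_cat sA => <-; exact: mem_nth.
have sub : j |: [set i : 'I_n | (i < nge s lam)%N] \subset [set i | (s <= eta i)%N].
  apply/fintype.subsetP => i; rewrite !inE => /orP[/eqP -> //|hi].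
  by apply: h5; apply: low; lia.
have := subset_leq_card sub; rewrite -/(nge s eta) (nge_rearr s he) cardsU1 inE.
rewrite card_lt_ord ?nge_le // -leqNgt.
have -> : (nge s lam <= j)%N by lia.
by rewrite add1n ltnn.
Qed.

Lemma nge_sorted eta : eta \in Om ->
  (forall s (p : 'I_n), (0 < s)%N -> (nge s lam <= p)%N -> (eta p < s)%N) -> eta = lam.
Proof.
move=> he h; apply: partition_unique => // i j hij.
have [->//|sp] := posnP (eta j); set s := eta j in sp *.
have hj : (j < nge s lam)%N.
  by rewrite ltnNge; apply/negP => hc; have := h s j sp hc; rewrite ltnn.
have sub : [set k | (s <= eta k)%N] \subset [set k : 'I_n | (k < nge s lam)%N].
  apply/fintype.subsetP => k; rewrite !inE => hk; rewrite ltnNge; apply/negP => hc.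
  by have := h s k sp hc; rewrite ltnNge hk.
have ec : [set k | (s <= eta k)%N] = [set k : 'I_n | (k < nge s lam)%N].
  by apply/eqP; rewrite eqEcard sub /= card_lt_ord ?nge_le // -/(nge s eta) (nge_rearr s he).
have : i \in [set k | (s <= eta k)%N] by rewrite ec inE; lia.
by rewrite inE.
Qed.

(* Ringing all the bells once, in order, sorts the configuration when each *)
(* active particle settles at the first lower site.                        *)
Lemma dring_all eta : eta \in Om -> foldl dring eta (enum 'I_n) = lam.
Proof.
move=> he; have ring_rearr e j : e \in Om -> dring e j \in Om by exact: dstep_rearr.
have gen (m : nat) : (m <= n)%N ->
    let e := foldl dring eta [seq i : 'I_n <- enum 'I_n | (i < m)%N] in
    e \in Om /\ forall s (p : 'I_n), (0 < s)%N -> (nge s lam <= p)%N -> (p < m)%N -> (e p < s)%N.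
  elim: m => [|m IH] hm.
    have -> : [seq i : 'I_n <- enum 'I_n | (i < 0)%N] = [::] by elim: (enum _).
    by [].
  have [h1 h2] := IH (ltnW hm).
  have -> : [seq i : 'I_n <- enum 'I_n | (i < m.+1)%N] =
      rcons [seq i : 'I_n <- enum 'I_n | (i < m)%N] (Ordinal hm).
    apply: (inj_map val_inj); rewrite map_rcons.
    rewrite (@val_filter_enum n (fun k : nat => (k < m.+1)%N)) (@val_filter_enum n (fun k : nat => (k < m)%N)).
    by rewrite !filter_iota_lt // -?(addn1 m) ?iotaD ?cats1 // ltnW.
  rewrite foldl_rcons; split; first exact: ring_rearr.
  move=> s p s0 cp pm; apply: dring_step => // k hk hkm; exact: h2.
have [h1 h2] := gen n (leqnn n).
have ee : [seq i : 'I_n <- enum 'I_n | (i < n)%N] = enum 'I_n.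
  by apply/all_filterP/allP => i _.
by rewrite ee in h1 h2; apply: nge_sorted => // s p s0 cp; apply: h2.
Qed.

(** A set absorbing for the average of the bells is absorbing for each bell, hence by [meet_eq1]
    stable under [dring]; [dring_all] then reaches lam. *)
Lemma Mop_irr x (A : pred 'X_{1..n}) : (forall i, 0 < x i) ->
  (forall e, e \in Om -> A e -> (kap x)^-1 * Mop x (fun z => (A z)%:R) e = 1) ->
  (exists2 e, e \in Om & A e) -> A lam.
Proof.
move=> hx hA [e he Ae]; pose g (z : 'X_{1..n}) : R := (A z)%:R.
have g01 (z : 'X_{1..n}) : 0 <= g z <= 1 by rewrite /g; case: (A z); rewrite ?ler01 ?lexx.
have bg j z : z \in Om -> 0 <= Bop t j g z <= 1 by apply: Bop_le1 => y _.
have B1 z j : z \in Om -> A z -> Bop t j g z = 1.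
  move=> hz Az; have kn : kap x != 0 by rewrite gt_eqF // kap_gt0.
  have h : Mop x g z = kap x by rewrite -[RHS]mulr1 -(hA z hz Az) mulrA divff // mul1r.
  have h0 : \sum_k (x k)^-1 * (1 - Bop t k g z) = 0.
    under eq_bigr do rewrite mulrBr mulr1.
    by rewrite sumrB -/(Mop x g z) h subrr.
  have hk := @sum_eq0_ge0 R _ (index_enum 'I_n) (fun k => (x k)^-1 * (1 - Bop t k g z)).
  have {}hk := fun H => hk H h0 j (mem_index_enum j).
  have /eqP : (x j)^-1 * (1 - Bop t j g z) = 0; first (apply: hk => k _).
    by rewrite mulr_ge0 ?invr_ge0 ?(ltW (hx _)) // subr_ge0; case/andP: (bg k z hz).
  by rewrite mulf_eq0 invr_eq0 (gt_eqF (hx j)) /= subr_eq0 => /eqP.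
have ringA z j : z \in Om -> A z -> A (dring z j).
  move=> hz Az; have := B1 z j hz Az; rewrite Bop_tour // /tour.
  have hb (y : 'X_{1..n}) : y \in Om -> Bop t j g y <= 1 by move=> /(bg j) /andP[].
  have [_ h2] := meet_eq1 j (after j) hb; move=> /(h2 z hz); rewrite -/(dring z j).
  rewrite Bop0; last by rewrite dring0 // (has0_rearr hz).
  by rewrite /g; case: (A (dring z j)) => // /eqP; rewrite eq_sym oner_eq0.
rewrite -(dring_all he); elim: (enum 'I_n) (e) he Ae => [|j s IH] z hz Az //=.
by apply: IH; [exact: dstep_rearr|exact: ringA].
Qed.

Lemma Mop01 x g : (forall i, 0 < x i) -> (forall e, e \in Om -> 0 <= g e <= 1) ->
  forall e, e \in Om -> 0 <= (kap x)^-1 * Mop x g e <= 1.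
Proof.
move=> hx hg e he; have kp := kap_gt0 hx.
rewrite mulr_ge0 ?invr_ge0 ?(ltW kp) //=; last first.
  apply: sumr_ge0 => j _; rewrite mulr_ge0 ?invr_ge0 ?(ltW (hx _)) //.
  by case/andP: (Bop_le1 j hg he).
rewrite mulrC ler_pdivrMr // mul1r; apply: ler_sum => j _.
rewrite -[leRHS]mulr1 ler_wpM2l ?invr_ge0 ?(ltW (hx _)) //.
by case/andP: (Bop_le1 j hg he).
Qed.

(** If bells that change nothing are counted, every state has the same total rate [kap x]; so
    stationarity is invariance under one stochastic operator. *)
Lemma stationaryP x (pi : 'X_{1..n} -> R) : (forall i, 0 < x i) ->
  stationary lam x t pi <->
  [/\ forall e, e \in Om -> 0 <= pi e, \sum_(e <- Om) pi e = 1 &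
     forall g, \sum_(e <- Om) pi e * ((kap x)^-1 * Mop x g e) = \sum_(e <- Om) pi e * g e].
Proof.
move=> hx; have kp := kap_gt0 hx; have kn : kap x != 0 by rewrite gt_eqF.
have sum_rate z : z \in Om -> \sum_(e <- Om) rate lam x t z e = kap x.
  move=> hz; rewrite -(Mop1 x hz) Mop_rate //; apply: eq_bigr => e _; by rewrite mulr1.
have spl (F : 'X_{1..n} -> R) (z : 'X_{1..n}) : z \in Om -> \sum_(e <- Om) F e = F z + \sum_(e <- Om | e != z) F e.
  by move=> hz; rewrite (bigD1_seq z) ?undup_uniq.
have bal z : z \in Om ->
   (\sum_(e <- Om | e != z) pi e * rate lam x t e z =
     pi z * \sum_(e <- Om | e != z) rate lam x t z e) <->
   \sum_(e <- Om) pi e * rate lam x t e z = kap x * pi z.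
  move=> hz; rewrite (spl (fun e => pi e * rate lam x t e z) z hz) -(sum_rate z hz).
  rewrite (spl (rate lam x t z) z hz).
  by move: (\sum_(_ <- _ | _) _) (\sum_(_ <- _ | _) _) => a b; split => h; [rewrite h; ring|lra].
split=> [[h1 h2 h3]|[h1 h2 h3]]; split=> //.
  move=> g; transitivity (\sum_(z <- Om) (kap x)^-1 * (\sum_(e <- Om) pi e * rate lam x t e z) * g z).
    under [RHS]eq_bigr do rewrite mulr_sumr mulr_suml.
    rewrite [RHS]exchange_big /= big_seq [RHS]big_seq; apply: eq_bigr => e he.
    by rewrite Mop_rate // !mulr_sumr; apply: eq_bigr => z _; ring.
  rewrite big_seq [RHS]big_seq; apply: eq_bigr => z hz.
  by have /bal -> := h3 z hz; rewrite ?mulKf.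
move=> z hz; apply/bal => //; have := h3 (fun e => (e == z)%:R).
have d (F : 'X_{1..n} -> R) : \sum_(e <- Om) F e * (e == z)%:R = F z.
  rewrite (spl (fun e => F e * (e == z)%:R) z hz) eqxx mulr1 big1 ?addr0 // => e /negbTE ->.
  by rewrite mulr0.
rewrite d => <-; rewrite mulr_sumr big_seq [RHS]big_seq; apply: eq_bigr => e he.
by rewrite Mop_rate // d mulrCA mulVKf.
Qed.

End Stationarity.

(** * Stationarity from the exchange relations *)

Section Exchange.
Variables (R : realType) (n : nat) (t : R) (lam : 'X_{1..n}).
Hypothesis t01 : 0 <= t < 1.
Hypothesis n2 : (1 < n)%N.
Hypothesis plam : is_partition lam.
Hypothesis lam0 : has0 lam.
Implicit Types (eta zeta : 'X_{1..n}) (i j k : 'I_n) (g h : 'X_{1..n} -> R) (x : 'I_n -> R).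

Local Notation Om := (rearr lam).

(** The R-matrix: the exchange relation [F_exch] solved for F(s_i x), with T_i transposed to
    [tau]. *)
Definition Rop i (a b : R) g eta : R :=
  ((b - a) * tau t i g eta + (1 - t) * b * g eta) / (b - t * a).

Lemma Bop_Rop i j a b g : Bop t j (Rop i a b g) =
  (fun e => ((b - a) * Bop t j (tau t i g) e + (1 - t) * b * Bop t j g e) / (b - t * a)).
Proof.
have -> : Rop i a b g = (fun e => ((b - a) / (b - t * a)) * tau t i g e +
   ((1 - t) * b / (b - t * a)) * g e).
  by apply: funext => e; rewrite /Rop; ring.
by rewrite Bop_linear; apply: funext => e; ring.
Qed.

Lemma tau_sum (I : Type) (r : seq I) (P : pred I) (c : I -> R) (G : I -> 'X_{1..n} -> R) i :
  tau t i (fun e => \sum_(k <- r | P k) c k * G k e) =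
  (fun e => \sum_(k <- r | P k) c k * tau t i (G k) e).
Proof.
apply: funext => e; rewrite /tau; case: ifP => _; last case: ifP => _; rewrite !mulr_sumr.
- by rewrite -big_split /=; apply: eq_bigr => k _; ring.
- by apply: eq_bigr => k _; ring.
- by apply: eq_bigr => k _; ring.
Qed.

(** Bells other than i and i+1 have unchanged rates and commute with [tau]. For these two, [tau_Bop]
    and [taup_Bop] express everything by four values, and a rational identity in a and b remains. *)
Lemma Mop_Rop i x g : (i.+1 < n)%N -> x i != 0 -> x (ordS i) != 0 ->
  Mop t x (Rop i (x i) (x (ordS i)) g) =
  Rop i (x i) (x (ordS i)) (Mop t (fun k => x (tperm i (ordS i) k)) g).
Proof.
move=> hi; set a := x i; set b := x (ordS i) => an bn.
have Si : ordS i != i by rewrite eq_sym ordS_neq.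
apply: funext => e; rewrite [in RHS]/Rop /Mop tau_sum.
under eq_bigr do rewrite Bop_Rop.
rewrite (bigD1 i) //= (bigD1 (ordS i)) //= [in RHS](bigD1 i) //= [in RHS](bigD1 (ordS i)) //=.
rewrite [X in _ = ((_ - _) * _ + _ * _ * X) / _](bigD1 i) //=.
rewrite [X in _ = ((_ - _) * _ + _ * _ * (_ + X)) / _](bigD1 (ordS i)) //=.
rewrite !tpermL !tpermR -/a -/b.
pose Q k := (k != i) && (k != ordS i).
have -> : \sum_(k | Q k) (x k)^-1 *
   (((b - a) * Bop t k (tau t i g) e + (1 - t) * b * Bop t k g e) / (b - t * a)) =
   ((b - a) * (\sum_(k | Q k) (x (tperm i (ordS i) k))^-1 * tau t i (Bop t k g) e) +
   (1 - t) * b * \sum_(k | Q k) (x (tperm i (ordS i) k))^-1 * Bop t k g e) / (b - t * a).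
  rewrite !mulr_sumr -big_split /= mulr_suml; apply: eq_bigr => k /andP[k1 k2].
  by rewrite tpermD 1?eq_sym // tau_Bop_comm //; ring.
rewrite -/(Q _); move: (\sum_(_ | _) _) (\sum_(_ | _) _) => s1 s2.
rewrite tau_Bop //; have := congr1 (fun f => f e) (taup_Bop t01 n2 i g).
rewrite /taup /=.
have -> : (fun eta => tau t i g eta + (1 - t) * g eta) = (fun eta => 1 * tau t i g eta + (1 - t) * g eta).
  by apply: funext => y; rewrite mul1r.
rewrite Bop_linear => h.
have -> : tau t i (Bop t (ordS i) g) e =
   1 * Bop t i (tau t i g) e + (1 - t) * Bop t i g e - (1 - t) * Bop t (ordS i) g e.
  by rewrite -h; ring.
move: (Bop _ _ _ _) (Bop _ _ _ _) (Bop _ _ _ _) (Bop _ _ _ _) (b - t * a)^-1 => u v w y c.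
by field; rewrite an bn.
Qed.

Lemma Mop_rot x g eta : Mop t (fun k => x (ord_pred k)) g (rot_comp eta) =
  Mop t x (fun e => g (rot_comp e)) eta.
Proof.
rewrite /Mop (reindex_inj (can_inj (@ordSK n))) /=; apply: eq_bigr => k _.
by rewrite ordSK Bop_rot.
Qed.

Definition Tval (phi : 'X_{1..n} -> R) i eta : R :=
  if (eta (ordS i) < eta i)%N then phi (swap_comp i eta)
  else if (eta i < eta (ordS i))%N then (t - 1) * phi eta + t * phi (swap_comp i eta)
  else t * phi eta.

Lemma pair_tau phi i g :
  \sum_(e <- Om) phi e * tau t i g e = \sum_(e <- Om) Tval phi i e * g e.
Proof.
under eq_bigr do rewrite mulrC.
under [RHS]eq_bigr do rewrite mulrC.
symmetry; apply: (@sum_tau R R^o t n lam i g phi) => z _ h; rewrite /Tval.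
- by rewrite h.
- by rewrite h ltnn.
- by rewrite [(z (ordS i) < _)%N]ltnNge (ltnW h) /= h.
Qed.

Variable F : ('I_n -> R) -> 'X_{1..n} -> R.
(** The defining identity of T_i evaluated at z, the value of T_i F_eta being written in the family
    by [Tval]. *)
Hypothesis F_exch : forall (z : 'I_n -> R) i eta, (i.+1 < n)%N -> eta \in Om ->
  (z (ordS i) - t * z i) * F (fun k => z (tperm i (ordS i) k)) eta =
  (1 - t) * z (ordS i) * F z eta + (z (ordS i) - z i) * Tval (F z) i eta.
Hypothesis F_rot : forall (z : 'I_n -> R) eta, eta \in Om ->
  F z eta = F (fun k => z (ord_pred k)) (rot_comp eta).

Lemma pair_Rop (z : 'I_n -> R) i g : (i.+1 < n)%N -> z (ordS i) - t * z i != 0 ->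
  \sum_(e <- Om) F z e * Rop i (z i) (z (ordS i)) g e =
  \sum_(e <- Om) F (fun k => z (tperm i (ordS i) k)) e * g e.
Proof.
move=> hi hd; set a := z i; set b := z (ordS i).
transitivity (((b - a) * (\sum_(e <- Om) F z e * tau t i g e) +
    (1 - t) * b * \sum_(e <- Om) F z e * g e) / (b - t * a)).
  rewrite !mulr_sumr -big_split /= mulr_suml; apply: eq_bigr => e _.
  by rewrite /Rop; ring.
rewrite pair_tau !mulr_sumr -big_split /= mulr_suml big_seq [RHS]big_seq; apply: eq_bigr => e he.
have h := F_exch z hi he; rewrite -/a -/b in h hd.
apply: (mulIf hd); rewrite mulfVK // [RHS]mulrAC [X in _ = X * _]mulrC h; ring.
Qed.

(** * The cycle of swaps and one rotation, for x_n largest *)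

Section Cycle.
Variables (x : 'I_n -> R) (l : 'I_n).
Hypothesis hl : l.+1 = n.
Hypothesis x_gt0 : forall i, 0 < x i.
Hypothesis x_max : forall i, i != l -> x i < x l.
Local Notation y := (x l).

Let zz := insertf x l.

Lemma zz_swap j : (j.+1 < n)%N -> (fun k => zz (ordS j) (tperm j (ordS j) k)) = zz j.
Proof. by move=> hj; apply: funext => k; exact: insertf_swap. Qed.

Lemma zz_last : zz l = x.
Proof. by apply: funext => k; exact: insertf_last. Qed.

Lemma zz_first (o : 'I_n) : o = 0%N :> nat -> zz o = (fun k => x (ord_pred k)).
Proof. by move=> o0; apply: funext => k; exact: insertf_first. Qed.

(** The variable y travels from the first position to position j. Just before it passes j the pair
    of variables there is y, x_j, and just after it x_j, y; hence only these two enter each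
    R-matrix. *)
Definition SS j g := foldl (fun h k => Rop k (x k) y h) g (ilo j).

Lemma SS_S j g : (j.+1 < n)%N -> SS (ordS j) g = Rop j (x j) y (SS j g).
Proof. by move=> hj; rewrite /SS lo_S // foldl_rcons. Qed.

Lemma ord_ind (P : 'I_n -> Prop) : (forall o : 'I_n, o = 0%N :> nat -> P o) ->
  (forall j, (j.+1 < n)%N -> P j -> P (ordS j)) -> forall j, P j.
Proof.
move=> P0 PS j; have [d] := ubnP j; elim: d j => // d IH j hd.
have [j0|jp] := posnP j; first exact: P0.
have ep := ord_pred_val jp; have hj := ltn_ord j; rewrite -(ord_predK j).
by apply: PS; [lia|apply: IH; lia].
Qed.

Lemma zzS j : (j.+1 < n)%N -> zz (ordS j) j = x j /\ zz (ordS j) (ordS j) = y.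
Proof. by move=> hj; rewrite /zz /insertf (ordS_val hj) ltnSn ltnn eqxx. Qed.

Lemma xj_lt j : (j.+1 < n)%N -> x j < y.
Proof. by move=> hj; apply: x_max; apply: ord_neq; lia. Qed.

Lemma den_gt0 j : (j.+1 < n)%N -> 0 < y - t * x j.
Proof.
by move=> hj; have := xj_lt hj; have := x_gt0 j; case/andP: t01 => h1 h2 h3 h4; nra.
Qed.

Lemma pair_SS (o : 'I_n) j g : o = 0%N :> nat ->
  \sum_(e <- Om) F (zz j) e * SS j g e = \sum_(e <- Om) F (zz o) e * g e.
Proof.
move=> o0; elim/ord_ind: j => [o' o0'|j hj IH].
  by have -> : o' = o; [apply: ord_inj; rewrite o0|rewrite /SS lo0].
rewrite SS_S //; have [e1 e2] := zzS hj.
have := @pair_Rop (zz (ordS j)) j (SS j g) hj; rewrite e1 e2 => ->.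
  by rewrite zz_swap.
by rewrite gt_eqF // den_gt0.
Qed.

Lemma Mop_SS (o : 'I_n) j g : o = 0%N :> nat ->
  Mop t (zz j) (SS j g) = SS j (Mop t (zz o) g).
Proof.
move=> o0; elim/ord_ind: j => [o' o0'|j hj IH].
  by have -> : o' = o; [apply: ord_inj; rewrite o0|rewrite /SS lo0].
rewrite !SS_S //; have [e1 e2] := zzS hj.
have := @Mop_Rop j (zz (ordS j)) (SS j g) hj; rewrite e1 e2 => ->; rewrite ?gt_eqF //.
by rewrite zz_swap // IH.
Qed.

Definition unrot eta : 'X_{1..n} := [multinom eta (ordS k) | k < n].

Lemma rot_compK eta : unrot (rot_comp eta) = eta.
Proof. by apply/mnmP => k; rewrite !mnmE ordSK. Qed.

Definition Sop g := SS l (fun e => g (unrot e)).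

Lemma pair_rot g :
  \sum_(e <- Om) F (fun k => x (ord_pred k)) e * g e = \sum_(e <- Om) F x e * g (rot_comp e).
Proof.
rewrite -(@reindex_rearr _ n lam (@rot_comp n)); first last.
- by move=> e; exact: rot_rearr.
- exact: (can_inj rot_compK).
by rewrite big_seq [RHS]big_seq; apply: eq_bigr => e he; rewrite -F_rot.
Qed.

Lemma pair_SSl g : \sum_(e <- Om) F x e * SS l g e = \sum_(e <- Om) F x e * g (rot_comp e).
Proof.
have [o o0] : exists o : 'I_n, o = 0%N :> nat by exists (ordS l); rewrite /= hl modnn.
by rewrite -{1}zz_last (pair_SS l g o0) (zz_first o0) pair_rot.
Qed.

Lemma pair_Sop g : \sum_(e <- Om) F x e * Sop g e = \sum_(e <- Om) F x e * g e.
Proof. by rewrite pair_SSl; apply: eq_bigr => e _; rewrite rot_compK. Qed.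

Lemma pair_Mop_Sop g :
  \sum_(e <- Om) F x e * Mop t x (Sop g) e = \sum_(e <- Om) F x e * Mop t x g e.
Proof.
have [o o0] : exists o : 'I_n, o = 0%N :> nat by exists (ordS l); rewrite /= hl modnn.
rewrite /Sop -{2}zz_last (Mop_SS l _ o0) pair_SSl; apply: eq_bigr => e _.
rewrite (zz_first o0) Mop_rot; congr (_ * Mop _ _ _ _).
by apply: funext => e'; rewrite rot_compK.
Qed.

(** The condition x_j < y makes both coefficients nonnegative, and t < 1 keeps that of staying
    positive; an ascent is swapped with positive weight. *)
Lemma Rop_conv j eta : (j.+1 < n)%N -> exists w0 w1 : R,
  [/\ 0 < w0, 0 <= w1, w0 + w1 = 1, ascent eta j -> 0 < w1 &
      forall g, Rop j (x j) y g eta = w0 * g eta + w1 * g (swap_comp j eta)].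
Proof.
move=> hj; have d := den_gt0 hj; have xy := xj_lt hj; have x0 := x_gt0 j.
have [t0 t1] := andP t01; have dn : y - t * x j != 0 by rewrite gt_eqF.
rewrite /ascent hj /=; have [h|h|h] := ltngtP (eta j) (eta (ordS j)).
- exists ((1 - t) * x j / (y - t * x j)), ((y - x j) / (y - t * x j)); split.
  + by rewrite divr_gt0 // mulr_gt0 // subr_gt0.
  + by rewrite divr_ge0 ?(ltW d) // subr_ge0 ltW.
  + by field.
  + by rewrite divr_gt0 // subr_gt0.
  + by move=> g; rewrite /Rop /tau h; field.
- exists ((1 - t) * y / (y - t * x j)), (t * (y - x j) / (y - t * x j)); split=> //.
  + by rewrite divr_gt0 // mulr_gt0 // subr_gt0.
  + by rewrite divr_ge0 ?(ltW d) // mulr_ge0 // subr_ge0 ltW.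
  + by field.
  + by move=> g; rewrite /Rop /tau [(eta j < _)%N]ltnNge (ltnW h) /= h; field.
- exists 1, 0; split=> //; rewrite ?addr0 ?ltr01 //.
  by move=> g; rewrite /Rop /tau h ltnn; field.
Qed.

Lemma SS01 j g : (forall e, e \in Om -> 0 <= g e <= 1) ->
  (forall e, e \in Om -> 0 <= SS j g e <= 1) /\
  (forall e, e \in Om -> SS j g e = 1 ->
     g e = 1 /\ forall k, (k < j)%N -> ascent e k -> g (swap_comp k e) = 1).
Proof.
move=> hg; elim/ord_ind: j => [o o0|j hj [IH1 IH2]].
  by rewrite /SS lo0 //=; split=> // e he h1; split=> // k; rewrite o0.
rewrite SS_S //; split=> e he; have [w0 [w1 [p0 p1 s1 pa ->]]] := Rop_conv e hj.
  have /andP[a b] := IH1 e he; have /andP[c d] := IH1 _ (swap_rearr j he).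
  by apply/andP; split; nra.
have /andP[a b] := IH1 e he; have /andP[c d] := IH1 _ (swap_rearr j he) => h1.
have h2 : SS j g e = 1.
  by apply/eqP; rewrite eq_le b /= -subr_le0 -(pmulr_rle0 _ p0); nra.
have [g1 g2] := IH2 e he h2; split=> // k; rewrite (ordS_val hj) ltnS leq_eqVlt => /predU1P[ek|hk] ak.
  have ek' : k = j by apply: ord_inj.
  rewrite ek' in ak *; have pw := pa ak.
  have h3 : SS j g (swap_comp j e) = 1.
    by apply/eqP; rewrite eq_le d /= -subr_le0 -(pmulr_rle0 _ pw); nra.
  by have [] := IH2 _ (swap_rearr j he) h3.
exact: g2.
Qed.

Lemma unrot_rearr eta : eta \in Om -> unrot eta \in Om.
Proof.
have inj : injective (@ordS n) by apply: can_inj (@ordSK n).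
move=> /(rearr_act (perm inj)).
have -> // : [multinom eta (perm inj i) | i < n] = unrot eta.
by apply/mnmP => i; rewrite !mnmE permE.
Qed.

Lemma Sop01 g : (forall e, e \in Om -> 0 <= g e <= 1) ->
  forall e, e \in Om -> 0 <= Sop g e <= 1.
Proof.
move=> hg; have [h _] := @SS01 l (fun e => g (unrot e)) (fun e he => hg _ (unrot_rearr he)).
exact: h.
Qed.

(** An absorbing set is closed under [unrot], of order n, hence under all rotations. Undoing the
    rotation that follows a swap, it is closed under swapping ascents, and these lead to lam. *)
Lemma Sop_irr (A : pred 'X_{1..n}) :
  (forall e, e \in Om -> A e -> Sop (fun e => (A e)%:R) e = 1) ->
  (exists2 e, e \in Om & A e) -> A lam.
Proof.
move=> hA [e he Ae]; pose g (z : 'X_{1..n}) : R := (A z)%:R.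
have g01 (z : 'X_{1..n}) : 0 <= g z <= 1 by rewrite /g; case: (A z); rewrite ?ler01 ?lexx.
have g1 (z : 'X_{1..n}) : g z = 1 -> A z.
  by rewrite /g; case: (A z) => // /eqP; rewrite eq_sym oner_eq0.
have cl (z : 'X_{1..n}) : z \in Om -> A z -> A (unrot z) /\ forall k, ascent z k -> A (unrot (swap_comp k z)).
  move=> hz Az; have [_ h] := @SS01 l (fun e => g (unrot e)) (fun e _ => g01 _).
  have [h1 h2] := h z hz (hA z hz Az); split; first exact: g1.
  by move=> k ak; apply: g1; apply: h2 => //; case/andP: ak; lia.
have itr m z : z \in Om -> A z -> iter m unrot z \in Om /\ A (iter m unrot z).
  move=> hz Az; elim: m => [|m [h1 h2]] //=; split; first exact: unrot_rearr.
  by have [] := cl _ h1 h2.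
have iterE m (z : 'X_{1..n}) k : iter m unrot z k = z (iter m (@ordS n) k).
  by elim: m k => [|m IH] k //=; rewrite mnmE IH -iterSr.
have sw z k : z \in Om -> A z -> ascent z k -> A (swap_comp k z).
  move=> hz Az ak; have [_ h] := cl z hz Az; have h1 := h k ak.
  have h2 : unrot (swap_comp k z) \in Om by apply: unrot_rearr; apply: swap_rearr.
  have [_] := itr n.-1 _ h2 h1; rewrite -iterSr prednK; last by lia.
  have -> // : iter n unrot (swap_comp k z) = swap_comp k z.
  by apply/mnmP => i; rewrite iterE iter_ordS_n.
have [d] := ubnP (mes e); elim: d e he Ae => // d IH e he Ae hd.
have [k ak|na] := pickP (ascent e).
  by apply: (IH (swap_comp k e)); [exact: swap_rearr|exact: sw|have := mes_swap ak; lia].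
by have <- : e = lam by apply: no_ascent => // i; rewrite na.
Qed.

Lemma balance_max g :
  \sum_(e <- Om) F x e * Mop t x g e = kap x * \sum_(e <- Om) F x e * g e.
Proof.
(* The defect of balance. It is invariant under [Sop] because F M and F are, and its total is 0
   because M 1 = kap. *)
pose phi z := \sum_(e <- Om) F x e * rate lam x t e z - kap x * F x z.
have hphi h : \sum_(z <- Om) phi z * h z =
    \sum_(e <- Om) F x e * Mop t x h e - kap x * \sum_(e <- Om) F x e * h e.
  under eq_bigr do rewrite mulrBl.
  rewrite sumrB mulr_sumr; congr (_ - _); last by apply: eq_bigr => z _; rewrite mulrA.
  under eq_bigr do rewrite mulr_suml.
  rewrite exchange_big /= big_seq [RHS]big_seq; apply: eq_bigr => e he.
  by rewrite (Mop_rate t lam0 x h he) mulr_sumr; apply: eq_bigr => z _; rewrite mulrA.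
have h0 := @invariant_eq0 R _ Om lam Sop Sop01 Sop_irr phi.
have {}h0 : forall e, e \in Om -> phi e = 0.
  apply: h0 => [h|]; first by rewrite !hphi pair_Mop_Sop pair_Sop.
  have := hphi (fun=> 1); under eq_bigr do rewrite mulr1.
  move=> ->; apply/eqP; rewrite subr_eq0 mulr_sumr; apply/eqP.
  by rewrite big_seq [RHS]big_seq; apply: eq_bigr => e he; rewrite (Mop1 t01 lam0 x he) mulr1 mulrC.
apply/eqP; rewrite -subr_eq0 -hphi big_seq big1 // => e he.
by rewrite h0 // mul0r.
Qed.

End Cycle.

Hypothesis F_poly : forall x (l : 'I_n) eta, exists p : {poly R}, forall u,
  F (fun k => if k == l then u else x k) eta = p.[u].
Hypothesis F_pos : forall x, (forall i, 0 < x i) -> 0 < F x lam.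

Lemma poly_eq0_large (p : {poly R}) (m : R) : (forall u, m < u -> p.[u] = 0) -> p = 0.
Proof.
move=> h; apply/eqP/negPn/negP => np.
pose s := [seq m + 1 + k%:R | k : nat <- iota 0 (size p)].
have : (size s < size p)%N.
  apply: max_poly_roots => //.
    apply/allP => u /mapP[k _ ->]; rewrite rootE h //.
    by rewrite -addrA ltrDl ltr_pwDl // ler0n.
  by rewrite map_inj_uniq ?iota_uniq // => a b /addrI /eqP; rewrite eqr_nat => /eqP.
by rewrite size_map size_iota ltnn.
Qed.

Lemma balance x g : (forall i, 0 < x i) ->
  \sum_(e <- Om) F x e * Mop t x g e = kap x * \sum_(e <- Om) F x e * g e.
Proof.
move=> hx; have [l hl] : exists l : 'I_n, l.+1 = n.
  by have h : (n.-1 < n)%N; [lia|exists (Ordinal h) => /=; lia].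
pose xu u k : R := if k == l then u else x k.
have [p hp] : exists p : 'X_{1..n} -> {poly R}, forall e u, F (xu u) e = (p e).[u].
  by have [p hp] := choice (fun e => F_poly x l e); exists p.
pose c e := \sum_(j | j != l) (x j)^-1 * Bop t j g e.
pose K := \sum_(j | j != l) (x j)^-1.
have Ml u e : u != 0 -> u * Mop t (xu u) g e = u * c e + Bop t l g e.
  move=> un; rewrite /Mop (bigD1 l) //= /xu eqxx mulrDr mulrA divff // mul1r addrC.
  by congr (_ * _ + _); apply: eq_bigr => j /negbTE ->.
have Kl u : u != 0 -> u * kap (xu u) = u * K + 1.
  move=> un; rewrite /kap (bigD1 l) //= /xu eqxx mulrDr divff // addrC.
  by congr (_ * _ + _); apply: eq_bigr => j /negbTE ->.
(* The last variable is freed as u. Only its own bell has the rate 1/u, so multiplying the balance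
   equation by u makes it polynomial in u. *)
pose P : {poly R} := \sum_(e <- Om) p e * ('X * (c e)%:P + (Bop t l g e)%:P) -
   ('X * K%:P + 1) * \sum_(e <- Om) p e * (g e)%:P.
have PE u : P.[u] = \sum_(e <- Om) F (xu u) e * (u * c e + Bop t l g e) -
   (u * K + 1) * \sum_(e <- Om) F (xu u) e * g e.
  rewrite /P !(hornerE, horner_sum); congr (_ - _ * _); apply: eq_bigr => e _.
    by rewrite !hornerE hp.
  by rewrite !hornerE hp.
have PM u : u != 0 -> P.[u] = u * (\sum_(e <- Om) F (xu u) e * Mop t (xu u) g e -
    kap (xu u) * \sum_(e <- Om) F (xu u) e * g e).
  move=> un; rewrite PE mulrBr mulrA -Kl // [in RHS]mulr_sumr; congr (_ - _).
  by apply: eq_bigr => e _; rewrite -Ml // mulrCA.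
have P0 : P = 0.
  (* Any u above the sum of the x_j exceeds each of them, so [balance_max] applies there. *)
  apply: (@poly_eq0_large _ (\sum_j x j)) => u hu.
  have sx j : x j <= \sum_j x j.
    by rewrite (bigD1 j) //= lerDl sumr_ge0 // => k _; rewrite ltW.
  have up : 0 < u by apply: lt_trans (hx l) _; apply: le_lt_trans (sx l) hu.
  rewrite PM ?gt_eqF // (@balance_max (xu u) l) // ?subrr ?mulr0 //.
    by move=> i; rewrite /xu; case: eqP.
  by move=> i ni; rewrite /xu eqxx (negbTE ni); apply: le_lt_trans hu.
have xl : xu (x l) = x by apply: funext => k; rewrite /xu; case: eqP => [->|].
have := PM (x l); rewrite P0 horner0 xl gt_eqF // => /(_ isT)/esym/eqP.
by rewrite mulf_eq0 (gt_eqF (hx l)) /= subr_eq0 => /eqP.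
Qed.

(** Perron's argument for M itself. Besides the final result, this sign feeds the construction of
    weight vectors for larger contents. *)
Lemma F_ge0 x : (forall i, 0 < x i) -> forall e, e \in Om -> 0 <= F x e.
Proof.
move=> hx; have kp := kap_gt0 lam0 hx; have kn : kap x != 0 by rewrite gt_eqF.
apply: (invariant_ge0 (fun g => Mop01 t01 lam0 hx) (fun A => Mop_irr t01 n2 plam lam0 hx)).
  by move=> g; under eq_bigr do rewrite mulrCA; rewrite -mulr_sumr balance // mulKf.
by exists lam; [exact: rearr_refl|exact: F_pos].
Qed.

Lemma stationary_unique x (pi : 'X_{1..n} -> R) : (forall i, 0 < x i) ->
  stationary lam x t pi <->
  (forall e, e \in Om -> pi e = F x e / \sum_(e <- Om) F x e).
Proof.
move=> hx; have kp := kap_gt0 lam0 hx; have kn : kap x != 0 by rewrite gt_eqF.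
have inv g : \sum_(e <- Om) F x e * ((kap x)^-1 * Mop t x g e) = \sum_(e <- Om) F x e * g e.
  under eq_bigr do rewrite mulrCA.
  by rewrite -mulr_sumr balance // mulKf.
have F0 := F_ge0 hx.
have Z0 : 0 < \sum_(e <- Om) F x e.
  rewrite (bigD1_seq lam) ?undup_uniq ?rearr_refl //= ltr_pwDl ?F_pos //.
  by rewrite big_seq_cond sumr_ge0 // => e /andP[he _]; exact: F0.
set Z := \sum_(e <- Om) F x e in Z0 *; have Zn : Z != 0 by rewrite gt_eqF.
rewrite stationaryP //; split=> [[h1 h2 h3] e he|h].
  apply/eqP; rewrite -subr_eq0; apply/eqP.
  have := @invariant_eq0 R _ Om lam (fun g e => (kap x)^-1 * Mop t x g e)
    (fun g => Mop01 t01 lam0 hx) (fun A => Mop_irr t01 n2 plam lam0 hx)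
    (fun e => pi e - F x e / Z); apply => // [g|].
    under eq_bigr do rewrite mulrBl mulrAC.
    under [RHS]eq_bigr do rewrite mulrBl mulrAC.
    by rewrite !sumrB -!mulr_suml h3 inv.
  by rewrite sumrB -mulr_suml h2 -/Z divff // subrr.
split=> [e he||g].
- by rewrite h // divr_ge0 ?F0 // ltW.
- by rewrite big_seq (eq_bigr _ h) -big_seq -mulr_suml -/Z divff.
- rewrite big_seq [RHS]big_seq; under eq_bigr => e he do rewrite h // mulrAC.
  under [RHS]eq_bigr => e he do rewrite h // mulrAC.
  by rewrite -!big_seq -!mulr_suml inv.
Qed.

End Exchange.

(** * Weight vectors regular at q = 1 *)

Section Ev.
Variables (R : realType) (t : R).

Definition ev : {rmorphism {poly {poly rat}} -> R} :=
  horner_eval t \o map_poly ratr \o horner_eval 1.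

Lemma evE a : ev a = eval_q1 t a. Proof. by []. Qed.

Lemma ev_q : ev 'X = 1.
Proof. by rewrite evE /eval_q1 hornerX rmorph1 hornerC. Qed.

Lemma ev_t : ev 'X%:P = t.
Proof. by rewrite evE /eval_q1 hornerC map_polyX hornerX. Qed.

Lemma relK_q : relK iotaF ev Kq 1.
Proof. by rewrite -ev_q KqE; exact: relK_iota. Qed.

Lemma relK_t : relK iotaF ev Kt t.
Proof. by have := relK_iota iotaF ev 'X%:P; rewrite ev_t. Qed.

End Ev.

Section Evaluation.
Variables (R : realType) (n : nat).
Implicit Types (f : {mpoly R[n]}) (v : 'I_n -> R).

Lemma meval_msym (s : 'S_n) f v : (msym s f).@[v] = f.@[fun k => v (s k)].
Proof.
elim/mpolyC_ind_comm: f => [|f g hf hg|c f hf|k f hf].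
- by rewrite msym1 !meval1.
- by rewrite msymD !mevalD hf hg.
- by rewrite msymZ !mevalZ hf.
- by rewrite msymM !mevalM hf msym_X !mevalXU.
Qed.

Lemma meval_omega1 f v : (omega 1 f).@[v] = f.@[fun k => v (ord_pred k)].
Proof.
rewrite /omega comp_mpoly_meval; congr meval; apply: funext => k.
by rewrite tnth_mktuple; case: ifP => _; rewrite scale1r mevalXU.
Qed.

Lemma meval_line f v (l : 'I_n) : exists p : {poly R}, forall u,
  f.@[fun k => if k == l then u else v k] = p.[u].
Proof.
elim/mpolyC_ind_comm: f => [|f g [p hp] [p' hp']|c f [p hp]|k f [p hp]].
- by exists 1 => u; rewrite meval1 hornerC.
- by exists (p + p') => u; rewrite mevalD hp hp' hornerD.
- by exists (c *: p) => u; rewrite mevalZ hp hornerZ.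
- exists ((if k == l then 'X else (v k)%:P) * p) => u; rewrite mevalM mevalXU hp hornerM.
  by case: eqP => _; rewrite ?hornerX ?hornerC.
Qed.

End Evaluation.

Lemma relK_tau (P : idomainType) (K L : fieldType) (iota : {rmorphism P -> K})
    (eps : {rmorphism P -> L}) t t' n (i : 'I_n) (w : 'X_{1..n} -> K) (w' : 'X_{1..n} -> L) z :
  relK iota eps t t' -> (forall z, relK iota eps (w z) (w' z)) ->
  relK iota eps (tau t i w z) (tau t' i w' z).
Proof.
move=> ht hw; rewrite /tau; case: ifP => _; last by case: ifP => _; apply: relKM.
apply: relKD => //; apply: relKM => //; apply: relKD => //; exact: relKN (relK1 _ _).
Qed.

Section GoodFamily.
Variables (R : realType) (t : R) (n : nat) (lam : 'X_{1..n}).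
Variables (E : {mpoly Qqt[n]}) (Eh : {mpoly R[n]}).
Hypothesis t01 : 0 <= t < 1.
Hypothesis n2 : (1 < n)%N.
Hypothesis plam : is_partition lam.
Hypothesis wE : wt Kq Kt lam E.
Hypothesis rE : Rel iotaF (ev t) E Eh.
Implicit Types (eta : 'X_{1..n}) (i j k l : 'I_n).

Local Notation G := (Gfam E).
Local Notation Rl := (Rel iotaF (ev t)).

Definition Gh := fam (@opT R t n) Eh.

Lemma Rel_fam eta : Rl (G eta) (Gh eta).
Proof.
rewrite /Gfam /Gh /fam; move: (mes eta) => d; elim: d eta => [|d IH] e; first exact: rE.
rewrite [fam_rec _ _ _ _]/= [X in Rel _ _ _ X]/=; case: pickP => [i /andP[hi _]|_]; last exact: rE.
by apply: Rel_opT => //; exact: relK_t.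
Qed.

(** Inherited from generic t through the uniqueness of specialisations: the real t may be 0, and
    [opT_comm] and [opT_braid] assume t invertible. *)
Lemma Gh_swap eta i : eta \in rearr lam -> (i.+1 < n)%N -> (eta (ordS i) < eta i)%N ->
  opT t i (Gh eta) = Gh (swap_comp i eta).
Proof.
move=> he hi hd; apply: (Rel_fun (@iotaF_inj)).
  by apply: Rel_opT; [exact: hi|exact: relK_t|exact: (Rel_fam eta)].
rewrite (Gfam_swap n2 plam wE he hi hd); exact: Rel_fam.
Qed.

Lemma Gh_fix eta i : eta \in rearr lam -> (i.+1 < n)%N -> eta i = eta (ordS i) ->
  opT t i (Gh eta) = t *: Gh eta.
Proof.
move=> he hi hd; apply: (Rel_fun (@iotaF_inj)).
  by apply: Rel_opT; [exact: hi|exact: relK_t|exact: (Rel_fam eta)].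
rewrite (Gfam_fix n2 plam wE he hi hd); apply: RelZ; [exact: relK_t|exact: Rel_fam].
Qed.

Lemma G_asc eta i : eta \in rearr lam -> (i.+1 < n)%N -> (eta i < eta (ordS i))%N ->
  opT Kt i (G eta) = (Kt - 1) *: G eta + Kt *: G (swap_comp i eta).
Proof.
move=> he hi ha; have hs := swap_rearr i he.
have -> : G eta = opT Kt i (G (swap_comp i eta)).
  by rewrite (Gfam_swap n2 plam wE hs hi) ?swap_compK // swap_compL swap_compR.
exact: opT_quad.
Qed.

Lemma Gh_asc eta i : eta \in rearr lam -> (i.+1 < n)%N -> (eta i < eta (ordS i))%N ->
  opT t i (Gh eta) = (t - 1) *: Gh eta + t *: Gh (swap_comp i eta).
Proof.
move=> he hi ha; have hs := swap_rearr i he.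
have -> : Gh eta = opT t i (Gh (swap_comp i eta)).
  by rewrite Gh_swap ?swap_compK // swap_compL swap_compR.
exact: opT_quad.
Qed.

Lemma Gh_rot eta : eta \in rearr lam -> Gh eta = omega 1 (Gh (rot_comp eta)).
Proof.
move=> he; have [l hl] : exists l : 'I_n, l.+1 = n.
  by have h : (n.-1 < n)%N; [lia|exists (Ordinal h) => /=; lia].
have r1 : Rl (Kq ^+ eta l *: G eta) (1 ^+ eta l *: Gh eta).
  by apply: RelZ; [apply: relKX; exact: relK_q|exact: Rel_fam].
have -> : Gh eta = 1 ^+ eta l *: Gh eta by rewrite expr1n scale1r.
apply: (Rel_fun (@iotaF_inj) r1).
rewrite (Gfam_rot n2 plam wE he hl).
by apply: Rel_omega; [exact: relK_q|exact: Rel_fam].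
Qed.

Definition Fv (z : 'I_n -> R) eta : R := (Gh eta).@[z].

Lemma Fv_exch (z : 'I_n -> R) i eta : (i.+1 < n)%N -> eta \in rearr lam ->
  (z (ordS i) - t * z i) * Fv (fun k => z (tperm i (ordS i) k)) eta =
  (1 - t) * z (ordS i) * Fv z eta + (z (ordS i) - z i) * Tval t (Fv z) i eta.
Proof.
move=> hi he; have := opT_E t i (Gh eta).
have : (opT t i (Gh eta)).@[z] = Tval t (Fv z) i eta.
  rewrite /Tval /Fv; case: ltngtP => h.
  - by rewrite Gh_swap.
  - by rewrite Gh_asc // mevalD !mevalZ.
  - by rewrite Gh_fix // mevalZ.
move: (opT t i (Gh eta)) => U hU /(congr1 (meval z)).
rewrite !(mevalM, mevalD, mevalN, mevalXU, mevalC, meval1) meval_msym -/(Fv _ _) -/(Fv z eta) hU.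
by move: (Fv _ _) (Fv _ _) (Tval _ _ _ _) (z i) (z (ordS i)) => a b c d e h; lra.
Qed.

Lemma Fv_rot (z : 'I_n -> R) eta : eta \in rearr lam ->
  Fv z eta = Fv (fun k => z (ord_pred k)) (rot_comp eta).
Proof. by move=> he; rewrite /Fv Gh_rot // meval_omega1. Qed.

Lemma Fv_poly (x : 'I_n -> R) l eta : exists p : {poly R}, forall u,
  Fv (fun k => if k == l then u else x k) eta = p.[u].
Proof. exact: meval_line. Qed.

(** More than positivity: this bound passes from one content to the next, and by [growth_coef] it
    forces a nonzero coefficient at x^lam. *)
Hypothesis pE : forall x : 'I_n -> R, (forall i, 0 < x i) ->
  \prod_i x i ^+ lam i <= Eh.@[x].
Hypothesis lam0 : has0 lam.

Lemma Gh_lam : Gh lam = Eh.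
Proof. exact: fam_lam. Qed.

Lemma Fv_pos (x : 'I_n -> R) : (forall i, 0 < x i) -> 0 < Fv x lam.
Proof.
move=> hx; rewrite /Fv Gh_lam; apply: lt_le_trans (pE hx).
by apply: prodr_gt0 => i _; rewrite exprn_gt0.
Qed.

Lemma Fv_ge0 (x : 'I_n -> R) eta : (forall i, 0 < x i) -> eta \in rearr lam -> 0 <= Fv x eta.
Proof.
move=> hx he.
exact: (F_ge0 t01 n2 plam lam0 Fv_exch Fv_rot Fv_poly Fv_pos hx he).
Qed.

(** * Adding boxes with control of the coefficients at q = 1 *)

Definition add_ones (l : nat) (nu : 'X_{1..n}) : 'X_{1..n} := [multinom (nu p + (p < l))%N | p < n].

Definition Xp (A : fieldType) (l : nat) : {mpoly A[n]} := \prod_(k < n | (k < l)%N) 'X_k.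

Definition wsum (w : 'X_{1..n} -> Qqt) : {mpoly Qqt[n]} :=
  \sum_(z <- rearr lam) w z *: G z.

(* w z and wh z are the coefficient of G z and its value at q = 1; the       *)
(* composition nu carries the coefficient that stays at least 1.             *)
Definition tracked (l : nat) (nu : 'X_{1..n}) := nu \in rearr lam /\
  exists w wh, [/\ wt Kq Kt (add_ones l nu) (Xp Qqt l * wsum w),
    forall z, relK iotaF (ev t) (w z) (wh z), forall z, 0 <= wh z & 1 <= wh nu].

Lemma opT_wsum i w : (i.+1 < n)%N -> opT Kt i (wsum w) = wsum (tau Kt i w).
Proof.
move=> hi; rewrite /wsum (opT_sum _ hi).
transitivity (\sum_(z <- rearr lam) w z *: opT Kt i (G z)).
  by apply: eq_bigr => z _; rewrite (opTZ _ hi).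
apply: sum_tau => z hz h.
- exact: (Gfam_swap n2 plam wE hz hi h).
- exact: (Gfam_fix n2 plam wE hz hi h).
- exact: (G_asc hz hi h).
Qed.

Lemma wsumD w w' : wsum w + wsum w' = wsum (fun z => w z + w' z).
Proof. by rewrite /wsum -big_split /=; apply: eq_bigr => z _; rewrite scalerDl. Qed.

Lemma wsumZ c w : c *: wsum w = wsum (fun z => c * w z).
Proof. by rewrite /wsum scaler_sumr; apply: eq_bigr => z _; rewrite scalerA. Qed.

Lemma msym_Xp (l : nat) i : (i.+1 < n)%N -> (l <= i)%N ->
  msym (tperm i (ordS i)) (Xp Qqt l) = Xp Qqt l.
Proof.
move=> hi hl; rewrite /Xp rmorph_prod /=; apply: eq_bigr => k hk.
have Si := ordS_val hi.
by rewrite msym_X tpermD //; apply: ord_neq; rewrite ?Si; lia.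
Qed.

(** As l <= i, the prefix [Xp] is symmetric in x_i and x_(i+1), so T_i acts on the family alone. The
    only negative entry of [tau] is t - 1, and it is compensated because the intertwiner coefficient
    at q = 1 is (1 - t)/(1 - t^B) with B > 0, hence at least 1 - t. The entry 1 of [tau] carries the
    lower bound from nu to its swap. *)
Lemma tracked_opT (l : nat) (nu : 'X_{1..n}) i : (i.+1 < n)%N -> (l <= i)%N -> (nu (ordS i) < nu i)%N ->
  tracked l nu -> tracked l (swap_comp i nu).
Proof.
move=> hi li hd [ht [w [wh [hw hr h0 h1]]]]; split; first exact: swap_rearr.
have Si := ordS_val hi; have [t0 t1] := andP t01.
pose eta := add_ones l nu.
have hde : (eta (ordS i) < eta i)%N by rewrite !mnmE Si; lia.
have rkd := rk_lt hde.
set B := (rk eta (ordS i) - rk eta i)%N; have Bp : (0 < B)%N by rewrite /B; lia.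
set A := (eta i - eta (ordS i))%N.
have tB := exp_lt1 t01 Bp.
have rden : relK iotaF (ev t) (1 - Kq ^+ A * Kt ^+ B) (1 - 1 ^+ A * t ^+ B).
  apply: relKD; first exact: relK1.
  by apply: relKN; apply: relKM; apply: relKX; [exact: relK_q|exact: relK_t].
have dh : 1 - 1 ^+ A * t ^+ B != 0 by rewrite expr1n mul1r subr_eq0 eq_sym lt_eqF.
have den : 1 - Kq ^+ A * Kt ^+ B != 0 by apply: (relK_neq0 (@iotaF_inj) rden).
pose ch : R := (1 - t) / (1 - 1 ^+ A * t ^+ B).
have rc : relK iotaF (ev t) (wcoef Kq Kt eta i) ch.
  apply: relKM; last exact: (relKV (@iotaF_inj) rden dh).
  by apply: relKD; [exact: relK1|apply: relKN; exact: relK_t].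
have cge : 1 - t <= ch.
  rewrite /ch expr1n mul1r ler_pdivlMr; last by rewrite subr_gt0.
  by have := exprn_ge0 B t0; nra.
exists (fun z => tau Kt i w z + wcoef Kq Kt eta i * w z), (fun z => tau t i wh z + ch * wh z).
have ps : add_ones l (swap_comp i nu) = swap_comp i eta.
  apply/mnmP => k; rewrite !mnmE.
  have [l1 l2] : (i < l)%N = false /\ (ordS i < l)%N = false.
    by rewrite Si !ltnNge li (leq_trans li (leqnSn i)).
  have [->|k1] := eqVneq k i; first by rewrite tpermL l1 l2.
  have [->|k2] := eqVneq k (ordS i); first by rewrite tpermR l1 l2.
  by rewrite tpermD // eq_sym.
split.
- have := wt_opT Kq_neq0 Kt_neq0 hi hde den hw.
  rewrite ps (opTM_sym _ hi _ (msym_Xp hi li)) (opT_wsum _ hi).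
  by rewrite scalerAr -mulrDr wsumZ wsumD.
- move=> z; apply: relKD; last exact: relKM.
  by apply: relK_tau => //; exact: relK_t.
- move=> z; rewrite /tau; have := h0 z; have := h0 (swap_comp i z).
  by do 2?case: ifP => _; nra.
- rewrite /tau swap_compL swap_compR hd swap_compK.
  by have := h0 (swap_comp i nu); nra.
Qed.

Lemma Xp_Phi (l : nat) (z : 'I_n) : z = 0%N :> nat -> (l < n)%N ->
  'X_z * omegai_rm Kq n (Xp Qqt l) = Xp Qqt l.+1.
Proof.
move=> z0 hl; rewrite /Xp rmorph_prod [RHS](bigD1 z) ?z0 //=; congr (_ * _).
rewrite [RHS](reindex_inj (can_inj (@ordSK n))) /=.
apply: eq_big => k.
  have hk := ltn_ord k; have [e|ne] := eqVneq k.+1 n.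
    have -> : ordS k = z by apply: ord_inj; rewrite z0 /= e modnn.
    by rewrite eqxx andbF; lia.
  have hk1 : (k.+1 < n)%N by lia.
  have ke := ordS_val hk1.
  have -> : (k.+1 %% n)%N = k.+1 by rewrite modn_small.
  rewrite ltnS; have -> : ordS k != z by apply: ord_neq; rewrite z0 ke.
  by rewrite andbT.
move=> hk; rewrite omegai_X ifN ?mul1r //.
by have := ltn_ord k; lia.
Qed.

(** By [Gfam_rot] the inverse of omega permutes the family up to powers of q, which have the value 1
    at q = 1. *)
Lemma tracked_Phi (l : nat) (nu : 'X_{1..n}) : (l < n)%N -> tracked l nu -> tracked l.+1 (rot_comp nu).
Proof.
move=> hl [ht [w [wh [hw hr h0 h1]]]]; split; first exact: rot_rearr.
have [m hm] : exists m : 'I_n, m.+1 = n.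
  by have h : (n.-1 < n)%N; [lia|exists (Ordinal h) => /=; lia].
have z0 : ordS m = 0%N :> nat by rewrite /= hm modnn.
exists (fun z : 'X_{1..n} => Kq ^- z (ordS m) * w (unrot z)), (fun z => wh (unrot z)); split.
- have := wt_Phi Kq_neq0 Kt_neq0 z0 n2 hw.
  have -> : Phi_comp (add_ones l nu) = add_ones l.+1 (rot_comp nu).
    apply/mnmP => k; rewrite !mnmE; have [k0|kp] := posnP k.
      by rewrite k0 (ord_pred_val0 k0) ltnS; lia.
    by rewrite (ord_pred_val kp); lia.
  rewrite rmorphM mulrA (Xp_Phi z0 hl).
  have -> // : omegai_rm Kq n (wsum w) = wsum (fun z : 'X_{1..n} => Kq ^- z (ordS m) * w (unrot z)).
  rewrite /wsum -(@reindex_rearr _ n lam (@rot_comp n)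
     (fun z : 'X_{1..n} => (Kq ^- z (ordS m) * w (unrot z)) *: G z)); first last.
  - by move=> z; exact: rot_rearr.
  - exact: (can_inj (@rot_compK n)).
  rewrite raddf_sum /= big_seq [RHS]big_seq; apply: eq_bigr => z hz.
  rewrite rot_compK mnmE ordSK.
  have oZ c f : omegai_rm Kq n (c *: f) = c *: omegai_rm Kq n f.
    by rewrite -!mul_mpolyC rmorphM omegai_mpolyC.
  rewrite oZ; have nz : Kq ^+ z m != 0 by rewrite expf_neq0 ?Kq_neq0.
  have -> : omegai_rm Kq n (G z) = Kq ^- z m *: G (rot_comp z).
    have := congr1 (omegai_rm Kq n) (Gfam_rot n2 plam wE hz hm).
    rewrite oZ omegaE (omega_rmK Kq_neq0) => <-.
    by rewrite scalerA mulVf // scale1r.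
  by rewrite scalerA mulrC.
- move=> z; rewrite -[wh _]mul1r; apply: relKM => //.
  rewrite -[1]invr1 -(expr1n _ (z (ordS m))); apply: (relKV (@iotaF_inj)).
    by apply: relKX; exact: relK_q.
  by rewrite expr1n oner_neq0.
- by move=> z; exact: h0.
- by rewrite rot_compK.
Qed.

Definition move_to_last j (nu : 'X_{1..n}) : 'X_{1..n} :=
  [multinom if (p < j)%N then nu p else if p.+1 == n then nu j else 0%N | p < n].

(** The entry at j passes the zeros behind it, each passage being a descent fit for [tracked_opT]; l
    <= j keeps the swaps off the positions that already have their box. *)
Lemma tracked_move (l : nat) j (nu : 'X_{1..n}) : (l <= j)%N ->
  (forall p : 'I_n, (j < p)%N -> nu p = 0%N) -> tracked l nu -> tracked l (move_to_last j nu).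
Proof.
have [d] := ubnP (n - j)%N; elim: d j nu => // d IH j nu hd lj hz hS.
have hj := ltn_ord j; have [e|ne] := eqVneq j.+1 n.
  have -> // : move_to_last j nu = nu.
  apply/mnmP => p; rewrite mnmE; case: ltnP => // hp; have hpn := ltn_ord p.
  have -> : p = j by apply: ord_inj; lia.
  by rewrite e eqxx.
have hj1 : (j.+1 < n)%N by lia.
have Sj := ordS_val hj1.
have [t0|tp] := posnP (nu j).
  have -> // : move_to_last j nu = nu.
  apply/mnmP => p; rewrite mnmE; case: ltnP => // hp.
  have [e|ne'] := eqVneq p j; first by rewrite e t0; case: ifP.
  have ne2 : (p : nat) != j by rewrite (inj_eq (@ord_inj n)).
  by rewrite t0 hz; [case: ifP|lia].
have tS : nu (ordS j) = 0%N by apply: hz; rewrite Sj.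
have -> : move_to_last j nu = move_to_last (ordS j) (swap_comp j nu).
  apply/mnmP => p; rewrite mnmE [RHS]mnmE Sj swap_compR.
  have [e|ne1] := eqVneq p j; first by rewrite e ltnn ltnSn swap_compL tS (negbTE ne).
  have ne2 : (p : nat) != j by rewrite (inj_eq (@ord_inj n)).
  case: (ltnP p j) => h; last by have -> : (p < j.+1)%N = false by lia.
  have -> : (p < j.+1)%N by lia.
  by rewrite swap_compD //; apply: ord_neq; rewrite Sj; lia.
apply: IH; rewrite ?Sj; try lia; last first.
  by apply: tracked_opT => //; rewrite tS.
move=> p hp; rewrite swap_compD ?hz //; try by apply: ord_neq; rewrite ?Sj; lia.
by lia.
Qed.

Definition rot_prefix j (nu : 'X_{1..n}) : 'X_{1..n} :=
  [multinom if p == 0%N :> nat then nu j else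
            if (p <= j)%N then nu (ord_pred p) else 0%N | p < n].

(** The entry at j goes to the end, and the affine intertwiner brings it to the front with a new
    box. *)
Lemma tracked_round (l : nat) j (nu : 'X_{1..n}) : (l <= j)%N -> (j.+1 < n)%N ->
  (forall p : 'I_n, (j < p)%N -> nu p = 0%N) -> tracked l nu -> tracked l.+1 (rot_prefix j nu).
Proof.
move=> lj hj hz hS; have -> : rot_prefix j nu = rot_comp (move_to_last j nu).
  apply/mnmP => p; rewrite !mnmE; have hp := ltn_ord p; have [p0|pp] := posnP p.
    rewrite (ord_pred_val0 p0) prednK; last by lia.
    by have -> : (n <= j)%N = false; [lia|rewrite eqxx].
  rewrite (ord_pred_val pp) prednK //.
  by case: ifP => // _; have -> : (p == n :> nat) = false by lia.
by apply: tracked_Phi; [lia|exact: tracked_move].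
Qed.

Lemma wsum_delta : wsum (fun z => (z == lam)%:R) = E.
Proof.
rewrite /wsum (bigD1_seq lam) ?undup_uniq ?rearr_refl //= eqxx scale1r big1 ?addr0.
  exact: (Gfam_lam E plam).
by move=> z /negbTE ->; rewrite scale0r.
Qed.

Lemma tracked0 : tracked 0 lam.
Proof.
split; first exact: rearr_refl.
exists (fun z => (z == lam)%:R), (fun z => (z == lam)%:R); split.
- rewrite wsum_delta /Xp big_pred0; last by move=> k.
  have -> : add_ones 0 lam = lam by apply/mnmP => p; rewrite mnmE addn0.
  by rewrite mul1r.
- by move=> z; case: eqP => _; [exact: relK1|exact: relK0].
- by move=> z; rewrite ler0n.
- by rewrite eqxx.
Qed.

(** After j + 1 rounds the first j + 1 entries are back in place and each has gained one box; [ta l]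
    is the state after l rounds, rotated by l. *)
Lemma tracked_rounds j : (j.+1 < n)%N -> (forall p : 'I_n, (j < p)%N -> lam p = 0%N) ->
  tracked j.+1 lam.
Proof.
move=> hj hz; pose af := nth 0%N (lam : seq nat).
have afE (p : 'I_n) : lam p = af p by rewrite /af /fun_of_multinom (tnth_nth 0%N).
pose ta (l : nat) : 'X_{1..n} :=
  [multinom if (p <= j)%N then af ((p + (j.+1 - l)) %% j.+1)%N else 0%N | p < n].
have ta0 (l : nat) : l = 0%N \/ l = j.+1 -> ta l = lam.
  move=> hl; apply/mnmP => p; rewrite mnmE; case: leqP => hp; last by rewrite hz.
  have -> : ((p + (j.+1 - l)) %% j.+1 = p)%N; last by rewrite -afE.
  by case: hl => ->; rewrite ?subn0 ?subnn ?addn0 ?modnDr modn_small.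
have st (l : nat) : (l <= j.+1)%N -> tracked l (ta l).
  elim: l => [|l IH] hl; first by rewrite ta0; [exact: tracked0|left].
  have -> : ta l.+1 = rot_prefix j (ta l).
    apply/mnmP => p; rewrite mnmE [RHS]mnmE; have [p0|pp] := posnP p.
      rewrite p0 /= mnmE leqnn add0n; congr af.
      have -> : (j + (j.+1 - l) = (j.+1 - l.+1) + j.+1)%N by lia.
      by rewrite modnDr.
    case: leqP => // hpj; rewrite mnmE (ord_pred_val pp).
    have -> : (p.-1 <= j)%N by lia.
    by congr (af (_ %% _)%N); lia.
  apply: tracked_round => //; last by apply: IH; lia.
  by move=> p hp; rewrite mnmE leqNgt hp.
by rewrite -(ta0 j.+1); [exact: st|right].
Qed.

Lemma good_step j : (j.+1 < n)%N -> (forall p : 'I_n, (j < p)%N -> lam p = 0%N) ->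
  exists E' Eh', [/\ wt Kq Kt (add_ones j.+1 lam) E', Rl E' Eh' &
    forall x : 'I_n -> R, (forall i, 0 < x i) ->
      \prod_i x i ^+ (add_ones j.+1 lam) i <= Eh'.@[x]].
Proof.
move=> hj hz; have [_ [w [wh [hw hr h0 h1]]]] := tracked_rounds hj hz.
exists (Xp Qqt j.+1 * wsum w), (Xp R j.+1 * \sum_(z <- rearr lam) wh z *: Gh z); split=> //.
  apply: RelM.
    by rewrite /Xp; apply: big_ind2 => [|*|k _]; [exact: Rel1|exact: RelM|exact: RelX].
  by apply: Rel_sum => z _; apply: RelZ => //; exact: Rel_fam.
move=> x hx; rewrite mevalM /Xp rmorph_prod /=.
have -> : \prod_i x i ^+ add_ones j.+1 lam i =
    (\prod_(k < n | (k < j.+1)%N) x k) * \prod_i x i ^+ lam i.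
  rewrite [X in X * _]big_mkcond -big_split /=; apply: eq_bigr => k _.
  rewrite mnmE addnC exprD; congr (_ * _); case: (k < j.+1)%N; by rewrite ?expr1.
have -> : \prod_(k < n | (k < j.+1)%N) ('X_k).@[x] = \prod_(k < n | (k < j.+1)%N) x k.
  by apply: eq_bigr => k _; rewrite mevalXU.
rewrite ler_pM2l; last by apply: prodr_gt0.
apply: le_trans (pE hx) _; rewrite raddf_sum /= (bigD1_seq lam) ?undup_uniq ?rearr_refl //=.
rewrite mevalZ Gh_lam -[leLHS]addr0; apply: lerD.
  rewrite -[leLHS]mul1r ler_wpM2r //.
  by rewrite -Gh_lam; apply: (Fv_ge0 hx); exact: rearr_refl.
rewrite big_seq_cond sumr_ge0 // => z /andP[hz' _]; rewrite mevalZ mulr_ge0 //.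
exact: (Fv_ge0 hx hz').
Qed.

End GoodFamily.

Lemma good_exists (R : realType) (t : R) n (lam : 'X_{1..n}) : 0 <= t < 1 -> (1 < n)%N ->
  is_partition lam -> has0 lam ->
  exists E Eh, [/\ wt Kq Kt lam E, Rel iotaF (ev t) E Eh &
    forall x : 'I_n -> R, (forall i, 0 < x i) -> \prod_i x i ^+ lam i <= Eh.@[x]].
Proof.
move=> t01 n2; have z0 : (0 < n)%N by lia.
pose o := Ordinal z0; have [m] := ubnP (lam o); elim: m lam => // m IH lam hm plam lam0.
have [j hj|hn] := pickP (fun j => 0 < lam j)%N; last first.
  have -> : lam = 0%MM by apply/mnmP => i; rewrite mnm0E; have := hn i; lia.
  exists 1, 1; split; [exact: (wt_1 Kq_neq0 Kt_neq0)|exact: Rel1|].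
  by move=> x _; rewrite meval1 big1 // => i _; rewrite mnm0E expr0.
(* The last nonzero part. A vacancy lies beyond it, so k.+1 < n, which the rounds require. *)
have [k hk kmax] := @arg_maxnP _ j (fun j => 0 < lam j)%N (fun k => k : nat) hj.
have [i hi] := has0P _ lam0.
have ki : (k < i)%N by rewrite ltnNge; apply/negP => h; have := plam _ _ h; rewrite hi; lia.
have hk1 : (k.+1 < n)%N by have := ltn_ord i; lia.
have kz (p : 'I_n) : (k < p)%N -> lam p = 0%N.
  move=> hp; apply/eqP; rewrite -leqn0 leqNgt; apply/negP => h.
  by have := kmax p h; rewrite /= leqNgt hp.
pose a : 'X_{1..n} := [multinom (lam p).-1 | p < n].
have ea : add_ones k.+1 a = lam.
  apply/mnmP => p; rewrite !mnmE; case: (leqP p k) => h; last by rewrite ltnNge h kz.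
  by rewrite ltnS h; have := plam _ _ h; lia.
have pa : is_partition a by move=> p q hpq; rewrite !mnmE; have := plam _ _ hpq; lia.
have a0 : has0 a by apply/has0P; exists i; rewrite mnmE hi.
have ao : (a o < m)%N by rewrite mnmE; have := plam o k (leq0n _); lia.
have [E [Eh [wE rE pE]]] := IH a ao pa a0.
have := good_step t01 n2 pa wE rE pE a0 hk1.
rewrite ea; apply => p hp; by rewrite mnmE kz.
Qed.

(** * Growth and conclusion *)

Section Growth.
Variable n : nat.
Implicit Types (m lam : 'X_{1..n}).

(** Induction on b: its head is removed from u if it occurs there; otherwise it lies in v and is
    traded for an entry of u, which is no larger. *)
Lemma sum_le_take (b u v : seq nat) k : sorted geq b -> perm_eq (u ++ v) b ->
  (size u <= k)%N -> (sumn u <= sumn (take k b))%N.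
Proof.
have geq_tr : transitive geq by move=> a c d /= h1 h2; exact: leq_trans h2 h1.
elim: b u v k => [|x b IH] u v k hs hp hk.
  by have := perm_size hp; rewrite size_cat; case: u {hp hk}.
case: k hk => [|k] hk; first by case: u hk {hp}.
have /allP hx := order_path_min geq_tr hs.
have sb : sorted geq b by apply: path_sorted hs.
rewrite [take _ _]/= [sumn (x :: _)]/=.
have [xu|xu] := boolP (x \in u).
  have pu := perm_to_rem xu; rewrite (perm_sumn pu) /= leq_add2l; apply: (IH _ v) => //.
    by rewrite -(perm_cons x) -cat_cons; apply: perm_trans hp; rewrite perm_cat2r perm_sym.
  by have := perm_size pu; rewrite /=; lia.
have xv : x \in v.
  have : x \in u ++ v by rewrite (perm_mem hp) mem_head.
  by rewrite mem_cat (negbTE xu).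
have pv := perm_to_rem xv.
have {}hp : perm_eq (u ++ rem x v) b.
  rewrite -(perm_cons x); apply: perm_trans hp; rewrite perm_sym.
  by rewrite -[x :: (u ++ _)]cat1s catA (perm_trans (y := u ++ ([:: x] ++ rem x v))) //
     ?perm_cat2l // catA perm_cat2r perm_catC.
case: u hk hp {xu} => [|y u] hk hp //=; rewrite leq_add //.
  by apply: hx; rewrite -(perm_mem hp) mem_head.
apply: (IH _ (y :: rem x v)) => //.
by apply: perm_trans hp; rewrite -cat1s catA perm_cat2r perm_catC.
Qed.

Lemma sumn_take_sort (s : seq nat) k : (sumn (take k s) <= sumn (take k (sort geq s)))%N.
Proof.
apply: (@sum_le_take _ _ (drop k s)).
- by apply: sort_sorted => a b /=; exact: leq_total.
- by rewrite cat_take_drop perm_sym perm_sort.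
- by rewrite size_take; case: ltnP; lia.
Qed.

Definition psum m k := sumn (take k m).

Lemma psumS m (i : 'I_n) : psum m i.+1 = (psum m i + m i)%N.
Proof.
rewrite /psum (take_nth 0%N) ?size_tuple // sumn_rcons; congr (_ + _)%N.
by rewrite /fun_of_multinom (tnth_nth 0%N).
Qed.

Lemma psum_inj m lam : (forall k, (k <= n)%N -> psum m k = psum lam k) -> m = lam.
Proof.
move=> h; apply/mnmP => i; have hi := ltn_ord i.
by have := h i.+1 hi; rewrite !psumS h ?(ltnW hi) //; lia.
Qed.

Lemma partition_sort lam : is_partition lam -> sort geq lam = lam.
Proof.
move=> h; apply: sorted_sort; first by move=> a c d /= h1 h2; exact: leq_trans h2 h1.
apply/(sortedP 0%N) => k; rewrite size_tuple => hk.
have := h (Ordinal (ltnW hk)) (Ordinal hk) (leqnSn _).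
by rewrite /fun_of_multinom !(tnth_nth 0%N).
Qed.

Lemma comp_le_psum m lam : is_partition lam -> comp_le m lam ->
  (forall k, (psum m k <= psum lam k)%N) /\ psum m n = psum lam n.
Proof.
move=> pl; rewrite /comp_le /plus_part (partition_sort pl).
have tn (a : 'X_{1..n}) : take n a = a by rewrite take_oversize ?size_tuple.
have ss : sumn (sort geq m) = sumn m by apply: perm_sumn; rewrite perm_sort.
case=> [[h1 h2]|[h1 h2]]; split=> //; rewrite /psum ?tn -?ss ?h1 //.
by move=> k; apply: leq_trans (sumn_take_sort m k) (h2 k).
Qed.

(** This is the sum of (n - i) m_i over i = 1, ..., n, a linear form that is strictly maximal at the
    partition among the compositions below it. It is the exponent of s in x^m at the point
    [wedge s]. *)
Definition Nsum m := (\sum_(k < n) psum m k)%N.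

Lemma Nsum_lt m lam : is_partition lam -> comp_le m lam -> m != lam ->
  (Nsum m < Nsum lam)%N.
Proof.
move=> pl hc hne; have [h1 h2] := comp_le_psum pl hc.
rewrite ltn_neqAle leq_sum ?andbT => [|k _]; last exact: h1.
apply: contra hne => /eqP e; apply/eqP/psum_inj => k; rewrite leq_eqVlt => /predU1P[->//|hk].
apply/eqP; rewrite eqn_leq h1 /= leqNgt; apply/negP => hlt.
move: e; rewrite /Nsum (bigD1 (Ordinal hk)) //= [RHS](bigD1 (Ordinal hk)) //=.
have : (\sum_(i < n | i != Ordinal hk) psum m i <= \sum_(i < n | i != Ordinal hk) psum lam i)%N.
  by apply: leq_sum => i _; exact: h1.
by move: (bigop _ _ _) (bigop _ _ _) => a b; lia.
Qed.

Lemma psumE m k : (k <= n)%N -> psum m k = (\sum_(i < n | (i < k)%N) m i)%N.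
Proof.
elim: k => [|k IH] hk; first by rewrite /psum take0 big_pred0.
rewrite (psumS m (Ordinal hk)) (IH (ltnW hk)) [RHS](bigD1 (Ordinal hk)) //= addnC.
congr (_ + _)%N; apply: eq_bigl => i.
by rewrite -val_eqE /=; lia.
Qed.

Variable R : realType.

Definition wedge (s : R) (i : 'I_n) : R := \prod_(k < n | (i < k)%N) s.

Lemma prod_wedge s m : \prod_i wedge s i ^+ m i = s ^+ Nsum m.
Proof.
have ex := big_morph (fun k => s ^+ k) (exprD s) (expr0 s).
rewrite /Nsum ex; under [RHS]eq_bigr => k _ do rewrite psumE ?(ltnW (ltn_ord k)) // ex.
rewrite [RHS](exchange_big_dep predT) //=; apply: eq_bigr => i _.
by rewrite /wedge prodrXl.
Qed.

(** Along [wedge s] the monomial of lam outgrows all others; without it f would be too small for the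
    lower bound. With C the sum of the absolute coefficients, s f <= C s^N contradicts f >= s^N as
    soon as s > C, whence the choice s = C + 1. *)
Lemma growth_coef (f : {mpoly R[n]}) lam :
  (forall m, f@_m != 0 -> m = lam \/ (Nsum m < Nsum lam)%N) ->
  (forall x : 'I_n -> R, (forall i, 0 < x i) -> \prod_i x i ^+ lam i <= f.@[x]) ->
  f@_lam != 0.
Proof.
move=> hs hp; apply/eqP => c0.
pose C := \sum_(m <- msupp f) `|f@_m|; pose s : R := C + 1.
have C0 : 0 <= C by apply: sumr_ge0.
have s1 : 1 <= s by rewrite /s lerDr.
have s0 : 0 < s by lra.
have w0 i : 0 < wedge s i by apply: prodr_gt0.
have := hp _ w0; rewrite prod_wedge mevalE => h.
have : s * (\sum_(m <- msupp f) f@_m * \prod_i wedge s i ^+ m i) <= C * s ^+ Nsum lam.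
  rewrite mulr_sumr /C mulr_suml big_seq [leRHS]big_seq; apply: ler_sum => m hm.
  rewrite prod_wedge mulrCA -exprS; apply: le_trans (ler_wpM2r _ (ler_norm _)) _.
    by rewrite exprn_ge0 // ltW.
  rewrite ler_wpM2l // ler_weXn2l //.
  case: (hs m) => //; first by rewrite -mcoeff_msupp.
  by move=> em; move: hm; rewrite mcoeff_msupp em c0 eqxx.
have sN : 0 < s ^+ Nsum lam by rewrite exprn_gt0.
move: (\sum_(m <- _) _ * _) h => V h1 h2; have : s * s ^+ Nsum lam <= C * s ^+ Nsum lam.
  by apply: le_trans h2; rewrite ler_pM2l.
by rewrite ler_pM2r // /s; lra.
Qed.

End Growth.

(** * Agreement with the specialisation used in the statement *)

Section Specialise.
Variables (R : realType) (t : R) (n : nat).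

Lemma relK_spec r v : relK iotaF (ev t) r v <-> spec_q1_to t r v.
Proof.
split=> [[d [p [nd h1 h2]]]|[a [b [nb -> ->]]]].
  have nid := iota_neq0 (@iotaF_inj) nd.
  exists p, d; split=> //; first by apply: (canRL (mulfK nid)); rewrite mulrC.
  by apply: (canRL (mulfK nd)); rewrite mulrC.
have nid := @iota_neq0 _ _ _ iotaF (ev t) (@iotaF_inj) b nb.
by exists b, a; split=> //; rewrite mulrC divfK.
Qed.

Lemma spec_q1E r v : relK iotaF (ev t) r v -> spec_q1 t r = v.
Proof.
move=> h; have h' := h; move/relK_spec: h' => h'.
have := @xgetPex R 0 [set u | spec_q1_to t r u]%classic (ex_intro _ v h').
by rewrite -/(spec_q1 t r) /= => /relK_spec h2; exact: (relK_fun (@iotaF_inj) h2 h).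
Qed.

Lemma value_q1E (x : 'I_n -> R) f g : Rel iotaF (ev t) f g -> value_q1 t x f = g.@[x].
Proof.
(* Specialising can only shrink the support, so g may be summed over the support of f, as [mmap]
   does. *)
move=> h; have -> : g = \sum_(m <- msupp f) g@_m *: 'X_[m].
  apply/mpolyP => m; rewrite raddf_sum /=.
  under eq_bigr do rewrite mcoeffZ mcoeffX.
  have [hm|hm] := boolP (m \in msupp f).
    rewrite (bigD1_seq m) ?msupp_uniq //= eqxx mulr1 big1 ?addr0 // => m' /negbTE ->.
    by rewrite mulr0.
  rewrite big_seq big1; last first.
    by move=> m' hm'; case: eqP => [e|_]; [rewrite -e hm' in hm|rewrite mulr0].
  apply: (relK_fun (@iotaF_inj) (Rel_coef m h)).
  by rewrite (memN_msupp_eq0 hm); exact: relK0.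
rewrite raddf_sum /value_q1 /mmap; apply: eq_bigr => m _ /=.
rewrite mevalZ (spec_q1E (Rel_coef m h)); congr (_ * _).
by rewrite /meval mmapX.
Qed.

End Specialise.

Section Final.
Variables (R : realType) (t : R) (n : nat) (lam : 'X_{1..n}).
Variables (F : 'X_{1..n} -> {mpoly Qqt[n]}) (E : {mpoly Qqt[n]}).
Hypothesis n2 : (1 < n)%N.
Hypothesis plam : is_partition lam.
Hypothesis wE : wt Kq Kt lam E.
Hypothesis hF : is_ASEP_family Kq Kt lam F.

Lemma ASEP_init_scale : E = E@_lam *: F lam.
Proof.
have [_ h1 hw] := ASEP_init hF.
exact: (wtK_unique n2 wE hw h1).
Qed.

Lemma ASEP_scale eta : E@_lam != 0 -> eta \in rearr lam -> F eta = (E@_lam)^-1 *: Gfam E eta.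
Proof.
move=> cn; have [d] := ubnP (mes eta); elim: d eta => // d IH eta hd he.
have [i ai|na] := pickP (ascent eta); last first.
  have -> : eta = lam by apply: no_ascent => // i; rewrite na.
  by rewrite (Gfam_lam E plam) {2}ASEP_init_scale scalerK.
have [hi hlt] := andP ai; have hs := swap_rearr i he.
have ds : (swap_comp i eta (ordS i) < swap_comp i eta i)%N by rewrite swap_compL swap_compR.
have := ASEP_swap hF hs hi ds; rewrite swap_compK => <-.
have := Gfam_swap n2 plam wE hs hi ds; rewrite swap_compK => <-.
rewrite IH //; last by have := mes_swap ai; lia.
exact: opTZ.
Qed.

End Final.

Theorem theorem1p1 (R : realType) (n : nat) (lam : 'X_{1..n})
    (x : 'I_n -> R) (t : R) (F : 'X_{1..n} -> {mpoly Qqt[n]}) :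
  (2 <= n)%N ->
  is_partition lam ->
  (exists i, lam i = 0%N) ->
  (forall i, 0 < x i) ->
  0 <= t < 1 ->
  is_ASEP_family Kq Kt lam F ->
  (forall eta m, eta \in rearr lam -> regular_q1 t (F eta)@_m) /\
  (forall pi : 'X_{1..n} -> R,
     stationary lam x t pi <->
     (forall eta, eta \in rearr lam ->
        pi eta = value_q1 t x (F eta) / value_q1 t x (MacdonaldP lam F))).
Proof.
move=> n2 plam /has0P lam0 hx t01 hF.
have [E [Eh [wE rE pE]]] := good_exists t01 n2 plam lam0.
have cE := ASEP_init_scale n2 wE hF.
(* Triangularity was not part of the construction of E; it is borrowed from [F lam], of which E is a
   multiple, and restricts the support of Eh. *)
have ch : Eh@_lam != 0.
  apply: growth_coef pE => m nm; have [->|ne] := eqVneq m lam; [by left|right].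
  apply: Nsum_lt => //; have [hs _ _] := ASEP_init hF; apply: hs.
  have := relK_neq0 (@iotaF_inj) (Rel_coef m rE) nm.
  by rewrite cE mcoeffZ mulf_eq0 negb_or mcoeff_msupp => /andP[].
have rc := Rel_coef lam rE; have cn := relK_neq0 (@iotaF_inj) rc ch.
have rF eta : eta \in rearr lam -> Rel iotaF (ev t) (F eta) ((Eh@_lam)^-1 *: Gh t Eh eta).
  move=> he; rewrite (ASEP_scale n2 plam wE hF cn he); apply: RelZ.
    exact: (relKV (@iotaF_inj) rc ch).
  exact: Rel_fam.
split=> [eta m he|pi].
  by exists ((Eh@_lam)^-1 *: Gh t Eh eta)@_m; apply/relK_spec; apply: Rel_coef; exact: rF.
have rP : Rel iotaF (ev t) (MacdonaldP lam F) (\sum_(eta <- rearr lam) (Eh@_lam)^-1 *: Gh t Eh eta).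
  exact: Rel_sum.
have vE eta : eta \in rearr lam -> value_q1 t x (F eta) / value_q1 t x (MacdonaldP lam F) =
    Fv t Eh x eta / \sum_(e <- rearr lam) Fv t Eh x e.
  move=> he; rewrite (value_q1E x (rF eta he)) (value_q1E x rP) -scaler_sumr !mevalZ raddf_sum /=.
  rewrite invfM mulrACA divff ?mul1r //; by rewrite invr_eq0.
have st := stationary_unique t01 n2 plam lam0 (Fv_exch n2 plam wE rE) (Fv_rot t01 n2 plam wE rE)
  (@Fv_poly R t n Eh) (Fv_pos t plam pE) pi hx.
by split=> [/st h eta he|h]; [rewrite vE // h|apply/st => eta he; rewrite h // vE].
Qed.
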